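(* Let $E$ be a unimodular locally compact group with countable base and let $\pi$ be a right Haar measure on $E$. Let $X$ be a random walk on $E$ with law $v$ and transition operator $P$, where $v$ is compactly supported, and let $R$ be the convergence parameter of $X$. Assume: (A) for every nonnegative $f\in C_0(E)$ there exist $\gamma>0$ and an integer $j\ge 1$ such that $v^j\ge \gamma\,(f\pi)$; (B) there exists a unique (up to a positive factor) $R$-invariant measure $\nu$ for $X$ taking finite values on compact sets. Let $\varphi$ be the unique continuous exponential on $E$ with $\int\varphi\,dv=1/R$. Then there exists a set $\mathcal N$ of positive integers of density $0$ such that $$\lim_{\substack{n\to\infty\\ n\notin\mathcal N}}\frac{\varkappa(P^nf)}{\mu(P^ng)}=\frac{\varkappa(\varphi)\,\pi(\varphi^{-1}f)}{\mu(\varphi)\,\pi(\varphi^{-1}g)}=\frac{\varkappa(\varphi)\,\nu(f)}{\mu(\varphi)\,\nu(g)}$$ and $$\lim_{\substack{n\to\infty\\ n\notin\mathcal N}}\frac{\mu(P^{n+m}g)}{\mu(P^ng)}=\frac1{R^m},\qquad m\ge1,$$ for all bounded Borel functions $f,g$ on $E$ vanishing outside some compact set with $\nu(g)\ne0$, and all probability measures $\mu$ and $\varkappa$ on the Borel $\sigma$-algebra of $E$ of the form $h\pi$ with $h\in S_0$. Here $S_0$ is the family of all bounded Borel functions $h:E\to[0,\infty)$ such that the set $\{x\in E: h(x)>0\}$ is relatively compact and has positive $\pi$-measure.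
   Context: Setting: $\mathcal E$ is the Borel $\sigma$-algebra of $E$ and $\mathcal E_+=\{A\in\mathcal E:\pi(A)>0\}$. A random walk $X=(X_n)_{n\ge0}$ on $E$ with law $v$ (a probability measure on $\mathcal E$) is the homogeneous Markov chain on $(E,\mathcal E)$ with transition probabilities $p(x,A)=v(x^{-1}A)$; its transition operator is $Pf(x)=\int f(xy)\,v(dy)$. $v^j$ is the $j$-th convolution power of $v$. $C_0(E)$ is the set of continuous compactly supported functions on $E$. For a measure $\mu$ and function $f$, $\mu(f)=\int f\,d\mu$, and $f\pi$ denotes the measure $A\mapsto\int_A f\,d\pi$. $X$ is spread out if for some $n\ge1$ the measure $v^n$ is nonsingular with respect to $\pi$. A spread out random walk is irreducible if for every $x\in E$ and $A\in\mathcal E_+$ there is $n\ge1$ with $P^n1_A(x)>0$ (for spread out walks this is equivalent to irreducibility in the traditional sense of random walks on groups). It is aperiodic if there are no $d\ge2$ and disjoint nonempty sets $E_0,\dots,E_{d-1}\in\mathcal E$ with $\pi(E\setminus\bigcup_iE_i)=0$ and $p(x,E_{i+1 \bmod d})=1$ for all $x\in E_i$. Assumption (A) is known to imply that $X$ is spread out, irreducible and aperiodic. Small functions and measures (in the sense of Nummelin): a measurable $s:E\to[0,\infty)$ with $\pi(s)>0$ and a nonzero measure $\mu$ on $\mathcal E$ are called a small function and a small measure, respectively, if they occur in an inequality $P^m1_A(x)\ge\beta\,s(x)\mu(A)$ for all $x\in E$, $A\in\mathcal E$, with some integer $m\ge1$ and $\beta>0$. The convergence parameter $R\ge1$ of an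 irreducible $X$ is the radius of convergence of the power series $\sum_n r^n\mu(P^ns)$, where $s$ is a small function and $\mu$ a small measure; it does not depend on the choice of $s$ and $\mu$. A measure $\mu$ on $\mathcal E$ is $r$-invariant for $X$ ($0<r<\infty$) if $\mu(E)>0$ and $\mu=r\,\mu P$, where $\mu P(A)=\int p(x,A)\,\mu(dx)$. An exponential on $E$ is a Borel function $\varphi:E\to(0,\infty)$ with $\varphi(xy)=\varphi(x)\varphi(y)$ for all $x,y\in E$. It is known that under (B) there exists a unique continuous exponential $\varphi$ with $\int\varphi\,dv=1/R$. A set $\mathcal N$ of positive integers has density $0$ if $\lim_{n\to\infty}\frac1n\,\#\{m\in\mathcal N: m\le n\}=0$. *)

(* Defs.v *)
From HB Require Import structures.
From mathcomp Require Import all_boot all_order all_algebra finmap.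
From mathcomp Require Import all_classical all_reals all_analysis.

Set Implicit Arguments.
Unset Strict Implicit.
Unset Printing Implicit Defensive.

Import Order.TTheory GRing.Theory Num.Theory.
Import numFieldNormedType.Exports.

Local Open Scope classical_set_scope.
Local Open Scope ring_scope.

(* A topological group carrying its Borel sigma-algebra. *)
HB.mixin Record isBorelTopologicalGroup (d : measure_display) E
    of Group E & Topological E & Measurable d E := {
  mulg_continuous : continuous (fun xy : E * E => (xy.1 * xy.2)%g) ;
  invg_continuous : continuous (fun x : E => (x^-1)%g) ;
  measurable_openE : @measurable d E = <<s [set U : set E | open U] >>
}.

#[short(type="borelGroupType")]
HB.structure Definition BorelGroup (d : measure_display) :=
  {E of isBorelTopologicalGroup d E & Group E & Topological E & Measurable d E}.

(* Locally compact groups are taken to be Hausdorff. *)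
Definition lc_group_countable_base d (E : borelGroupType d) : Prop :=
  [/\ hausdorff_space E, locally_compact [set: E] & @second_countable E].

Section measures_on_a_group.
Context d (E : borelGroupType d) (R : realType).
Implicit Types (mu nu : {measure set E -> \bar R}) (A K : set E).

Definition finite_on_compacts mu : Prop :=
  forall K, compact K -> (mu K < +oo)%E.

(* Regularity is omitted: it is automatic for a measure finite on compact sets
   of a locally compact Hausdorff space with countable base. *)
Definition right_haar mu : Prop :=
  [/\ (0 < mu setT)%E, finite_on_compacts mu &
      forall A (x : E), measurable A -> mu [set (a * x)%g | a in A] = mu A].

Definition left_haar mu : Prop :=
  [/\ (0 < mu setT)%E, finite_on_compacts mu &
      forall A (x : E), measurable A -> mu [set (x * a)%g | a in A] = mu A].

Definition unimodular : Prop := forall mu, right_haar mu <-> left_haar mu.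

Definition msupport mu : set E :=
  [set x | forall U : set E, open U -> U x -> (0 < mu U)%E].

Definition compactly_supported mu : Prop := compact (msupport mu).

(* mu = h pi *)
Definition has_density mu nu (h : E -> R) : Prop :=
  forall A, measurable A -> mu A = (\int[nu]_(x in A) (h x)%:E)%E.

Definition C0 (f : E -> R) : Prop :=
  continuous f /\ compact (closure [set x | f x != 0]).

Definition bounded_borel (f : E -> R) : Prop :=
  measurable_fun [set: E] f /\ exists M : R, forall x, `|f x| <= M.

Definition vanishes_off_compact (f : E -> R) : Prop :=
  exists2 K : set E, compact K & forall x, ~ K x -> f x = 0.

Definition S0 (pi : {measure set E -> \bar R}) (h : E -> R) : Prop :=
  [/\ bounded_borel h, (forall x, 0 <= h x),
      precompact [set x | 0 < h x] & (0 < pi [set x | (0 < h x)%R])%E].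

Definition exponential (phi : E -> R) : Prop :=
  [/\ measurable_fun [set: E] phi, (forall x, 0 < phi x) &
      forall x y : E, phi (x * y)%g = phi x * phi y].

(* (v * nu)(A) = \int v(dx) nu(x^{-1} A); convpow v 0 is the Dirac mass at 1. *)
Definition convolution (v nu : set E -> \bar R) (A : set E) : \bar R :=
  (\int[v]_x nu [set (x^-1 * a)%g | a in A])%E.

Definition convpow (v : set E -> \bar R) (j : nat) : set E -> \bar R :=
  iter j (convolution v) (\d_(1%g : E) : set E -> \bar R).

End measures_on_a_group.

Section random_walk.
Context d (E : borelGroupType d) (R : realType).
(* v is the law of the walk, pi the reference (right Haar) measure. *)
Variables (v : probability E R) (pi : {measure set E -> \bar R}).

Definition rw_kernel (x : E) (A : set E) : \bar R :=
  v [set (x^-1 * a)%g | a in A].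

Definition rw_op (f : E -> \bar R) (x : E) : \bar R :=
  (\int[v]_y f (x * y)%g)%E.

(* mu (P^n f) *)
Definition int_rw_op (mu : {measure set E -> \bar R}) (n : nat) (f : E -> R) : R :=
  fine (\int[mu]_x iter n rw_op (EFin \o f) x)%E.

Definition minorization (m : nat) (beta : R) (s : E -> R)
    (mu : {measure set E -> \bar R}) : Prop :=
  [/\ (1 <= m)%N, 0 < beta &
      forall (x : E) (A : set E), measurable A ->
        ((beta * s x)%:E * mu A <= iter m rw_op (EFin \o \1_A) x)%E].

Definition pos_fun (s : E -> R) : Prop :=
  [/\ measurable_fun [set: E] s, (forall x, 0 <= s x) &
      (0 < \int[pi]_x (s x)%:E)%E].

Definition pos_measure (mu : {measure set E -> \bar R}) : Prop :=
  (0 < mu [set: E])%E.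

Definition small_function (s : E -> R) : Prop :=
  pos_fun s /\
  exists m beta mu, pos_measure mu /\ minorization m beta s mu.

Definition small_measure (mu : {measure set E -> \bar R}) : Prop :=
  pos_measure mu /\
  exists m beta s, pos_fun s /\ minorization m beta s mu.

Definition radius_of_convergence (a : R^nat) : \bar R :=
  ereal_sup [set (`|x|)%:E | x in [set x : R | cvgn (pseries a x)]].

(* A minorization with A = E forces small functions to be bounded and small
   measures to be finite, so the coefficients mu (P^n s) are finite and taking
   their real value loses nothing. *)
Definition convergence_parameter (r : \bar R) : Prop :=
  exists s mu, [/\ small_function s, small_measure mu &
    radius_of_convergence (fun n => int_rw_op mu n s) = r].

Definition invariant_measure (r : R) (mu : {measure set E -> \bar R}) : Prop :=
  [/\ 0 < r, (0 < mu [set: E])%E &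
      forall A, measurable A ->
        mu A = (r%:E * \int[mu]_x rw_kernel x A)%E].

Definition conditionA : Prop :=
  forall f : E -> R, C0 f -> (forall x, 0 <= f x) ->
  exists gamma : R, exists j : nat, [/\ 0 < gamma, (1 <= j)%N &
    forall A, measurable A ->
      (gamma%:E * \int[pi]_(x in A) (f x)%:E <= convpow v j A)%E].

(* nu is, up to a positive factor, the unique r-invariant measure finite on
   compact sets. *)
Definition unique_invariant_measure (r : R)
    (nu : {measure set E -> \bar R}) : Prop :=
  [/\ invariant_measure r nu, finite_on_compacts nu &
      forall nu' : {measure set E -> \bar R},
        invariant_measure r nu' -> finite_on_compacts nu' ->
        exists2 c : R, 0 < c & forall A, measurable A -> nu' A = (c%:E * nu A)%E].

End random_walk.

Definition density_zero (R : realType) (N : set nat) : Prop :=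
  (fun n : nat => (#|` fset_set (N `&` [set m | (m <= n)%N]) |)%:R / n%:R : R)
    @ \oo --> (0 : R).

(* Main.v *)
Require Import Defs.
From HB Require Import structures.
From mathcomp Require Import all_boot all_order all_algebra finmap.
From mathcomp Require Import all_classical all_reals all_analysis measurable_realfun.
From mathcomp Require Import ring lra zify.

Set Implicit Arguments.
Unset Strict Implicit.
Unset Printing Implicit Defensive.

Import Order.TTheory GRing.Theory Num.Theory.
Import numFieldNormedType.Exports.

Local Open Scope classical_set_scope.
Local Open Scope ring_scope.

(* Put U = r P, so that U phi = phi.  By condition (A) some U^k is, up to a part
   of small mass, convolution by a bounded compactly supported density, and some
   U^l and U^(l+1) both dominate such a convolution.  In a long product of
   factors U these blocks occur with a well concentrated frequency, so that
   inserting one more block shows, for suitable consecutive delays t and t+1,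
       (1 - del) U^n f <= U^(n+t) f + c q^n phi,   q < 1.
   Hence a_n = <1_K, U^n 1_K>, where <h, f> is the integral of h f against pi,
   is almost nondecreasing; it is bounded, and subexponential because r is the
   convergence parameter.  Therefore a_(n+1) / a_n tends to 1 off a set N of
   density 0.  Since <h, U^n f> and its complement in a combination of shifts of
   a_n are both almost nondecreasing, <h, U^(n+1) f> - <h, U^n f> = o(a_n) off N.

   An ultrafilter limit B(h, f) of <h, U^n f> / a_n is then U-invariant in f and
   absolutely continuous in each argument, hence given by measures.  By (B),
   B(h, f) = c(h) nu(f), and nu is a multiple of phi^-1 pi, which is r-invariant.
   Invariance of P under left translations gives c(h(a^-1 .)) = phi(a) c(h), so c
   is a multiple of h |-> pi(h phi) by uniqueness of Haar measure.  The limit does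
   not depend on the ultrafilter, so the ratios converge off N. *)

(** * Borel structure of the group *)

Section countable_base.
Context (T : topologicalType).

(** Beyond subexponentiality nothing is known about the decay of a_n, and the operators involved
    need not commute; U^n and U^(n+t) are therefore compared by counting. If U^k = A + B with B of
    small mass, then inserting U^k at the T places of U^(T-1) gives T U^(T+k-1) in total. If also
    gam A <= U^l, the insertions of gam A are blocks in products of length T+l-1, and an exponential
    Chebyshev bound shows that about gam T of them count. The Chebyshev error is the source of the
    geometric term. Two consecutive delays are carried along because only long delays are
    controlled, while a one-step increment is the difference of the increments over t+1 steps from n
    and over t steps from n+1. In logarithms both are almost nonnegative and bounded sums telescope,
    so large ones are rare. Ultrafilter limits exist for all pairs (h, f) at once but are only
    finitely additive. Countable additivity comes from bounds by Haar mass, uniform in n because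
    smoothing on the left commutes with steps on the right. *)

Lemma second_countable_seq : @second_countable T ->
  exists F : nat -> set T, (forall n, open (F n)) /\
    forall x U, nbhs x U -> exists2 n, F n x & F n `<=` U.
Proof.
move=> [B /countable_injP[f finj] [Bo Bb]].
pose F n := xget set0 [set U | B U /\ f U = n].
have FE U : B U -> F (f U) = U.
  move=> BU; rewrite /F; case: xgetP => [V _ [BV fV]|/(_ U)]; last first.
    by move=> /(_ (conj BU erefl)).
  by apply: finj => //; rewrite inE.
exists F; split=> [n|x U xU].
  rewrite /F; case: xgetP => [V _ [BV _]|_]; [exact: Bo|exact: open0].
have [V [BV Vx] VU] := Bb x U xU.
by exists (f V); rewrite FE.
Qed.

End countable_base.

Section borel_group.
Context d (E : borelGroupType d) (R : realType).
Implicit Types (U K : set E) (x y : E).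

Lemma borel_open U : open U -> measurable U.
Proof. by move=> oU; rewrite measurable_openE; exact: sub_sigma_algebra. Qed.

Lemma borel_closed U : closed U -> measurable U.
Proof.
move=> cU; rewrite -(setCK U); apply: measurableC; apply: borel_open.
by rewrite openC.
Qed.

Lemma borel_compact K : hausdorff_space E -> compact K -> measurable K.
Proof. by move=> hE /(compact_closed hE)/borel_closed. Qed.

Lemma continuous_borel (f : E -> E) : continuous f -> measurable_fun setT f.
Proof.
move=> cf; apply: (measurability [set U : set E | open U]).
  exact: measurable_openE.
move=> _ [U oU <-]; rewrite setTI; apply: borel_open.
by move/continuousP : cf; apply.
Qed.

Lemma continuous_borel_real (f : E -> R) :
  continuous f -> measurable_fun setT f.
Proof.
move=> cf; apply: (measurability _ (measurable_realfun.RGenOpens.measurableE R)).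
move=> _ [_ [a [b ->]] <-]; rewrite setTI; apply: borel_open.
by move/continuousP : cf; apply; exact: interval_open.
Qed.

(** Continuity alone does not give this, since the sigma-algebra on [E * E] is the product one. The
    countable base writes the preimage of an open set as a countable union of open rectangles. *)
Lemma mulg_borel : @second_countable E ->
  measurable_fun setT (fun xy : E * E => (xy.1 * xy.2)%g).
Proof.
move=> /second_countable_seq[F [Fo Fb]].
apply: (measurability [set U : set E | open U]).
  exact: measurable_openE.
move=> _ [U oU <-]; rewrite setTI.
pose G (nm : nat * nat) := if pselect (F nm.1 `*` F nm.2 `<=`
    (fun xy : E * E => (xy.1 * xy.2)%g) @^-1` U) then F nm.1 `*` F nm.2 else set0.
rewrite [X in measurable X](_ : _ = \bigcup_nm G nm).
  apply: countable_bigcupT_measurable => // nm.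
  rewrite /G; case: pselect => ?; last exact: measurable0.
  by apply: measurableX; exact: borel_open.
apply/seteqP; split=> [[x y] /= xyU|[x y] [nm _]]; last first.
  by rewrite /G; case: pselect => [h|_ //]; exact: h.
have : nbhs (x, y) ((fun xy : E * E => (xy.1 * xy.2)%g) @^-1` U).
  exact: (@mulg_continuous _ E (x, y)) (open_nbhs_nbhs (conj oU xyU)).
move=> [[V W] /= [xV yW] VW].
have [n Fnx FnV] := Fb _ _ xV.
have [m Fmy FmW] := Fb _ _ yW.
exists (n, m) => //; rewrite /G; case: pselect => // h; exfalso; apply: h.
by move=> [a b] /= [Fa Fb']; apply: (VW (a, b)); split; [exact: FnV|exact: FmW].
Qed.

Lemma mull_continuous x : continuous (fun y : E => (x * y)%g).
Proof.
move=> y; apply: (@continuous_comp E (E * E)%type E (fun y => (x, y))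
  (fun xy => (xy.1 * xy.2)%g)); last exact: mulg_continuous.
by apply: cvg_pair => /=; [exact: cvg_cst|exact: cvg_id].
Qed.

Lemma mulr_continuous x : continuous (fun y : E => (y * x)%g).
Proof.
move=> y; apply: (@continuous_comp E (E * E)%type E (fun y => (y, x))
  (fun xy => (xy.1 * xy.2)%g)); last exact: mulg_continuous.
by apply: cvg_pair => /=; [exact: cvg_id|exact: cvg_cst].
Qed.

Definition mulset (A B : set E) : set E :=
  [set z | exists x y, [/\ A x, B y & z = (x * y)%g]].
Definition invset (A : set E) : set E := [set x | A (x^-1)%g].

Lemma compact_mulset A B : compact A -> compact B -> compact (mulset A B).
Proof.
move=> cA cB.
rewrite (_ : mulset A B = (fun xy : E * E => (xy.1 * xy.2)%g) @` (A `*` B)).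
  apply: continuous_compact; last exact: compact_setX.
  by apply: continuous_subspaceT => z; exact: mulg_continuous.
apply/seteqP; split=> [_ [x [y [Ax By ->]]]|_ [[x y] [/= Ax By] <-]].
  by exists (x, y).
by exists x, y.
Qed.

Lemma compact_invset A : compact A -> compact (invset A).
Proof.
move=> cA; rewrite (_ : invset A = (fun x : E => (x^-1)%g) @` A).
  apply: continuous_compact => //.
  by apply: continuous_subspaceT => z; exact: invg_continuous.
apply/seteqP; split=> [x Ax|_ [x Ax <-]].
  by exists (x^-1)%g => //; rewrite monoid.invgK.
by rewrite /invset /= monoid.invgK.
Qed.

Hypothesis E_lc : lc_group_countable_base E.
Let hE : hausdorff_space E. Proof. by case: E_lc. Qed.

(** Every point is interior to some [K n], because a basic neighborhood of it has a compact
    superset. Hence a compact set lies in a single [K n], which a mere countable cover would not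
    ensure. *)
Lemma compact_exhaustion : exists K : nat -> set E,
  [/\ forall n, compact (K n), {homo K : m n / (m <= n)%N >-> m `<=` n},
      \bigcup_n K n = setT &
      forall C : set E, compact C -> exists n, C `<=` K n].
Proof.
case: E_lc => _ lc /second_countable_seq[F [Fo Fb]].
pose G n := xget set0 [set C : set E | compact C /\ F n `<=` C].
have Gc n : compact (G n).
  by rewrite /G; case: xgetP => [V _ []//|_]; exact: compact0.
have FG n : (exists C : set E, compact C /\ F n `<=` C) -> F n `<=` G n.
  by move=> [C CF]; rewrite /G; case: xgetP => [V _ []//|/(_ C)].
pose K n := \big[setU/set0]_(i < n) G i.
have KS n : K n.+1 = K n `|` G n by rewrite /K big_ord_recr.
have Kc n : compact (K n).
  elim: n => [|n IH]; first by rewrite /K big_ord0; exact: compact0.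
  by rewrite KS; exact: compactU.
have Kh : {homo K : m n / (m <= n)%N >-> m `<=` n}.
  move=> m n /subnK <-; elim: (n - m)%N => [//|k IH].
  by apply: subset_trans IH _; rewrite addSn KS; exact: subsetUl.
have near_x x : exists n, nbhs x (K n).
  have [C] := lc x Logic.I; rewrite withinET => xC [cC _].
  have [n Fnx FnC] := Fb _ _ xC.
  exists n.+1; rewrite KS; apply: (@filterS _ _ _ (F n)).
    apply: subset_trans (@subsetUr _ _ _).
    by apply: FG; exists C.
  by apply: open_nbhs_nbhs; split.
exists K; split => //.
  apply/seteqP; split=> // x _; have [n xn] := near_x x.
  by exists n => //; exact: nbhs_singleton.
move=> C cC; move/compact_near_coveringP : cC.
move=> /(_ nat \oo (fun n x => K n x) _) [].
  move=> x _; have [n xn] := near_x x.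
  exists (K n, [set m | (n <= m)%N]) => /=.
    by split => //; exists n.
  by move=> [y m] [/= Ky nm]; exact: (Kh n).
by move=> n _ /(_ n (leqnn n)) CK; exists n.
Qed.

(** Condition (A) concerns continuous functions, while the estimates below use indicators of compact
    sets; a finite sum of bumps links the two. *)
Lemma C0_dominates K : compact K ->
  exists f : E -> R, [/\ C0 f, (forall x, 0 <= f x) & forall x, K x -> 1 <= f x].
Proof.
case: (E_lc) => _ lc _ cK.
have /choice[F FP] (x : E) : exists fx : E -> R, [/\ continuous fx,
    (forall y, 0 <= fx y), fx x = 2 &
    exists2 C, compact C & forall y, ~ C y -> fx y = 0].
  have [C] := lc x Logic.I; rewrite withinET => xC [cC _].
  have cr := @locally_compact_completely_regular E R lc hE.
  have [|g [cg g01 gx gC]] := (@uniform_separatorP _ R _ _).1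
    (cr x (~` C°) (open_closedC (@open_interior _ C)) _).
    by apply; exact: xC.
  (* The value 2 at [x] makes the set where the bump exceeds 1 an open neighborhood of [x]. *)
  exists (fun y => 2 * (1 - g y)); split.
  - move=> y; apply: cvgM; first exact: cvg_cst.
    by apply: cvgB; [exact: cvg_cst|exact: cg].
  - move=> y; have /= := g01 (g y) (ex_intro2 _ _ y Logic.I erefl).
    by rewrite in_itv /= => /andP[_ g1]; rewrite mulr_ge0 // subr_ge0.
  - by rewrite (gx (g x)) ?subr0 ?mulr1 //; exists x.
  - exists C => // y nCy; rewrite (gC (g y)) ?subrr ?mulr0 //.
    by exists y => // /interior_subset.
have Uo x : open [set y | 1 < F x y].
  have [cF _ _ _] := FP x.
  by apply: (@open_comp _ _ (F x) [set z | 1 < z]) => [z _|];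
    [exact: cF|exact: open_gt].
have : cover_compact K by rewrite -compact_cover.
move=> /(_ E setT (fun x => [set y | 1 < F x y])) [].
- by move=> x _; exact: Uo.
- by move=> x Kx; exists x => //=; have [_ _ -> _] := FP x; lra.
move=> D _ KD.
have [f [cf f0 fD [C cC fC]]] : exists f : E -> R, [/\ continuous f,
    forall y, 0 <= f y, (forall x y, x \in (D : seq E) -> 1 < F x y -> 1 <= f y) &
    exists2 C, compact C & forall y, ~ C y -> f y = 0].
  elim: (D : seq E) => [|x s [f [cf f0 fs [C cC fC]]]].
    exists (fun=> 0); split => //; first by move=> y; exact: cvg_cst.
    by exists set0; first exact: compact0.
  have [cF F0 Fx [B cB FB]] := FP x.
  exists (fun y => F x y + f y); split.
  - by move=> y; apply: cvgD; [exact: cF|exact: cf].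
  - by move=> y; rewrite addr_ge0.
  - move=> z y; rewrite inE => /orP[/eqP ->|zs] h.
      by apply: ler_wpDr => //; exact: ltW.
    by apply: ler_wpDl => //; exact: fs h.
  - exists (B `|` C); first exact: compactU.
    by move=> y /not_orP[/FB -> /fC ->]; rewrite addr0.
exists f; split => //.
  split => //; apply: (@subclosed_compact _ _ C) => //.
    exact: closed_closure.
  have /closure_id -> := compact_closed hE cC.
  by apply: closureS => x /=; apply: contra_neqP => /fC.
by move=> x /KD[z zD]; exact: fD.
Qed.
End borel_group.

(** * Monotone functionals *)

Import HBNNSimple.

Section monotone_functionals.
Context d (T : measurableType d) (R : realType).
Local Open Scope ereal_scope.
Implicit Types (f g : T -> \bar R) (L : (T -> \bar R) -> \bar R).

Definition nnm f := measurable_fun [set: T] f /\ forall x, 0 <= f x.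

(** Covers integrals, point evaluations, iterates of the walk operator and their compositions, so
    that the passage from indicators to nonnegative measurable functions is made once for all of
    them. *)
Record monotone_functional L : Prop := MonotoneFunctional {
  mf_ge0 : forall f, nnm f -> 0 <= L f ;
  mf_le : forall f g, nnm f -> nnm g -> (forall x, f x <= g x) -> L f <= L g ;
  mf_D : forall f g, nnm f -> nnm g -> L (f \+ g) = L f + L g ;
  mf_Z : forall (c : R) f, (0 <= c)%R -> nnm f ->
    L (fun x => c%:E * f x) = c%:E * L f ;
  mf_cvg : forall f_ : nat -> T -> \bar R, (forall n, nnm (f_ n)) ->
    (forall x, nondecreasing_seq (f_ ^~ x)) ->
    L (f_ n) @[n --> \oo] --> L (fun x => limn (f_ ^~ x)) }.

Lemma nnm_indic A : measurable A -> nnm (EFin \o (\1_A : T -> R)).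
Proof.
move=> mA; split; first by apply/measurable_EFinP; exact: measurable_indic.
by move=> x /=; rewrite lee_fin.
Qed.

Lemma nnmD f g : nnm f -> nnm g -> nnm (f \+ g).
Proof.
move=> [mf f0] [mg g0]; split; first exact: emeasurable_funD.
by move=> x; rewrite adde_ge0.
Qed.

Lemma nnmM f g : nnm f -> nnm g -> nnm (fun x => f x * g x).
Proof.
move=> [mf f0] [mg g0]; split; first exact: emeasurable_funM.
by move=> x; rewrite mule_ge0.
Qed.

Lemma nnm_cst (c : R) : (0 <= c)%R -> nnm (fun=> c%:E).
Proof. by move=> c0; split => // x; rewrite lee_fin. Qed.

Lemma nnmZ (c : R) f : (0 <= c)%R -> nnm f -> nnm (fun x => c%:E * f x).
Proof. by move=> c0; apply: nnmM; exact: nnm_cst. Qed.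

Lemma nnm_sum (I : eqType) (s : seq I) (F : I -> T -> \bar R) :
  (forall i, i \in s -> nnm (F i)) -> nnm (fun x => \sum_(i <- s) F i x).
Proof.
elim: s => [|i s IH] Fs.
  rewrite (_ : (fun=> _) = (fun=> 0%:E)); first exact: nnm_cst.
  by apply/funext => x; rewrite big_nil.
rewrite (_ : (fun=> _) = F i \+ (fun x => \sum_(j <- s) F j x)); last first.
  by apply/funext => x; rewrite big_cons.
apply: nnmD; first by apply: Fs; rewrite inE eqxx.
by apply: IH => j js; apply: Fs; rewrite inE js orbT.
Qed.

Lemma mf_sum L (I : eqType) (s : seq I) (F : I -> T -> \bar R) :
  monotone_functional L -> (forall i, i \in s -> nnm (F i)) ->
  L (fun x => \sum_(i <- s) F i x) = \sum_(i <- s) L (F i).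
Proof.
move=> mL; elim: s => [|i s IH] Fs.
  rewrite big_nil (_ : (fun=> _) = (fun x => 0%:E * (fun=> 0%:E) x)); last first.
    by apply/funext => x; rewrite big_nil mul0e.
  by rewrite (mf_Z mL) // ?mul0e //; exact: nnm_cst.
have Fs' j : j \in s -> nnm (F j) by move=> js; apply: Fs; rewrite inE js orbT.
rewrite big_cons -IH // -(mf_D mL).
- by congr L; apply/funext => x /=; rewrite big_cons.
- by apply: Fs; rewrite inE eqxx.
- exact: nnm_sum.
Qed.

Lemma mf_le_indic L1 L2 : monotone_functional L1 -> monotone_functional L2 ->
  (forall A, measurable A -> L1 (EFin \o \1_A) <= L2 (EFin \o \1_A)) ->
  forall f, nnm f -> L1 f <= L2 f.
Proof.
move=> mL1 mL2 L12 f [mf f0].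
pose g := nnsfun_approx measurableT mf.
have gn n : nnm (EFin \o g n).
  split; first by apply/measurable_EFinP.
  by move=> x; rewrite lee_fin.
have gf : f = (fun x => limn ((fun n => (EFin \o g n : T -> \bar R)) ^~ x)).
  apply/funext => x; apply/esym/cvg_lim => //.
  exact: (@cvg_nnsfun_approx _ _ _ _ measurableT f mf (fun y _ => f0 y) x Logic.I).
have gnd x : nondecreasing_seq ((fun n => (EFin \o g n : T -> \bar R)) ^~ x).
  move=> n m nm; rewrite lee_fin.
  by have /lefP := @nd_nnsfun_approx _ _ _ _ measurableT f mf n m nm; exact.
have L1g := mf_cvg mL1 gn gnd; have L2g := mf_cvg mL2 gn gnd.
rewrite gf; apply: (lee_cvg_to L1g L2g); apply: nearW => n.
rewrite (_ : EFin \o g n = (fun x => \sum_(y <- fset_set (range (g n)))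
    (y%:E * (EFin \o \1_(g n @^-1` [set y])) x))); last first.
  by apply/funext => x /=; rewrite fimfunE fsbig_finite//= sumEFin.
have y0 y : y \in fset_set (range (g n)) -> (0 <= y)%R.
  by rewrite in_fset_set // inE => -[x _ <-].
rewrite !mf_sum // => [|y ys|y ys].
- rewrite big_seq [leRHS]big_seq; apply: lee_sum => y ys.
  rewrite (mf_Z mL1) ?(mf_Z mL2); first last.
  - exact: nnm_indic.
  - exact: y0.
  - exact: nnm_indic.
  - exact: y0.
  by apply: lee_wpmul2l; [rewrite lee_fin y0|exact: L12].
- by apply: nnmZ; [exact: y0|exact: nnm_indic].
- by apply: nnmZ; [exact: y0|exact: nnm_indic].
Qed.

Lemma mf_eq_indic L1 L2 : monotone_functional L1 -> monotone_functional L2 ->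
  (forall A, measurable A -> L1 (EFin \o \1_A) = L2 (EFin \o \1_A)) ->
  forall f, nnm f -> L1 f = L2 f.
Proof.
move=> mL1 mL2 L12 f nf; apply/le_anti/andP; split; apply: mf_le_indic => //.
  by move=> A mA; rewrite L12.
by move=> A mA; rewrite L12.
Qed.

Lemma mf_eval x : monotone_functional (fun f => f x).
Proof.
split=> //.
- by move=> f [_].
- move=> f_ nf ndf.
  exact: (@ereal_nondecreasing_is_cvgn _ (f_ ^~ x)).
Qed.

Lemma mf_scale (c : R) L : (0 <= c)%R -> monotone_functional L ->
  monotone_functional (fun f => c%:E * L f).
Proof.
move=> c0 mL; split.
- by move=> f nf; rewrite mule_ge0 // ?lee_fin ?(mf_ge0 mL).
- by move=> f g nf ng fg; rewrite lee_wpmul2l ?lee_fin // (mf_le mL).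
- by move=> f g nf ng; rewrite (mf_D mL) // ge0_muleDr // (mf_ge0 mL).
- by move=> a f a0 nf; rewrite (mf_Z mL) // muleCA.
- move=> f_ nf ndf; apply: cvgeZl => //.
  exact: (mf_cvg mL).
Qed.

End monotone_functionals.
Hint Resolve nnmD nnmM nnmZ nnm_indic nnm_cst : core.

Section integral_functionals.
Context d (T : measurableType d) d' (T' : measurableType d') (R : realType).
Local Open Scope ereal_scope.

Lemma mf_comp (L : (T' -> \bar R) -> \bar R)
    (A : (T -> \bar R) -> T' -> \bar R) :
  monotone_functional L -> (forall f, nnm f -> nnm (A f)) ->
  (forall x, monotone_functional (A ^~ x)) ->
  monotone_functional (fun f => L (A f)).
Proof.
move=> mL nA mA; split.
- by move=> f nf; exact/(mf_ge0 mL)/nA.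
- move=> f g nf ng fg; apply: (mf_le mL); [exact: nA|exact: nA|].
  by move=> x; exact: (mf_le (mA x)).
- move=> f g nf ng; rewrite -(mf_D mL); [|exact: nA|exact: nA].
  by congr L; apply/funext => x /=; rewrite (mf_D (mA x)).
- move=> c f c0 nf; rewrite -(mf_Z mL) //; last exact: nA.
  by congr L; apply/funext => x /=; rewrite (mf_Z (mA x)).
- move=> f_ nf ndf; rewrite (_ : A _ = (fun x => limn (fun n => A (f_ n) x))).
    apply: (mf_cvg mL) => [n|x n m nm]; first exact: nA.
    by apply: (mf_le (mA x)) => // y; exact: ndf.
  by apply/funext => x; apply/esym/cvg_lim => //; exact: (mf_cvg (mA x)).
Qed.

Lemma mf_integral (mu : {measure set T -> \bar R}) :
  monotone_functional (fun f => \int[mu]_x f x).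
Proof.
split.
- by move=> f [mf f0]; exact: integral_ge0.
- by move=> f g [mf f0] [mg g0] fg; exact: ge0_le_integral.
- by move=> f g [mf f0] [mg g0]; rewrite ge0_integralD.
- by move=> c f c0 [mf f0]; rewrite ge0_integralZl_EFin.
- move=> f_ nf ndf; apply: cvg_monotone_convergence => //.
  + by move=> n; have [] := nf n.
  + by move=> n x _; have [_] := nf n.
Qed.

End integral_functionals.

(** * Convolutions and invariant integrals *)

Section tonelli.
Context d1 d2 (T1 : measurableType d1) (T2 : measurableType d2) (R : realType).
Variables (m1 : {measure set T1 -> \bar R}) (m2 : {measure set T2 -> \bar R}).
Hypothesis s1 : sigma_finite setT m1.
Hypothesis s2 : sigma_finite setT m2.
Local Open Scope ereal_scope.

(** A copy of [m1] that carries the hypothesis [s1] as an instance, the form in which the Tonelli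
    theorem expects sigma-finiteness. *)
Let m1' : set T1 -> \bar R := m1.
HB.instance Definition _ := Measure.on m1'.
HB.instance Definition _ := Measure_isSigmaFinite.Build _ _ _ m1' s1.

Let m2' : set T2 -> \bar R := m2.
HB.instance Definition _ := Measure.on m2'.
HB.instance Definition _ := Measure_isSigmaFinite.Build _ _ _ m2' s2.

Lemma tonelli (f : T1 * T2 -> \bar R) : nnm f ->
  \int[m1]_x \int[m2]_y f (x, y) = \int[m2]_y \int[m1]_x f (x, y).
Proof. by move=> [mf f0]; exact: (@fubini_tonelli _ _ _ _ _ m1' m2' f). Qed.

Lemma nnm_partial_integral (f : T1 * T2 -> \bar R) : nnm f ->
  nnm (fun x => \int[m2]_y f (x, y)).
Proof.
move=> [mf f0]; split.
  exact: (@measurable_fun_fubini_tonelli_F _ _ _ _ _ m2').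
by move=> x; exact: integral_ge0.
Qed.

End tonelli.

Section group_operators.
Context d (E : borelGroupType d) (R : realType).
Hypothesis E_lc : lc_group_countable_base E.
Local Open Scope ereal_scope.
Implicit Types (f k : E -> \bar R) (A K : set E) (mu : {measure set E -> \bar R}).

Let hE : hausdorff_space E. Proof. by case: E_lc. Qed.
Let scE : @second_countable E. Proof. by case: E_lc. Qed.

Lemma sigma_finite_on_compacts mu : finite_on_compacts mu ->
  sigma_finite setT mu.
Proof.
move=> fmu; have [K [cK _ KT _]] := compact_exhaustion E_lc.
exists K => // n; split; first exact: borel_compact.
exact: fmu.
Qed.

Lemma nnm_comp (t : E -> E) f : measurable_fun setT t -> nnm f ->
  nnm (fun x => f (t x)).
Proof. by move=> mt [mf f0]; split => //; exact: measurableT_comp. Qed.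

Lemma nnm_mull x f : nnm f -> nnm (fun y => f (x * y)%g).
Proof. by apply: nnm_comp; apply: continuous_borel; exact: mull_continuous. Qed.

Lemma nnm_mulr x f : nnm f -> nnm (fun y => f (y * x)%g).
Proof. by apply: nnm_comp; apply: continuous_borel; exact: mulr_continuous. Qed.

Lemma mf_translate (mu : {measure set E -> \bar R}) (t : E -> E) :
  measurable_fun setT t -> monotone_functional (fun f => \int[mu]_x f (t x)).
Proof.
move=> mt; apply: (@mf_comp _ _ _ _ _ _ (fun f x => f (t x))).
- exact: mf_integral.
- by move=> f; exact: nnm_comp.
- by move=> x; exact: mf_eval.
Qed.

Lemma haar_mulr mu f a :
  (forall A x, measurable A -> mu [set (a * x)%g | a in A] = mu A) ->
  nnm f -> \int[mu]_x f (x * a)%g = \int[mu]_x f x.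
Proof.
move=> inv; have ma : measurable_fun setT (fun y : E => (y * a)%g).
  by apply: continuous_borel; exact: mulr_continuous.
apply: (mf_eq_indic (mf_translate mu ma) (mf_integral mu)) => A mA /=.
have mAa : measurable ((fun y : E => (y * a)%g) @^-1` A).
  by rewrite -[X in measurable X]setTI; exact: ma.
transitivity (\int[mu]_x (\1_((fun y : E => (y * a)%g) @^-1` A) x)%:E) => //.
rewrite !integral_indic // !setIT -[LHS](inv _ a) //.
congr (mu _); apply/seteqP; split=> [_ [y Ay <-] //|x Ax].
by exists (x * a^-1)%g; rewrite /= monoid.mulgVK.
Qed.

Lemma haar_mull mu f a :
  (forall A x, measurable A -> mu [set (x * a)%g | a in A] = mu A) ->
  nnm f -> \int[mu]_x f (a * x)%g = \int[mu]_x f x.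
Proof.
move=> inv; have ma : measurable_fun setT (fun y : E => (a * y)%g).
  by apply: continuous_borel; exact: mull_continuous.
apply: (mf_eq_indic (mf_translate mu ma) (mf_integral mu)) => A mA /=.
have mAa : measurable ((fun y : E => (a * y)%g) @^-1` A).
  by rewrite -[X in measurable X]setTI; exact: ma.
transitivity (\int[mu]_x (\1_((fun y : E => (a * y)%g) @^-1` A) x)%:E) => //.
rewrite !integral_indic // !setIT -[LHS](inv _ a) //.
congr (mu _); apply/seteqP; split=> [_ [y Ay <-] //|x Ax].
by exists (a^-1 * x)%g; rewrite /= monoid.mulVKg.
Qed.

(** Right convolution by the measure of density [k] with respect to [mu]: the walk operator is the
    case [k = 1], [mu = v], and smoothing operators are the case [mu = pi]. *)
Definition gop mu (k : E -> R) f x : \bar R :=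
  \int[mu]_y ((k y)%:E * f (x * y)%g).

Lemma nnm_mul2 (k : E -> R) f : nnm (EFin \o k) -> nnm f ->
  nnm (fun xy : E * E => (k xy.2)%:E * f (xy.1 * xy.2)%g).
Proof.
move=> [mk k0] [mf f0]; split; last first.
  by move=> x; rewrite mule_ge0 //; exact: k0.
apply: emeasurable_funM.
  by apply: measurableT_comp mk _; exact: measurable_snd.
by apply: measurableT_comp mf _; exact: mulg_borel.
Qed.

Lemma nnm_gop mu (k : E -> R) f : sigma_finite setT mu -> nnm (EFin \o k) ->
  nnm f -> nnm (gop mu k f).
Proof.
by move=> smu nk nf; exact: (nnm_partial_integral smu (nnm_mul2 nk nf)).
Qed.

Lemma mf_gop mu (k : E -> R) x : nnm (EFin \o k) ->
  monotone_functional (gop mu k ^~ x).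
Proof.
move=> nk; apply: (@mf_comp _ _ _ _ _ _ (fun f y => (k y)%:E * f (x * y)%g)).
- exact: mf_integral.
- by move=> f nf; apply: (nnmM nk); exact: nnm_mull.
- move=> y; have [_ /(_ y)] := nk; rewrite lee_fin => ky.
  by apply: mf_scale => //; exact: mf_eval.
Qed.

Section walk.
Variables (v : probability E R) (pi : {measure set E -> \bar R}).
Hypothesis pi_fin : finite_on_compacts pi.
Hypothesis pi_r : forall A x, measurable A -> pi [set (a * x)%g | a in A] = pi A.
Hypothesis pi_l : forall A x, measurable A -> pi [set (x * a)%g | a in A] = pi A.

Let spi : sigma_finite setT pi. Proof. exact: sigma_finite_on_compacts. Qed.
Let sv : sigma_finite setT v. Proof. exact: sigma_finiteT. Qed.

Lemma rw_opE f : rw_op v f = gop v (fun=> 1%R) f.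
Proof.
by apply/funext => x; apply: eq_integral => y _; rewrite mul1e.
Qed.

Lemma nnm_rw_op f : nnm f -> nnm (rw_op v f).
Proof. by move=> nf; rewrite rw_opE; apply: nnm_gop => //; exact: nnm_cst. Qed.

Lemma mf_rw_op x : monotone_functional (rw_op v ^~ x).
Proof.
rewrite (_ : _ ^~ x = (gop v (fun=> 1%R) ^~ x)).
  by apply: mf_gop; exact: nnm_cst.
by apply/funext => f; rewrite rw_opE.
Qed.

Lemma nnm_iter_rw_op n f : nnm f -> nnm (iter n (rw_op v) f).
Proof. by move=> nf; elim: n => //= n; exact: nnm_rw_op. Qed.

Lemma mf_iter_rw_op n x : monotone_functional (fun f => iter n (rw_op v) f x).
Proof.
elim: n x => [|n IH] x; first exact: mf_eval.
apply: (@mf_comp _ _ _ _ _ (fun f => rw_op v f x) (iter n (rw_op v))) => //.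
  exact: mf_rw_op.
by move=> f; exact: nnm_iter_rw_op.
Qed.

Lemma iter_rw_op_mull n f a x : iter n (rw_op v) (fun y => f (a * y)%g) x =
  iter n (rw_op v) f (a * x)%g.
Proof.
elim: n x => //= n IH x; apply: eq_integral => y _.
by rewrite IH monoid.mulgA.
Qed.

(** Composition with a step [z] translates the density on the right, by right invariance of [pi]; in
    the opposite order, in [rw_op_gop], it translates on the left, by left invariance. Unimodularity
    makes both available. *)
Lemma gop_rw_op (k : E -> R) f x : nnm (EFin \o k) -> nnm f ->
  gop pi k (rw_op v f) x = \int[v]_z gop pi (fun y => k (y * z^-1)%g) f x.
Proof.
move=> nk nf.
pose F (yz : E * E) := (k yz.1)%:E * f (x * (yz.1 * yz.2))%g.
have nF : nnm F.
  split; last by move=> yz; apply: mule_ge0; [exact: (nk.2 yz.1)|exact: nf.2].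
  apply: emeasurable_funM.
    by apply: measurableT_comp nk.1 _; exact: measurable_fst.
  by apply: measurableT_comp (nnm_mull x nf).1 _; exact: mulg_borel.
transitivity (\int[pi]_y \int[v]_z F (y, z)).
  apply: eq_integral => y _; rewrite /rw_op -ge0_integralZl_EFin //.
  - by apply: eq_integral => z _; rewrite /F /= monoid.mulgA.
  - by move=> z _; exact: nf.2.
  - exact: (nnm_mull _ nf).1.
  - by have := nk.2 y; rewrite lee_fin.
rewrite (tonelli spi sv nF); apply: eq_integral => z _.
rewrite -[RHS](@haar_mulr pi (fun y => (k (y * z^-1)%g)%:E * f (x * y)%g) z) //.
  by apply: eq_integral => y _; rewrite /F /= monoid.mulgK.
apply: nnmM; last exact: nnm_mull.
exact: (nnm_mulr z^-1%g nk).
Qed.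

Lemma rw_op_gop (k : E -> R) f x : nnm (EFin \o k) -> nnm f ->
  rw_op v (gop pi k f) x = \int[v]_z gop pi (fun y => k (z^-1 * y)%g) f x.
Proof.
move=> nk nf; apply: eq_integral => z _.
rewrite /gop -[RHS](@haar_mull pi (fun y => (k (z^-1 * y)%g)%:E * f (x * y)%g) z) //.
  by apply: eq_integral => y _; rewrite /= monoid.mulKg monoid.mulgA.
apply: nnmM; last exact: nnm_mull.
exact: (nnm_mull z^-1%g nk).
Qed.

Lemma gop_translate (k : E -> R) f x : nnm (EFin \o k) -> nnm f ->
  gop pi k f x = \int[pi]_y ((k (x^-1 * y)%g)%:E * f y).
Proof.
move=> nk nf.
rewrite -[RHS](@haar_mull pi (fun y => (k (x^-1 * y)%g)%:E * f y) x) //.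
  by apply: eq_integral => y _; rewrite monoid.mulKg.
by apply: nnmM => //; exact: (nnm_mull x^-1%g nk).
Qed.

Hypothesis v_compact : compactly_supported v.
Let S := msupport v.

(** The complement of the support is covered by the null sets of a countable base. *)
Lemma msupport_full : v (~` S) = 0.
Proof.
have [F [Fo Fb]] := second_countable_seq scE.
have mF n : measurable (F n) by exact: borel_open.
pose G n := if v (F n) == 0 then F n else set0.
have mG n : measurable (G n) by rewrite /G; case: ifP.
have SG : ~` S `<=` \bigcup_n G n.
  move=> x; rewrite /S /msupport /= -existsNP => -[U /not_implyP[oU]].
  move=> /not_implyP[Ux /negP]; rewrite -leNgt => vU.
  have [n Fnx FnU] := Fb x U (open_nbhs_nbhs (conj oU Ux)).
  exists n => //; rewrite /G ifT //.
  rewrite eq_le measure_ge0 andbT (le_trans _ vU) //.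
  by apply: le_measure; rewrite ?inE //; exact: borel_open.
apply/eqP; rewrite eq_le measure_ge0 andbT.
have mS : measurable (~` S).
  by apply: measurableC; exact: borel_compact.
apply: (le_trans (measure_sigma_subadditive v mG mS SG)).
rewrite eseries0 // => n _ _; rewrite /G.
by case: ifP => [/eqP //|_]; exact: measure0.
Qed.

Lemma le_integral_support (G H : E -> \bar R) : nnm G -> nnm H ->
  (forall z, S z -> G z <= H z) -> \int[v]_z G z <= \int[v]_z H z.
Proof.
move=> [mG G0] [mH H0] GH; apply: ae_ge0_le_integral => //.
exists (~` S); split => //.
- by apply: measurableC; exact: borel_compact.
- exact: msupport_full.
- move=> z /= nh Sz; apply: nh => _; exact: GH.
Qed.

End walk.
End group_operators.

(** * Real sequences and sets of density zero *)

Section real_estimates.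
Context (R : realType).
Implicit Types (q s : R).

Lemma bernoulli_ge (x : R) n : 0 <= x <= 1 -> 1 - n%:R * x <= (1 - x) ^+ n.
Proof.
move=> /andP[x0 x1]; elim: n => [|n IH]; first by rewrite mul0r subr0 expr0.
rewrite exprS; apply: (@le_trans _ _ ((1 - x) * (1 - n%:R * x))); last first.
  by apply: ler_wpM2l => //; rewrite subr_ge0.
have n0 : 0 <= n%:R :> R by [].
rewrite -natr1; nra.
Qed.

Lemma geometric_blocks (q : R) p : 0 < q < 1 -> (0 < p)%N ->
  exists c q', [/\ 0 <= c, 0 < q' < 1 &
    forall n, q ^+ (n.+1 %/ p) <= c * q' ^+ n].
Proof.
move=> /andP[q0 q1] p0; have p0' : 0 < p%:R :> R by rewrite ltr0n.
(* Bernoulli's inequality gives [q <= q' ^+ p], so [q'] replaces a [p]-th root of [q]. *)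
pose q' := 1 - (1 - q) / p%:R.
have pl1 : 1 <= p%:R :> R by rewrite ler1n.
have x01 : 0 < (1 - q) / p%:R < 1.
  rewrite divr_gt0 ?subr_gt0 //= ltr_pdivrMr // mul1r.
  by apply: lt_le_trans pl1; rewrite ltrBlDr ltrDl.
have q'01 : 0 < q' < 1.
  by rewrite /q'; case/andP: x01 => *; apply/andP; split; lra.
have [q'0 q'1] := andP q'01.
have qq' : q <= q' ^+ p.
  have h : 0 <= (1 - q) / p%:R <= 1 by case/andP: x01 => *; rewrite !ltW.
  apply: le_trans (bernoulli_ge p h).
  by rewrite mulrC divfK ?lt0r_neq0 // opprB addrC subrK.
exists ((q' ^+ p)^-1), q'; split => // [|n].
  by rewrite invr_ge0 exprn_ge0 // ltW.
apply: (@le_trans _ _ (q' ^+ (p * (n.+1 %/ p)))).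
  by rewrite exprM lerXn2r // nnegrE ?exprn_ge0 // ltW.
rewrite ler_pdivlMl ?exprn_gt0 // -exprD.
apply: ler_wiXn2l; rewrite ?ltW //.
have := ltn_ceil n.+1 p0; rewrite mulSn mulnC; lia.
Qed.

Lemma expR_le_inv (s : R) : 0 <= s < 1 -> expR s - 1 <= s / (1 - s).
Proof.
move=> /andP[s0 s1]; have := expR_ge1Dx (- s); rewrite expRN => h.
have e0 : 0 < expR s by exact: expR_gt0.
have s1' : 0 < 1 - s by rewrite subr_gt0.
have : expR s * (1 - s) <= 1.
  by rewrite -[leRHS](mulfV (lt0r_neq0 e0)) ler_wpM2l // ltW.
by rewrite ler_pdivlMr // => ?; nra.
Qed.

(** The Chernoff rate for a frequency [b] to exceed [b + eps]. After [1 + u <= expR u] and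
    [expR s - 1 <= s / (1 - s)] it suffices that [b < (b + eps) * (1 - s)], which holds for
    [s = eps / 4] because [b + eps <= 2]. *)
Lemma concentration_rate (b eps : R) : 0 <= b <= 1 -> 0 < eps <= 1 ->
  exists2 s, 0 < s &
    0 < expR (- (s * (b + eps))) * (1 + (expR s - 1) * b) < 1.
Proof.
move=> /andP[b0 b1] /andP[e0 e1]; pose s := eps / 4.
have s0 : 0 < s by rewrite divr_gt0.
have s1 : s <= 4^-1 by rewrite /s ler_pdivrMr // mulVf.
exists s => //.
have es := expR_le_inv (s := s).
have {}es : expR s - 1 <= s / (1 - s) by apply: es; apply/andP; split; lra.
have es0 : 0 <= expR s - 1 by rewrite subr_ge0 ltW // pexpR_gt1.
apply/andP; split.
  by rewrite mulr_gt0 ?expR_gt0 // ltr_pwDl // mulr_ge0.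
apply: (@le_lt_trans _ _ (expR (- (s * (b + eps))) * expR ((expR s - 1) * b))).
  by rewrite ler_wpM2l ?expR_ge0 // expR_ge1Dx.
rewrite -expRD expR_lt1 addrC subr_lt0.
apply: (@le_lt_trans _ _ (s / (1 - s) * b)); first by rewrite ler_wpM2r.
have s1' : 0 < 1 - s by lra.
rewrite -mulrA ltr_pM2l // mulrC ltr_pdivrMr //.
have : s * 4 = eps by rewrite /s divfK.
nra.
Qed.

Lemma sum_blocks (F : nat -> R) l N :
  \sum_(t < l * N) F t = \sum_(c < l) \sum_(i < N) F (c + l * i)%N.
Proof.
elim: N => [|N IH].
  rewrite muln0 big_ord0 big1 // => c _; exact: big_ord0.
rewrite mulnS addnC big_split_ord /= IH -big_split /=.
by apply: eq_bigr => c _; rewrite big_ord_recr /= addnC.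
Qed.

Lemma min_pos (P : nat -> R -> Prop) J T :
  (forall n, (J <= n)%N -> exists2 c, 0 < c & P n c) ->
  (forall n a b, a <= b -> P n b -> P n a) ->
  exists2 c, 0 < c & forall n, (J <= n < T)%N -> P n c.
Proof.
move=> HP Pm; elim: T => [|T [c c0 IH]].
  by exists 1 => // n; rewrite ltn0 andbF.
have [JT|TJ] := leqP J T; last first.
  by exists c => // n /andP[Jn nT]; apply: IH; lia.
have [c' c'0 Pc'] := HP T JT.
exists (Num.min c c') => [|n /andP[Jn]]; first by rewrite lt_min c0.
rewrite ltnS leq_eqVlt => /orP[/eqP ->|nT].
  by apply: Pm Pc'; rewrite ge_min lexx orbT.
by apply: (Pm n _ c); [rewrite ge_min lexx|apply: IH; rewrite Jn].
Qed.

Lemma expr_large (q a : R) : 1 < q -> exists n, forall m, (n <= m)%N -> a <= q ^+ m.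
Proof.
move=> q1; have x0 : 0 < q - 1 by rewrite subr_gt0.
have ge m : 1 + m%:R * (q - 1) <= q ^+ m.
  elim: m => [|m IH]; first by rewrite mul0r addr0 expr0.
  rewrite exprS; apply: (@le_trans _ _ (q * (1 + m%:R * (q - 1)))); last first.
    by rewrite ler_wpM2l // ltW // (lt_trans ltr01).
  have h : 0 <= m%:R * ((q - 1) * (q - 1)) :> R.
    by rewrite mulr_ge0 // mulr_ge0 // ltW.
  by rewrite -natr1; lra.
exists (Num.bound `|a / (q - 1)|) => m nm.
apply: le_trans (ge m); apply: ler_wpDl => //.
rewrite -ler_pdivrMr //; apply: (le_trans (ler_norm _)); apply: ltW.
apply: (lt_le_trans (archi_boundP (normr_ge0 _))).
by rewrite ler_nat.
Qed.

End real_estimates.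

Section density.
Context (R : realType).
Implicit Types (A B N : set nat) (e : R).

Definition cnt A M : R := \sum_(m < M) \1_A (m : nat).

Definition sparse A := forall e, 0 < e ->
  exists M0, forall M, (M0 <= M)%N -> cnt A M <= e * M%:R.

Lemma cnt_le A B M : (forall m, (m < M)%N -> A m -> B m) -> cnt A M <= cnt B M.
Proof.
move=> AB; apply: ler_sum => m _; rewrite !indicE ler_nat.
by case: (boolP (_ \in A)) => //; rewrite inE => /(AB _ (ltn_ord m)) h; rewrite mem_set.
Qed.

Lemma cnt_ge0 A M : 0 <= cnt A M.
Proof. by apply: sumr_ge0 => m _. Qed.

Lemma cntS A M : cnt A M.+1 = cnt A M + \1_A M.
Proof. by rewrite /cnt big_ord_recr. Qed.

Lemma cnt_mono A M M' : (M <= M')%N -> cnt A M <= cnt A M'.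
Proof.
move=> /subnK <-; elim: (M' - M)%N => [//|k IH].
by rewrite addSn cntS ler_wpDr.
Qed.

Lemma cnt_leM A M : cnt A M <= M%:R.
Proof.
rewrite -[M in leRHS]card_ord -sumr_const; apply: ler_sum => m _.
by rewrite indicE; case: (_ \in _).
Qed.

Lemma cntU A B M : cnt (A `|` B) M <= cnt A M + cnt B M.
Proof.
rewrite /cnt -big_split; apply: ler_sum => m _; rewrite !indicE in_setU.
by case: (_ \in A); case: (_ \in B); rewrite /= ?lexx ?addr0 ?add0r // lerDl.
Qed.

Lemma cnt_shift A j M : cnt [set n | A (n + j)%N] M <= cnt A (M + j).
Proof.
rewrite /cnt addnC big_split_ord /= ler_wpDl //; first exact: sumr_ge0.
apply: ler_sum => m _; rewrite !indicE addnC ler_nat.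
by case: (boolP (_ \in [set n | A (n + j)%N])) => //; rewrite inE /= => h; rewrite mem_set.
Qed.

Lemma sparse_le A B : (forall m, A m -> B m) -> sparse B -> sparse A.
Proof.
move=> AB sB e e0; have [M0 H] := sB e e0; exists M0 => M MM.
by apply: le_trans (H M MM); apply: cnt_le => m _; exact: AB.
Qed.

Lemma sparseU A B : sparse A -> sparse B -> sparse (A `|` B).
Proof.
move=> sA sB e e0; have e20 : 0 < e / 2 by rewrite divr_gt0.
have [M1 H1] := sA _ e20; have [M2 H2] := sB _ e20.
exists (maxn M1 M2) => M; rewrite geq_max => /andP[m1 m2].
apply: (le_trans (cntU A B M)).
by rewrite [e]splitr mulrDl lerD // ?H1 ?H2.
Qed.

Lemma sparse_shift A j : sparse A -> sparse [set n | A (n + j)%N].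
Proof.
move=> sA e e0; have e20 : 0 < e / 2 by rewrite divr_gt0.
have [M1 H1] := sA _ e20; exists (maxn M1 j) => M; rewrite geq_max => /andP[m1 jM].
apply: (le_trans (cnt_shift A j M)).
apply: (le_trans (H1 (M + j)%N _)); first by apply: (leq_trans m1); exact: leq_addr.
rewrite -mulrA ler_pM2l // ler_pdivrMl // -[2]/(2%:R) -natrM ler_nat.
by rewrite mul2n -addnn leq_add2l.
Qed.

Lemma sparse_ex (A_ : nat -> set nat) i : (forall j : nat, sparse (A_ j)) ->
  sparse [set n | exists2 j, (j < i)%N & A_ j n].
Proof.
move=> sA; elim: i => [|i IH].
  move=> e e0; exists 0%N => M _.
  rewrite /cnt big1 ?mulr_ge0 // ?(ltW e0) // => m _.
  by rewrite indicE memNset // => -[j].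
apply: (sparse_le _ (sparseU IH (sA i))) => m [j].
rewrite ltnS leq_eqVlt => /orP[/eqP ->|ji] Am; first by right.
by left; exists j.
Qed.

(** Diagonal choice: [N] follows [A i] only from a time on after which the frequency of [A i] stays
    below [1 / (i + 1)]. The level in force grows without bound, so each [A i] is eventually
    contained in [N]. *)
Lemma sparse_diagonal (A : nat -> set nat) : (forall i, sparse (A i)) ->
  (forall i j n, (i <= j)%N -> A i n -> A j n) ->
  exists N, [/\ (forall n, N n -> (0 < n)%N), sparse N &
    forall i, exists n0, forall n, (n0 <= n)%N -> A i n -> N n].
Proof.
move=> sA hA.
pose P i n := forall M, (n <= M)%N -> cnt (A i) M <= (i.+1%:R)^-1 * M%:R.
have P0 n : P 0%N n by move=> M _; rewrite invr1 mul1r cnt_leM.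
have Pm i n n' : (n <= n')%N -> P i n -> P i n'.
  by move=> nn' Pn M n'M; apply: Pn; exact: leq_trans n'M.
have Pe i : exists n, P i n.
  have [|M0 H] := sA i (i.+1%:R)^-1; first by rewrite invr_gt0.
  by exists M0.
(* The highest level up to [n] that has settled by time [n]; level 0 always has, its bound being the
   trivial one. *)
pose k n := \max_(i < n.+1 | `[< P i n >]) (i : nat).
have Pk n : P (k n) n.
  have : (0 < #|[pred i : 'I_n.+1 | `[< P i n >]]|)%N.
    by apply/card_gt0P; exists ord0; apply/asboolP; exact: P0.
  by move=> /(eq_bigmax_cond (fun i => nat_of_ord i))[i /asboolP Pi]; rewrite /k => ->.
have kge i n : (i <= n)%N -> P i n -> (i <= k n)%N.
  move=> ni Pi; have i1 : (i < n.+1)%N by rewrite ltnS.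
  apply: (leq_bigmax_cond (F := fun i : 'I_n.+1 => nat_of_ord i) (Ordinal i1)).
  exact/asboolP.
have kle n : (k n <= n)%N.
  by apply/bigmax_leqP => i _; rewrite -ltnS.
have kmono n n' : (n <= n')%N -> (k n <= k n')%N.
  move=> nn'; apply: kge; first exact: leq_trans (kle n) nn'.
  exact: Pm nn' (Pk n).
have kinf i : exists n0, forall n, (n0 <= n)%N -> (i <= k n)%N.
  have [n0 Pn0] := Pe i; exists (maxn n0 i) => n; rewrite geq_max => /andP[a b].
  by apply: kge => //; exact: Pm a Pn0.
exists [set n | (0 < n)%N /\ A (k n) n]; split.
- by move=> n [].
- move=> e e0; pose i := Num.bound e^-1.
  have ie : (i.+1%:R)^-1 <= e.
    rewrite invf_ple ?posrE //.
    apply: ltW; apply: (lt_le_trans (archi_boundP _)).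
      by rewrite invr_ge0 ltW.
    by rewrite ler_nat.
  have [n0 Hn0] := kinf i; exists n0 => M nM.
  apply: (@le_trans _ _ (cnt (A (k M)) M)).
    (* Below [M] every level in force is at most [k M]. *)
    apply: cnt_le => m mM [_]; apply: hA; apply: kmono; exact: ltnW.
  apply: (le_trans (Pk M M (leqnn M))); rewrite ler_wpM2r //.
  apply: le_trans ie; rewrite lef_pV2 ?posrE // ler_nat ltnS.
  exact: Hn0.
- move=> i; have [n0 Hn0] := kinf i; exists n0.+1 => n nn Ai; split.
    exact: leq_ltn_trans nn.
  by apply: hA Ai; apply: Hn0; exact: ltnW.
Qed.

Lemma card_cnt N n : (#|` fset_set (N `&` [set m | (m < n)%N]) |)%:R = cnt N n.
Proof.
have fin k : finite_set (N `&` [set m | (m < k)%N]).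
  by apply: (sub_finite_set _ (finite_II k)) => m [].
elim: n => [|n IH].
  rewrite (_ : _ `&` _ = set0) ?fset_set0 ?cardfs0 /cnt ?big_ord0 //.
  by apply/seteqP; split => m [].
rewrite cntS -IH indicE; have [Nn|nNn] := pselect (N n).
  rewrite mem_set // (_ : N `&` [set m | (m < n.+1)%N] =
      n |` (N `&` [set m | (m < n)%N])); last first.
    apply/seteqP; split => m /=.
      by rewrite ltnS leq_eqVlt => -[Nm /orP[/eqP ->|mn]]; [left|right].
    by move=> [->|[Nm mn]]; split => //; exact: ltnW.
  rewrite fset_setU1 // cardfsU1 in_fset_set // memNset /=; last by case; rewrite ltnn.
  by rewrite natrD addrC.
rewrite memNset // addr0 (_ : N `&` [set m | (m < n.+1)%N] =
  N `&` [set m | (m < n)%N]) //.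
apply/seteqP; split => m /= [Nm].
  by rewrite ltnS leq_eqVlt => /orP[/eqP mn|//]; move: Nm; rewrite mn.
by move=> mn; split => //; exact: ltnW.
Qed.

Lemma sparse_density_zero N : sparse N -> density_zero R N.
Proof.
move=> sN; apply/cvgrPdist_le => e e0.
have e20 : 0 < e / 2 by rewrite divr_gt0.
have [M0 H] := sN _ e20.
exists (maxn M0 1) => // n /=; rewrite geq_max => /andP[Mn n1].
rewrite sub0r normrN (card_cnt N n.+1) ger0_norm ?divr_ge0 ?cnt_ge0 //.
rewrite ler_pdivrMr ?ltr0n //.
apply: (le_trans (H n.+1 (leqW Mn))).
rewrite -mulrA ler_pM2l // ler_pdivrMl // -[2]/(2%:R) -natrM ler_nat.
by rewrite mul2n -addnn -addn1 leq_add2l.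
Qed.

Lemma cnt_unshift A n0 M : cnt A M <= n0%:R + cnt [set m | A (n0 + m)%N] M.
Proof.
apply: (le_trans (cnt_mono A (leq_addl n0 M))).
rewrite /cnt big_split_ord /= lerD //; exact: cnt_leM.
Qed.

(* The increments of [b] over [s] steps are bounded below and telescope. *)
Lemma cnt_increments (b : nat -> R) C s del e n0 : 0 < del -> 0 < e ->
  (forall n, (n0 <= n)%N -> b n <= C) ->
  (forall n, (n0 <= n)%N -> - del <= b (n + s)%N - b n) ->
  exists K, forall M,
    e * cnt [set m | e < b (n0 + m + s)%N - b (n0 + m)%N + del] M <=
      del * M%:R + K.
Proof.
move=> d0 e0 bC bs.
pose S M := \sum_(n < M) (b (n0 + n + s)%N - b (n0 + n)%N).
have SE M : S M = \sum_(n < s) b (n0 + M + n)%N - \sum_(n < s) b (n0 + n)%N.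
  rewrite /S; elim: M => [|M IH]; first by rewrite big_ord0 addn0 subrr.
  rewrite big_ord_recr /= IH.
  have : \sum_(n < s) b (n0 + M.+1 + n)%N + b (n0 + M)%N =
      \sum_(n < s) b (n0 + M + n)%N + b (n0 + M + s)%N.
    rewrite -(big_ord_recr s (fun n => b (n0 + M + n)%N)) /= big_ord_recl addn0.
    rewrite addrC; congr (_ + _); apply: eq_bigr => n _.
    by congr b; rewrite /= /bump /=; lia.
  move=> h; lra.
exists (s%:R * C - \sum_(n < s) b (n0 + n)%N) => M.
apply: (@le_trans _ _ (\sum_(m < M) (b (n0 + m + s)%N - b (n0 + m)%N + del))).
  rewrite /cnt mulr_sumr; apply: ler_sum => m _; rewrite indicE.
  have ge0 := bs (n0 + m)%N (leq_addr _ _).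
  case: (boolP (_ \in _)) => [|_]; first by rewrite inE /= mulr1 => /ltW.
  by rewrite mulr0; lra.
rewrite big_split /= -/(S M) SE sumr_const card_ord -[_ *+ M]mulr_natr addrC.
rewrite lerD2l lerD2r -[s in s%:R]card_ord mulr_natl -sumr_const.
by apply: ler_sum => m _; apply: bC; rewrite -addnA leq_addr.
Qed.

(** A one-step increment is the increment over [t.+1] steps from [n] minus the one over [t] steps
    from [n.+1]. Both are at least [- del], so if the difference is larger than [e] in absolute
    value, one of them exceeds [e - del]; by telescoping this has frequency at most about
    [del / e]. *)
Lemma sparse_slow (b : nat -> R) C n1 :
  (forall n, (n1 <= n)%N -> b n <= C) ->
  (forall del, 0 < del -> exists t, forall s, s = t \/ s = t.+1 ->
    exists n0, forall n, (n0 <= n)%N -> - del <= b (n + s)%N - b n) ->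
  forall e, 0 < e -> sparse [set n | e < `|b n.+1 - b n|].
Proof.
move=> bC H e e0 eta eta0.
(* The two families together contribute the frequency [2 * del / e], half of [eta]; the other half
   absorbs the constants for large [M]. *)
pose del := e * eta / 4.
have d0 : 0 < del by rewrite divr_gt0 // mulr_gt0.
have [t Ht] := H del d0.
have [m1 H1] := Ht t.+1 (or_intror erefl).
have [m2 H2] := Ht t (or_introl erefl).
pose n0 := maxn n1 (maxn m1 m2).
have n1n : (n1 <= n0)%N by exact: leq_maxl.
have m1n : (m1 <= n0)%N by rewrite /n0 maxnCA leq_maxl.
have m2n : (m2 <= n0)%N by rewrite /n0 maxnA leq_maxr.
have bC0 n : (n0 <= n)%N -> b n <= C by move=> h; apply: bC; exact: leq_trans h.
have H10 n : (n0 <= n)%N -> - del <= b (n + t.+1)%N - b n.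
  by move=> h; apply: H1; exact: leq_trans h.
have H20 n : (n0 <= n)%N -> - del <= b (n + t)%N - b n.
  by move=> h; apply: H2; exact: leq_trans h.
have [K1 HK1] := cnt_increments d0 e0 bC0 H10.
have [K2 HK2] := cnt_increments d0 e0 bC0 H20.
set A1 := [set m | _] in HK1; set A2 := [set m | _] in HK2.
pose K := n0%:R * e + K1 + K2 + del.
have key M : e * cnt [set n | e < `|b n.+1 - b n|] M <= 2 * del * M%:R + K.
  have h1 : cnt [set m | e < `|b (n0 + m).+1 - b (n0 + m)%N|] M <=
      cnt A1 M + cnt A2 (M + 1).
    apply: le_trans (lerD (lexx _) (cnt_shift A2 1 M)).
    apply: le_trans (cntU _ _ M); apply: cnt_le => m _ /=.
    have p1 := H10 (n0 + m)%N (leq_addr _ _).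
    have p2 : - del <= b (n0 + (m + 1) + t)%N - b (n0 + (m + 1))%N.
      by apply: H20; exact: leq_addr.
    rewrite /A1 /A2 /=.
    have e1 : (n0 + (m + 1) + t = n0 + m + t.+1)%N by lia.
    have e2 : (n0 + (m + 1) = (n0 + m).+1)%N by lia.
    rewrite e1 e2 in p2 *.
    by rewrite ltr_normr => /orP[h|h]; [left|right]; lra.
  have h2 := cnt_unshift [set n | e < `|b n.+1 - b n|] n0 M.
  have h3 := HK1 M; have h4 := HK2 (M + 1)%N.
  rewrite natrD mulrDr in h4.
  have : e * cnt [set n | e < `|b n.+1 - b n|] M <=
      e * (n0%:R + (cnt A1 M + cnt A2 (M + 1))).
    by rewrite ler_pM2l //; apply: (le_trans h2); rewrite lerD2l.
  rewrite /K; lra.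
have [M1 HM1] : exists M1 : nat, 2 * K / (e * eta) <= M1%:R.
  exists (Num.bound `|2 * K / (e * eta)|).
  apply: (le_trans (ler_norm _)); apply: ltW.
  by apply: archi_boundP.
exists M1 => M MM.
rewrite -(ler_pM2l e0); apply: (le_trans (key M)).
have : 2 * K <= M%:R * (e * eta).
  rewrite -ler_pdivrMr ?mulr_gt0 //; apply: (le_trans HM1).
  by rewrite ler_nat.
have -> : 2 * del * M%:R = M%:R * (e * eta) / 2 by rewrite /del; lra.
by move=> h; rewrite mulrA [_ * M%:R]mulrC; lra.
Qed.

End density.

(** * Almost nondecreasing sequences *)

Section slow_sequences.
Context (R : realType).
Variables (a : nat -> R) (C : R).
Hypothesis a_le : forall n, a n <= C.
Hypothesis a_sub : forall q, 0 < q < 1 ->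
  exists n0, forall n, (n0 <= n)%N -> q ^+ n <= a n.

(** The error is absolute and not relative to [x]: it arises from a bound by [phi], and is later
    compared with [a] alone. *)
Definition almost_nondecreasing (x : nat -> R) del s := exists c q,
  [/\ 0 <= c, 0 < q < 1 & forall n, (1 - del) * x n <= x (n + s)%N + c * q ^+ n].

(** Subexponentiality is used at a rate [p] strictly between [q] and 1, and [(p / q) ^+ n] outgrows
    [c / e]. *)
Lemma geometric_negligible c q e : 0 <= c -> 0 < q < 1 -> 0 < e ->
  exists n0, forall n, (n0 <= n)%N -> c * q ^+ n <= e * a n.
Proof.
move=> c0 /andP[q0 q1] e0; pose p := (q + 1) / 2.
have qp : q < p by rewrite /p; lra.
have p1 : p < 1 by rewrite /p; lra.
have p0 : 0 < p by apply: lt_trans qp.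
have p01 : 0 < p < 1 by rewrite p0.
have [n1 H1] := a_sub p01.
have pq1 : 1 < p / q by rewrite ltr_pdivlMr // mul1r.
have [n2 H2] := expr_large (c / e) pq1.
exists (maxn n1 n2) => n; rewrite geq_max => /andP[m1 m2].
apply: (@le_trans _ _ (e * p ^+ n)); last by rewrite ler_pM2l // H1.
have := H2 n m2; rewrite (expr_div_n p q) ler_pdivlMr ?exprn_gt0 //.
by rewrite mulrAC ler_pdivrMr // [e * _]mulrC.
Qed.

Lemma eventually_pos : exists n0, forall n, (n0 <= n)%N -> 0 < a n.
Proof.
have h : 0 < (2^-1 : R) < 1 by apply/andP; split; lra.
have [n0 H] := a_sub h; exists n0 => n nn; apply: lt_le_trans (H n nn).
by rewrite exprn_gt0 // invr_gt0.
Qed.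

Lemma expR_near1 e : 0 < e ->
  exists2 eta, 0 < eta & forall x : R, `|x| <= eta -> `|expR x - 1| <= e.
Proof.
move=> e0; have := @continuous_expR R 0; rewrite /continuous_at expR0.
move=> /cvgrPdist_le /(_ _ e0) /nbhs_ballP[eta eta0 H].
exists (eta / 2); first by rewrite divr_gt0.
move=> x xe; rewrite distrC; apply: H; rewrite /ball /= sub0r normrN.
by apply: (le_lt_trans xe); rewrite ltr_pdivrMr // ltr_pMr // ltr1n.
Qed.

Lemma ratio_limit_set :
  (forall del, 0 < del <= 1 -> exists t, forall s, s = t \/ s = t.+1 ->
    almost_nondecreasing a del s) ->
  exists N, [/\ (forall n, N n -> (0 < n)%N), density_zero R N &
    forall j e, 0 < e -> exists n0, forall n, (n0 <= n)%N -> ~ N n ->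
      `|a (n + j)%N - a n| <= e * a n].
Proof.
(* Logarithms turn multiplicative losses into increments that can be summed, and the bound on [a]
   into an upper bound for these sums. *)
move=> Ha; pose b n := ln (a n).
have [n1 pos] := eventually_pos.
have bC n : (n1 <= n)%N -> b n <= ln C.
  move=> h; rewrite /b ler_ln ?posrE ?pos //.
  by apply: lt_le_trans (a_le n1); apply: pos.
have bs del : 0 < del -> exists t, forall s, s = t \/ s = t.+1 ->
    exists n0, forall n, (n0 <= n)%N -> - del <= b (n + s)%N - b n.
  (* Half of the admissible loss [1 - expR (- del)] goes to the almost monotonicity, half to the
     geometric error. *)
  move=> del0; pose d1 := (1 - expR (- del)) / 2.
  have ed : expR (- del) < 1 by rewrite expR_lt1 oppr_lt0.
  have ed0 := expR_gt0 (- del).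
  have d10 : 0 < d1 by rewrite /d1; lra.
  have d1e : 1 - d1 - d1 = expR (- del) by rewrite /d1; lra.
  have d101 : 0 < d1 <= 1 by rewrite d10 /=; lra.
  have [t Ht] := Ha _ d101; exists t => s st.
  have [c [q [c0 q01 H]]] := Ht s st.
  have [n2 H2] := geometric_negligible c0 q01 d10.
  exists (maxn n1 n2) => n; rewrite geq_max => /andP[m1 m2].
  have an := pos n m1; have ans := pos (n + s)%N (leq_trans m1 (leq_addr _ _)).
  have h : expR (- del) * a n <= a (n + s)%N.
    by rewrite -d1e; have := H n; have := H2 n m2; lra.
  rewrite lerBrDr -[- del]expRK -lnM ?posrE // ler_ln ?posrE //.
  by rewrite mulr_gt0.
have slow := sparse_slow bC bs.
(* Windows of [i.+1] consecutive increments with tolerance [1 / (i + 1)]: a single set [N] then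
   controls the quotient of [a (n + j)] and [a n] for every fixed [j]. *)
pose A i := [set n | exists2 j, (j < i.+1)%N &
  (i.+1%:R)^-1 < `|b (n + j).+1 - b (n + j)%N|].
have sA i : sparse R (A i).
  apply: sparse_ex => j.
  apply: (sparse_shift j (A := [set n | i.+1%:R^-1 < `|b n.+1 - b n|])).
  by apply: slow; rewrite invr_gt0.
have mA i j n : (i <= j)%N -> A i n -> A j n.
  move=> ij [k ki h]; exists k; first by apply: (leq_trans ki).
  by apply: le_lt_trans h; rewrite lef_pV2 ?posrE // ler_nat.
have [N [N0 sN HN]] := sparse_diagonal sA mA.
exists N; split => //; first exact: sparse_density_zero.
have step j e : 0 < e -> exists n0, forall n, (n0 <= n)%N -> ~ N n ->
    `|b (n + j).+1 - b (n + j)%N| <= e.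
  move=> e0; pose i := maxn j (Num.bound e^-1).
  have ie : (i.+1%:R)^-1 <= e.
    rewrite invf_ple ?posrE //; apply: ltW.
    apply: (lt_le_trans (archi_boundP _)); first by rewrite invr_ge0 ltW.
    by rewrite ler_nat; apply: leqW; exact: leq_maxr.
  have [n0 H] := HN i; exists n0 => n nn nNn.
  rewrite leNgt; apply/negP => h; apply: nNn; apply: H => //.
  exists j; first by rewrite ltnS leq_maxl.
  exact: le_lt_trans h.
have stepj j e : 0 < e -> exists n0, forall n, (n0 <= n)%N -> ~ N n ->
    `|b (n + j)%N - b n| <= e.
  elim: j e => [|j IH] e e0.
    by exists 0%N => n _ _; rewrite addn0 subrr normr0 ltW.
  have e20 : 0 < e / 2 by rewrite divr_gt0.
  have [m1 H1] := IH _ e20; have [m2 H2] := step j _ e20.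
  exists (maxn m1 m2) => n; rewrite geq_max => /andP[h1 h2] nNn.
  rewrite addnS [e]splitr.
  have -> : b (n + j).+1 - b n =
    (b (n + j).+1 - b (n + j)%N) + (b (n + j)%N - b n) by ring.
  by apply: (le_trans (ler_normD _ _)); rewrite lerD ?H1 ?H2.
move=> j e e0; have [eta eta0 Heta] := expR_near1 e0.
have [n0 H0] := stepj j _ eta0.
exists (maxn n1 n0) => n; rewrite geq_max => /andP[m1 m0] nNn.
have an := pos n m1; have anj := pos (n + j)%N (leq_trans m1 (leq_addr _ _)).
have := Heta _ (H0 n m0 nNn).
rewrite /b expRD expRN !lnK ?posrE // => h.
have -> : a (n + j)%N - a n = (a (n + j)%N / a n - 1) * a n.
  by rewrite mulrBl divfK ?lt0r_neq0 // mul1r.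
by rewrite normrM (gtr0_norm an) ler_wpM2r // ltW.
Qed.

Variable F : set_system nat.
Context {FF : Filter F}.
Hypothesis Foo : \oo `<=` F.
Hypothesis Fj : forall j e, 0 < e -> \forall n \near F, `|a (n + j)%N - a n| <= e * a n.

Lemma near_geometric c q e : 0 <= c -> 0 < q < 1 -> 0 < e ->
  \forall n \near F, c * q ^+ n <= e * a n.
Proof.
move=> c0 q01 e0; have [n0 H] := geometric_negligible c0 q01 e0.
by apply: Foo; exists n0.
Qed.

Lemma near_pos : \forall n \near F, 0 < a n.
Proof. by have [n0 H] := eventually_pos; apply: Foo; exists n0. Qed.

(** Neither summand can fall by much, and their sum is nearly constant, so neither can rise by much.
    In the constant, [2 * D] comes from the variation of [a] over the two shifts, [2 * D] from the
    loss [del * y n], and 1 from the geometric error. *)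
Lemma squeeze_increment (x y : nat -> R) D L del s : 0 <= D -> 0 < del <= 1 ->
  (forall n, 0 <= x n) -> (forall n, 0 <= y n) ->
  (forall n, x n + y n = D * a (n + L)%N) ->
  almost_nondecreasing x del s -> almost_nondecreasing y del s ->
  \forall n \near F, `|x (n + s)%N - x n| <= (4 * D + 1) * del * a n.
Proof.
move=> D0 /andP[d0 d1] x0 y0 xy [c1 [q1 [c10 q101 H1]]] [c2 [q2 [c20 q201 H2]]].
apply: filterS (filterI (filterI (near_geometric c10 q101 d0)
  (near_geometric c20 q201 d0)) (filterI near_pos
  (filterI (Fj L d0) (Fj (s + L) d0)))) => n [[g1 g2] [an [j1 j2]]].
have := H1 n; have := H2 n; have := xy n; have := xy (n + s)%N.
rewrite -addnA; move: (x0 n) (y0 n) g1 g2 j1 j2; rewrite !ler_norml.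
set u := x n; set w := y n; set u' := x _; set w' := y _.
set aL := a (n + L)%N; set aL' := a (n + (s + L))%N; set an' := a n.
set e1 := c1 * _; set e2 := c2 * _.
move=> u0 w0 g1 g2 /andP[j1 j2] /andP[k1 k2] E1 E2 h2 h1.
have t1 : D * aL <= D * ((1 + del) * an') by apply: ler_wpM2l => //; lra.
have t2 : D * (aL' - aL) <= D * ((del + del) * an').
  by apply: ler_wpM2l => //; lra.
have t3 : del * u <= del * (D * ((1 + del) * an')).
  by apply: ler_wpM2l; [exact: ltW|lra].
have t4 : del * w <= del * (D * ((1 + del) * an')).
  by apply: ler_wpM2l; [exact: ltW|lra].
have t5 : del * (D * ((1 + del) * an')) <= 2 * D * del * an'.
  have -> : 2 * D * del * an' = del * (D * (2 * an')) by ring.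
  apply: ler_wpM2l; first exact: ltW.
  apply: ler_wpM2l => //; apply: ler_wpM2r; [exact: ltW|lra].
have t6 : 0 <= D * (del * an') by rewrite !mulr_ge0 // ltW.
by apply/andP; split; lra.
Qed.

(* If [x] and its complement [y] in a slowly varying sequence are both almost
   nondecreasing, then [x] varies slowly too. *)
Lemma slow_increment (x y y' : nat -> R) D L D' L' :
  0 <= D -> 0 <= D' ->
  (forall n, 0 <= x n) -> (forall n, 0 <= y n) -> (forall n, 0 <= y' n) ->
  (forall n, x n + y n = D * a (n + L)%N) ->
  (forall n, x n.+1 + y' n = D' * a (n + L')%N) ->
  (forall del, 0 < del <= 1 -> exists t, forall s, s = t \/ s = t.+1 ->
    [/\ almost_nondecreasing x del s, almost_nondecreasing y del s,
        almost_nondecreasing (x \o S) del s & almost_nondecreasing y' del s]) ->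
  forall e, 0 < e -> \forall n \near F, `|x n.+1 - x n| <= e * a n.
Proof.
move=> D0 D'0 x0 y0 y'0 xy xy' H e e0.
pose B := 4 * D + 1 + (4 * D' + 1).
have B0 : 0 < B by rewrite /B; lra.
pose del := Num.min 1 (e / B).
have del01 : 0 < del <= 1 by rewrite lt_min ltr01 divr_gt0 //= ge_min lexx.
have Bdel : B * del <= e.
  by rewrite mulrC -ler_pdivlMr // ge_min lexx orbT.
have [t Ht] := H del del01.
have [x1 y1 _ _] := Ht t.+1 (or_intror erefl).
have [_ _ x2 y2] := Ht t (or_introl erefl).
have s1 := squeeze_increment D0 del01 x0 y0 xy x1 y1.
have s2 := squeeze_increment D'0 del01 (fun n => x0 n.+1) y'0 xy' x2 y2.
apply: filterS (filterI near_pos (filterI s1 s2)) => n [an [h1 h2]].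
(* Only the long delays [t] and [t.+1] are controlled; started at [n.+1] and [n], they end at the
   same time. *)
have -> : x n.+1 - x n =
  (x (n + t.+1)%N - x n) - ((x \o S) (n + t)%N - (x \o S) n).
  by rewrite /= addnS; ring.
apply: (le_trans (ler_normB _ _)); apply: (le_trans (lerD h1 h2)).
by rewrite -!mulrDl ler_pM2r.
Qed.

End slow_sequences.

(** * Uniqueness of the Haar measure *)

Section haar_uniqueness.
Context d (E : borelGroupType d) (R : realType).
Variable pi : {measure set E -> \bar R}.
Hypothesis E_lc : lc_group_countable_base E.
Hypothesis pi_fin : finite_on_compacts pi.
Hypothesis pi_r : forall A (x : E), measurable A ->
  pi [set (a * x)%g | a in A] = pi A.
Hypothesis pi_l : forall A (x : E), measurable A ->
  pi [set (x * a)%g | a in A] = pi A.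
Implicit Types (h k : E -> \bar R).

Let hE : hausdorff_space E. Proof. by case: E_lc. Qed.

Lemma nnm_mul h : nnm h -> nnm (fun xy : E * E => h (xy.1 * xy.2)%g).
Proof.
move=> nh; split => [|xy]; last exact: nh.2.
by apply: (measurableT_comp nh.1); apply: mulg_borel; case: E_lc.
Qed.

Lemma nnm_comp2 h (f g : E * E -> E) : nnm h -> measurable_fun setT f ->
  measurable_fun setT g -> nnm (fun xy => h (f xy * g xy)%g).
Proof.
move=> nh mf mg; have [mm _] := nnm_mul nh; split => [|xy]; last exact: nh.2.
apply: (measurableT_comp mm (g := fun xy => (f xy, g xy))).
exact: measurable_fun_pair.
Qed.

Let minv : measurable_fun setT (fun x : E => x^-1%g).
Proof. by apply: continuous_borel; exact: invg_continuous. Qed.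

Lemma nnm_inv h : nnm h -> nnm (fun x => h x^-1%g).
Proof.
by move=> nh; split => [|x]; [exact: measurableT_comp nh.1 minv|exact: nh.2].
Qed.

(** The double integral of [h x * k (y * x)] is evaluated twice. Right invariance of [pi] in [y]
    gives the left-hand side; left invariance of [T] first replaces [x] by [y^-1 * x], and the
    integral over [y] then gives the right-hand side. *)
Lemma haar_exchange (T : {measure set E -> \bar R}) h k :
  finite_on_compacts T ->
  (forall f (a : E), nnm f -> (\int[T]_x f (a * x)%g = \int[T]_x f x)%E) ->
  nnm h -> nnm k ->
  (\int[T]_x h x * \int[pi]_x k x = \int[T]_x k x * \int[pi]_x h x^-1%g)%E.
Proof.
move=> T_fin T_l nh nk.
have sT := sigma_finite_on_compacts E_lc T_fin.
have spi := sigma_finite_on_compacts E_lc pi_fin.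
have m1 : measurable_fun setT (@fst E E) by exact: measurable_fst.
have m2 : measurable_fun setT (@snd E E) by exact: measurable_snd.
have n1 h' : nnm h' -> nnm (fun xy : E * E => h' xy.1).
  by move=> nh'; split => [|xy]; [exact: measurableT_comp nh'.1 m1|exact: nh'.2].
pose G (xy : E * E) := (h xy.1 * k (xy.2 * xy.1)%g)%E.
have nG : nnm G by apply: nnmM; [exact: n1|exact: nnm_comp2].
pose G' (xy : E * E) := (k xy.1 * h (xy.2^-1 * xy.1)%g)%E.
have nG' : nnm G'.
  apply: nnmM; first exact: n1.
  by apply: nnm_comp2 => //; exact: measurableT_comp minv m2.
transitivity (\int[T]_x \int[pi]_y G (x, y))%E.
  rewrite -ge0_integralZr //; first last.
  - exact: (mf_ge0 (mf_integral pi) nk).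
  - by move=> x _; exact: nh.2.
  - exact: nh.1.
  apply: eq_integral => x _; rewrite -(haar_mulr x pi_r nk) -ge0_integralZl //.
  - exact: (nnm_mulr x nk).1.
  - by move=> y _; exact: nk.2.
  - exact: nh.2.
rewrite (tonelli sT spi nG).
transitivity (\int[pi]_y \int[T]_x G' (x, y))%E.
  apply: eq_integral => y _; rewrite -(T_l (fun x => G' (x, y)) y).
    by apply: eq_integral => x _; rewrite /G /G' /= monoid.mulKg muleC.
  by apply: nnmM => //; exact: (nnm_mull y^-1%g nh).
rewrite -(tonelli sT spi nG').
rewrite -ge0_integralZr //; first last.
- exact: (mf_ge0 (mf_integral pi) (nnm_inv nh)).
- by move=> x _; exact: nk.2.
- exact: nk.1.
apply: eq_integral => x _.
have nhx : nnm (fun y => h (y^-1 * x)%g) by exact: (nnm_inv (nnm_mulr x nh)).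
(* Replacing [y] by [x * y], by left invariance of [pi], removes [x]. *)
rewrite -(_ : (\int[pi]_y h (y^-1 * x)%g = \int[pi]_y h y^-1%g)%E); last first.
  rewrite -(haar_mull x pi_l nhx).
  by apply: eq_integral => y _; rewrite monoid.invgM monoid.mulgVK.
rewrite -ge0_integralZl //.
- exact: nhx.1.
- by move=> y _; exact: nhx.2.
- exact: nk.2.
Qed.

(** The exchange formula with [T = pi] and the indicator of [K] shows that [pi] is invariant under
    inversion, [pi K] being positive and finite; the formula for [T] then loses its inverse. The
    product form remains meaningful for infinite integrals. *)
Lemma haar_unique (T : {measure set E -> \bar R}) K h k :
  compact K -> (0 < pi K)%E -> finite_on_compacts T ->
  (forall f (a : E), nnm f -> (\int[T]_x f (a * x)%g = \int[T]_x f x)%E) ->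
  nnm h -> nnm k ->
  (\int[T]_x h x * \int[pi]_x k x = \int[T]_x k x * \int[pi]_x h x)%E.
Proof.
move=> cK pK T_fin T_l nh nk; rewrite haar_exchange //; congr (_ * _)%E.
have mK := borel_compact hE cK.
have pf : pi K \is a fin_num by rewrite ge0_fin_numE // pi_fin.
have e : (pi K * \int[pi]_x h x^-1%g = pi K * \int[pi]_x h x)%E.
  have := haar_exchange pi_fin (fun f a nf => haar_mull a pi_l nf) nh
    (nnm_indic R mK).
  by rewrite /= integral_indic // setIT muleC.
by apply/le_anti/andP; split; rewrite -(lee_pmul2l pf pK) e.
Qed.

End haar_uniqueness.

Lemma ultra_bounded_cvg (R : realType) (F : set_system nat) (x : nat -> R) D :
  UltraFilter F -> (\forall n \near F, 0 <= x n <= D) -> cvg (x n @[n --> F]).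
Proof.
move=> UF xD; have := @segment_compact R 0 D.
rewrite compact_ultra => /(_ (x @ F)) H.
have PF : ProperFilter F by exact: ultra_proper.
have UxF : UltraFilter (x @ F).
  split=> [|G PG FG]; first exact: fmap_proper_filter; apply/seteqP; split => // A GA.
  have [//|FA] := @in_ultra_setVsetC _ F (x @^-1` A) UF.
  have GnA : G (~` A) by exact: FG.
  by have [y []] := filter_ex (filterI GA GnA).
have [|y [_ cv]] := H UxF; last exact: cvgP cv.
by apply: filterS xD => n; rewrite /= in_itv.
Qed.

Lemma cvg_ext (R : realType) (F : set_system nat) (x y : nat -> R) (l : R) :
  (forall n, x n = y n) -> y n @[n --> F] --> l -> x n @[n --> F] --> l.
Proof. by move=> /funext ->. Qed.

(** * The rescaled walk operator *)

(* [pi] is also left invariant, as the group is unimodular. *)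
Record walk_setting d (E : borelGroupType d) (R : realType)
    (v : probability E R) (pi : {measure set E -> \bar R}) (r : R)
    (phi : E -> R) : Prop := WalkSetting {
  ws_lc : lc_group_countable_base E ;
  ws_pos : (0 < pi setT)%E ;
  ws_fin : finite_on_compacts pi ;
  ws_r : forall A x, measurable A -> pi [set (a * x)%g | a in A] = pi A ;
  ws_l : forall A x, measurable A -> pi [set (x * a)%g | a in A] = pi A ;
  ws_compact : compactly_supported v ;
  ws_A : conditionA v pi ;
  ws_r0 : 0 < r ;
  ws_phi : continuous phi ;
  ws_exp : exponential phi ;
  ws_int : (\int[v]_x (phi x)%:E)%E = (r^-1)%:E }.

Section walk_analysis.
Context d (E : borelGroupType d) (R : realType).
Variables (v : probability E R) (pi : {measure set E -> \bar R}) (r : R).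
Variable phi : E -> R.
Hypothesis W : walk_setting v pi r phi.
Implicit Types (f g h : E -> R) (K : set E).

Let E_lc := ws_lc W.
Let hE : hausdorff_space E. Proof. by case: E_lc. Qed.
Let spi : sigma_finite setT pi.
Proof. exact: (sigma_finite_on_compacts E_lc (ws_fin W)). Qed.
Let r0 := ws_r0 W.
Let nK K : compact K -> nnm (EFin \o (\1_K : E -> R)).
Proof. by move=> cK; apply: nnm_indic; exact: borel_compact. Qed.

Let mphi : measurable_fun setT phi. Proof. by have [] := ws_exp W. Qed.

Lemma phi_gt0 x : 0 < phi x. Proof. by have [_ + _] := ws_exp W; exact. Qed.
Lemma phiM x y : phi (x * y)%g = phi x * phi y.
Proof. by have [_ _] := ws_exp W; exact. Qed.

Lemma phi1 : phi 1%g = 1.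
Proof.
have := phiM 1%g 1%g; rewrite monoid.mulg1 => /eqP.
by rewrite -{1}[phi _]mulr1 (inj_eq (mulfI (lt0r_neq0 (phi_gt0 _)))) => /eqP.
Qed.

Lemma phiV x : phi (x^-1)%g = (phi x)^-1.
Proof.
apply: (mulfI (lt0r_neq0 (phi_gt0 x))).
by rewrite -phiM monoid.mulgV phi1 mulfV // lt0r_neq0 // phi_gt0.
Qed.

Lemma nnm_phi : nnm (EFin \o phi).
Proof.
split; first exact/measurable_EFinP.
by move=> x; rewrite lee_fin ltW // phi_gt0.
Qed.

(** The bound is preserved by [U], which fixes [phi], and it holds for bounded functions of compact
    support, since [phi] is bounded away from 0 on compact sets. On this cone all integrals against
    the walk are finite, so operators can be real-valued. *)
Definition dom (M : R) f :=
  measurable_fun setT f /\ forall x, 0 <= f x <= M * phi x.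

Lemma dom_nnm M f : dom M f -> nnm (EFin \o f).
Proof.
move=> [mf fM]; split; first exact/measurable_EFinP.
by move=> x; rewrite lee_fin; have /andP[] := fM x.
Qed.

Lemma dom_ge0 M f : dom M f -> 0 <= M.
Proof.
move=> [_ /(_ 1%g)]; rewrite phi1 mulr1 => /andP[]; exact: le_trans.
Qed.

Lemma dom_f_ge0 M f x : dom M f -> 0 <= f x.
Proof. by move=> [_ /(_ x)/andP[]]. Qed.

Lemma domD M N f g : dom M f -> dom N g -> dom (M + N) (f \+ g).
Proof.
move=> [mf fM] [mg gN]; split; first exact: measurable_funD.
move=> x /=; have /andP[? ?] := fM x; have /andP[? ?] := gN x.
by rewrite mulrDl; apply/andP; split; [exact: addr_ge0|exact: lerD].
Qed.

Lemma domZ c M f : 0 <= c -> dom M f -> dom (c * M) (fun x => c * f x).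
Proof.
move=> c0 [mf fM]; split; first exact: measurable_funM.
move=> x /=; have /andP[? ?] := fM x.
by rewrite -mulrA mulr_ge0 //= ler_wpM2l.
Qed.

Lemma dom_le M N f : M <= N -> dom M f -> dom N f.
Proof.
move=> MN [mf fM]; split => // x; have /andP[-> h] /= := fM x.
by apply: le_trans h _; rewrite ler_wpM2r // ltW // phi_gt0.
Qed.

Lemma domB M N f g : dom M f -> dom N g -> (forall x, g x <= f x) ->
  dom M (f \- g).
Proof.
move=> [mf fM] [mg gN] gf; split; first exact: measurable_funB.
move=> x /=; have /andP[? ?] := fM x; have /andP[? ?] := gN x.
by rewrite subr_ge0 gf /= lerBlDr ler_wpDr.
Qed.

(** [b] bounds the norm of [A] for the sup norm weighted by [phi]. For a convolution it is the total
    [phi]-mass of the convolving measure. *)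
Record posop (b : R) (A : (E -> R) -> E -> R) : Prop := PosOp {
  po_dom : forall M f, dom M f -> dom (b * M) (A f) ;
  po_D : forall M N f g, dom M f -> dom N g -> A (f \+ g) = A f \+ A g ;
  po_Z : forall c M f, 0 <= c -> dom M f ->
    A (fun x => c * f x) = (fun x => c * A f x) }.

Lemma po_le b A M N f g : posop b A -> dom M f -> dom N g ->
  (forall x, f x <= g x) -> forall x, A f x <= A g x.
Proof.
move=> pA df dg fg x; have dgf := domB dg df fg.
have -> : g = f \+ (g \- f) by apply/funext => y /=; rewrite addrC subrK.
rewrite (po_D pA df dgf) /= lerDl.
exact: dom_f_ge0 (po_dom pA dgf).
Qed.

Lemma posop_comp b c A B : posop b A -> posop c B ->
  posop (b * c) (fun f => A (B f)).
Proof.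
move=> pA pB; split.
- by move=> M f df; rewrite -mulrA; apply: (po_dom pA); exact: (po_dom pB).
- move=> M N f g df dg; rewrite (po_D pB df dg).
  exact: (po_D pA (po_dom pB df) (po_dom pB dg)).
- move=> a M f a0 df; rewrite (po_Z pB a0 df).
  exact: (po_Z pA a0 (po_dom pB df)).
Qed.

Lemma posop_id : posop 1 id.
Proof. by split=> // M f; rewrite mul1r. Qed.

Lemma posop_iter b A n : posop b A -> posop (b ^+ n) (iter n A).
Proof.
move=> pA; elim: n => [|n IH]; first by rewrite expr0; exact: posop_id.
by rewrite exprS; exact: (posop_comp pA IH).
Qed.

Lemma posopZ b c A : 0 <= c -> posop b A -> posop (c * b) (fun f x => c * A f x).
Proof.
move=> c0 pA; split.
- by move=> M f df; rewrite -mulrA; apply: domZ => //; exact: (po_dom pA).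
- move=> M N f g df dg; rewrite (po_D pA df dg).
  by apply/funext => x /=; rewrite mulrDr.
- move=> a M f a0 df; rewrite (po_Z pA a0 df).
  by apply/funext => x; rewrite mulrCA.
Qed.

Lemma posopD b c A B : posop b A -> posop c B ->
  posop (b + c) (fun f => A f \+ B f).
Proof.
move=> pA pB; split.
- move=> M f df; rewrite mulrDl.
  by apply: domD; [exact: (po_dom pA)|exact: (po_dom pB)].
- move=> M N f g df dg; rewrite (po_D pA df dg) (po_D pB df dg).
  by apply/funext => x /=; rewrite addrACA.
- move=> a M f a0 df; rewrite (po_Z pA a0 df) (po_Z pB a0 df).
  by apply/funext => x /=; rewrite mulrDr.
Qed.

Lemma posopB b c A B : posop b A -> posop c B ->
  (forall M f x, dom M f -> B f x <= A f x) ->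
  posop b (fun f => A f \- B f).
Proof.
move=> pA pB BA; split.
- move=> M f df; apply: (domB (po_dom pA df) (po_dom pB df)) => x.
  exact: BA df.
- move=> M N f g df dg; rewrite (po_D pA df dg) (po_D pB df dg).
  by apply/funext => x /=; rewrite opprD addrACA.
- move=> a M f a0 df; rewrite (po_Z pA a0 df) (po_Z pB a0 df).
  by apply/funext => x /=; rewrite mulrBr.
Qed.

Lemma posop_weaken b c A : b <= c -> posop b A -> posop c A.
Proof.
move=> bc pA; split; [|exact: (po_D pA)|exact: (po_Z pA)].
move=> M f df; apply: dom_le (po_dom pA df).
by rewrite ler_wpM2r // (dom_ge0 df).
Qed.

Definition walk_op f x : R := r * fine (rw_op v (EFin \o f) x).
Local Notation U := walk_op.

Lemma fine_EFin (a : \bar R) (b : R) : (0 <= a)%E -> (a <= b%:E)%E ->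
  a = (fine a)%:E.
Proof.
by move=> a0 ab; rewrite fineK // ge0_fin_numE // (le_lt_trans ab) ?ltry.
Qed.

Lemma rw_op_phi x : rw_op v (EFin \o phi) x = (r^-1 * phi x)%:E.
Proof.
rewrite /rw_op (eq_integral (fun y => ((phi x)%:E * (phi y)%:E)%E)); last first.
  by move=> y _ /=; rewrite phiM EFinM.
rewrite ge0_integralZl_EFin //.
- by rewrite (ws_int W) -EFinM mulrC.
- by move=> y _; exact: nnm_phi.2.
- exact: nnm_phi.1.
- by rewrite ltW // phi_gt0.
Qed.

Lemma rw_op_dom M f x : dom M f ->
  rw_op v (EFin \o f) x = (fine (rw_op v (EFin \o f) x))%:E /\
  (rw_op v (EFin \o f) x <= (r^-1 * (M * phi x))%:E)%E.
Proof.
move=> df; have nf := dom_nnm df.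
have le : (rw_op v (EFin \o f) x <= (r^-1 * (M * phi x))%:E)%E.
  rewrite mulrCA EFinM -rw_op_phi -(mf_Z (mf_rw_op v x)) ?(dom_ge0 df) //;
    last exact: nnm_phi.
  apply: (mf_le (mf_rw_op v x)) => //.
    by apply: nnmZ; [exact: dom_ge0 df|exact: nnm_phi].
  by move=> y; rewrite -EFinM lee_fin; have [_ /(_ y)/andP[]] := df.
split => //; apply: fine_EFin le.
exact: (mf_ge0 (mf_rw_op v x)).
Qed.

Lemma U_EFin M f x : dom M f -> (U f x)%:E = (r%:E * rw_op v (EFin \o f) x)%E.
Proof. by move=> df; rewrite (rw_op_dom x df).1 -EFinM. Qed.

Lemma posop_U : posop 1 U.
Proof.
split.
- move=> M f df; rewrite mul1r; split.
        apply: measurable_funM => //.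
    apply: (measurableT_comp (f := fine)) => //.
    exact: (nnm_rw_op E_lc v (dom_nnm df)).1.
  move=> x; rewrite -!lee_fin (U_EFin x df).
  apply/andP; split.
    apply: mule_ge0; first by rewrite lee_fin ltW.
    exact: (mf_ge0 (mf_rw_op v x) (dom_nnm df)).
  rewrite -[M * phi x](mulVKf (lt0r_neq0 r0)) EFinM.
  by apply: lee_wpmul2l; [rewrite lee_fin ltW|exact: (rw_op_dom x df).2].
- move=> M N f g df dg; apply/funext => x; apply: EFin_inj.
  rewrite (U_EFin x (domD df dg)) EFinD (U_EFin x df) (U_EFin x dg).
  rewrite -ge0_muleDr.
  + by rewrite -(mf_D (mf_rw_op v x) (dom_nnm df) (dom_nnm dg)).
  + exact: (mf_ge0 (mf_rw_op v x) (dom_nnm df)).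
  + exact: (mf_ge0 (mf_rw_op v x) (dom_nnm dg)).
- move=> c M f c0 df; apply/funext => x; apply: EFin_inj.
  rewrite (U_EFin x (domZ c0 df)) EFinM (U_EFin x df) muleCA.
  by rewrite -(mf_Z (mf_rw_op v x) c0 (dom_nnm df)).
Qed.

Lemma posop_iterU n : posop 1 (iter n U).
Proof. by rewrite -(expr1n _ n); apply: posop_iter; exact: posop_U. Qed.

Lemma dom_iterU n M f : dom M f -> dom M (iter n U f).
Proof. by move/(po_dom (posop_iterU n)); rewrite mul1r. Qed.

Lemma iterU_EFin n M f x : dom M f ->
  (iter n U f x)%:E = ((r ^+ n)%:E * iter n (rw_op v) (EFin \o f) x)%E.
Proof.
move=> df; elim: n x => [|n IH] x /=; first by rewrite expr0 mul1e.
have df' := dom_iterU n df.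
rewrite (U_EFin x df') exprS EFinM -muleA; congr (_ * _)%E.
rewrite -(mf_Z (mf_rw_op v x)) ?exprn_ge0 ?ltW //; last first.
  exact: (nnm_iter_rw_op E_lc v n (dom_nnm df)).
by congr (rw_op v _ x); apply/funext => y; rewrite -IH.
Qed.

(** * Smoothing by indicator densities *)

Section smoothing.
Let S := msupport v.
Let cS : compact S. Proof. exact: ws_compact W. Qed.

Lemma phi_bounds K : compact K ->
  exists a b, [/\ 0 < a, 0 < b & forall x, K x -> a <= phi x <= b].
Proof.
move=> cK.
have ub C : compact C -> exists2 b, 0 < b & forall x, C x -> phi x <= b.
  move=> cC; have /compact_bounded : compact (phi @` C).
    apply: continuous_compact => //; apply: continuous_subspaceT.
    exact: ws_phi W.
  move=> [M [_ hM]]; exists (`|M| + 1); first by rewrite ltr_wpDl.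
  move=> x Cx; apply: le_trans (ler_norm _) _.
  apply: (hM (`|M| + 1)); last by exists x.
  by rewrite (le_lt_trans (ler_norm _)) // ltrDl.
have [b b0 hb] := ub K cK.
(* The lower bound on [K] is the reciprocal of an upper bound on the inverse set. *)
have [a a0 ha] := ub _ (compact_invset cK).
exists a^-1, b; split; rewrite ?invr_gt0 // => x Kx; rewrite hb // andbT.
rewrite -[phi x]invrK lef_pV2 ?posrE ?invr_gt0 ?(phi_gt0) //.
by rewrite -(phiV); apply: ha; rewrite /invset /= monoid.invgK.
Qed.

Lemma dom_compact K f c : compact K -> measurable_fun setT f ->
  (forall x, 0 <= f x <= c) -> (forall x, ~ K x -> f x = 0) ->
  exists M, dom M f.
Proof.
move=> cK mf f0 fK; have [a [b [a0 _ ab]]] := phi_bounds cK.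
exists (c / a); split => // x; have /andP[-> fc] /= := f0 x.
have c0 : 0 <= c by apply: le_trans fc; have /andP[] := f0 x.
have [Kx|/fK ->] := pselect (K x).
  apply: (le_trans fc); rewrite -mulrA ler_peMr //.
  by rewrite mulrC ler_pdivlMr // mul1r; have /andP[] := ab x Kx.
by rewrite mulr_ge0 ?divr_ge0 ?(ltW a0) // ltW // phi_gt0.
Qed.

Definition indic_conv K f x : R := fine (gop pi \1_K (EFin \o f) x).
Local Notation N := indic_conv.

(** The [phi]-mass of [K]: the factor by which [indic_conv K] multiplies [phi], hence its norm as a
    [posop]. *)
Definition wt K : R := fine (\int[pi]_y (\1_K y * phi y)%:E)%E.

Lemma wt_EFin K : compact K ->
  (\int[pi]_y (\1_K y * phi y)%:E)%E = (wt K)%:E.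
Proof.
move=> cK; have mK := borel_compact hE cK.
have [a [b [a0 b0 ab]]] := phi_bounds cK.
have nphi := nnm_phi.
rewrite /wt; apply/esym; rewrite fineK // ge0_fin_numE; last first.
  apply: integral_ge0 => y _; rewrite lee_fin mulr_ge0 //.
  by rewrite ltW // phi_gt0.
apply: (@le_lt_trans _ _ (\int[pi]_y (b * \1_K y)%:E)%E).
  apply: (mf_le (mf_integral pi)).
  - exact: (nnmM (nK cK) nphi).
  - have := nnmZ (ltW b0) (nK cK); rewrite (_ : (fun=> _) = (fun y => (b * \1_K y)%:E)) //.
  - move=> y; rewrite lee_fin indicE; case: (boolP (y \in K)) => [|_].
      by rewrite inE => /ab/andP[_]; rewrite mul1r mulr1.
    by rewrite mul0r mulr0.
have -> : (\int[pi]_y (b * \1_K y)%:E = b%:E * \int[pi]_y (\1_K y)%:E)%E.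
  rewrite -ge0_integralZl_EFin ?ltW //.
  exact: (nK cK).1.
rewrite integral_indic // setIT lte_mul_pinfty ?lee_fin ?ltW //.
exact: ws_fin W _ cK.
Qed.

Lemma wt_gt0 K : compact K -> (0 < pi K)%E -> 0 < wt K.
Proof.
move=> cK K0; have mK := borel_compact hE cK.
have [a [b [a0 b0 ab]]] := phi_bounds cK.
rewrite -lte_fin -wt_EFin //.
apply: (@lt_le_trans _ _ (\int[pi]_y (a * \1_K y)%:E)%E).
  have -> : (\int[pi]_y (a * \1_K y)%:E = a%:E * \int[pi]_y (\1_K y)%:E)%E.
    rewrite -ge0_integralZl_EFin ?ltW //.
    exact: (nK cK).1.
  by rewrite integral_indic // setIT mule_gt0.
apply: (mf_le (mf_integral pi)).
- exact: (nnmZ (ltW a0) (nK cK)).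
- exact: (nnmM (nK cK) nnm_phi).
- move=> y; rewrite lee_fin indicE; case: (boolP (y \in K)) => [|_].
    by rewrite inE => /ab/andP[]; rewrite mul1r mulr1.
  by rewrite mul0r mulr0.
Qed.

Lemma gop_phi K x : compact K ->
  gop pi \1_K (EFin \o phi) x = (phi x * wt K)%:E.
Proof.
move=> cK; rewrite /gop EFinM -wt_EFin // -ge0_integralZl_EFin //.
- by apply: eq_integral => y _ /=; rewrite phiM -!EFinM mulrCA.
- by move=> y _; rewrite lee_fin mulr_ge0 // ltW // phi_gt0.
- exact: (nnmM (nK cK) nnm_phi).1.
- by rewrite ltW // phi_gt0.
Qed.

Lemma N_EFin K M f x : compact K -> dom M f ->
  (N K f x)%:E = gop pi \1_K (EFin \o f) x /\ N K f x <= wt K * M * phi x.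
Proof.
move=> cK df; have nf := dom_nnm df; have mg := mf_gop pi x (nK cK).
have le : (gop pi \1_K (EFin \o f) x <= (wt K * M * phi x)%:E)%E.
  rewrite [wt K * M]mulrC -mulrA EFinM [wt K * _]mulrC -gop_phi // -(mf_Z mg).
  - apply: (mf_le mg) => //.
      by apply: nnmZ; [exact: dom_ge0 _ _ df|exact: nnm_phi].
    by move=> y; rewrite -EFinM lee_fin; have [_ /(_ y)/andP[]] := df.
  - exact: dom_ge0 _ _ df.
  - exact: nnm_phi.
rewrite /indic_conv -(fine_EFin (mf_ge0 mg nf) le); split => //.
by rewrite -lee_fin -(fine_EFin (mf_ge0 mg nf) le).
Qed.

Lemma posop_N K : compact K -> posop (wt K) (N K).
Proof.
move=> cK; have mg x := mf_gop pi x (nK cK); split.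
- move=> M f df; split.
    apply: (measurableT_comp (f := fine)) => //.
    exact: (nnm_gop E_lc spi (nK cK) (dom_nnm df)).1.
  move=> x; rewrite (N_EFin x cK df).2 andbT.
  by apply: fine_ge0; exact: (mf_ge0 (mg x) (dom_nnm df)).
- move=> M P f g df dg; apply/funext => x; apply: EFin_inj.
  rewrite EFinD (N_EFin x cK df).1 (N_EFin x cK dg).1.
  rewrite (N_EFin x cK (domD df dg)).1.
  exact: (mf_D (mg x) (dom_nnm df) (dom_nnm dg)).
- move=> c M f c0 df; apply/funext => x; apply: EFin_inj.
  rewrite EFinM (N_EFin x cK df).1 (N_EFin x cK (domZ c0 df)).1.
  exact: (mf_Z (mg x) c0 (dom_nnm df)).
Qed.

Lemma N_mono K K' M f x : compact K -> compact K' -> K `<=` K' -> dom M f ->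
  N K f x <= N K' f x.
Proof.
move=> cK cK' KK' df; rewrite -lee_fin (N_EFin x cK df).1 (N_EFin x cK' df).1.
have nf := dom_nnm df; apply: (mf_le (mf_integral pi)).
- by apply: nnmM; [exact: nK|exact: nnm_mull].
- by apply: nnmM; [exact: nK|exact: nnm_mull].
- move=> y; apply: lee_wpmul2r; first exact: nf.2.
  rewrite lee_fin !indicE ler_nat; case: (boolP (y \in K)) => //.
  by rewrite inE => /KK' h; rewrite mem_set.
Qed.

Lemma N_setU K K' M f x : compact K -> compact K' -> dom M f ->
  N K f x <= N (K `|` K') f x /\ N K' f x <= N (K `|` K') f x.
Proof.
move=> cK cK' df; have cU := compactU cK cK'.
by split; apply: N_mono df.
Qed.

Let gop_nonneg (k : E -> R) f x : nnm (EFin \o k) -> nnm (EFin \o f) ->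
  (0 <= gop pi k (EFin \o f) x)%E.
Proof. by move=> nk nf; exact: (mf_ge0 (mf_gop pi x nk) nf). Qed.

Let gop_le (k k' : E -> R) f x : nnm (EFin \o k) -> nnm (EFin \o k') ->
  nnm (EFin \o f) -> (forall y, k y <= k' y) ->
  (gop pi k (EFin \o f) x <= gop pi k' (EFin \o f) x)%E.
Proof.
move=> nk nk' nf kk'; apply: (mf_le (mf_integral pi)).
- by apply: nnmM => //; exact: nnm_mull.
- by apply: nnmM => //; exact: nnm_mull.
- by move=> y; apply: lee_wpmul2r; [exact: nf.2|rewrite lee_fin].
Qed.

Let nnm_gop_param (t : E -> E -> E) f x K : compact K ->
  measurable_fun setT (fun zy : E * E => t zy.1 zy.2) -> nnm (EFin \o f) ->
  nnm (fun z => gop pi (fun y => \1_K (t z y)) (EFin \o f) x).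
Proof.
move=> cK mt nf.
apply: (@nnm_partial_integral _ _ _ _ _ pi spi
  (fun zy : E * E => ((\1_K (t zy.1 zy.2))%:E * (f (x * zy.2)%g)%:E)%E)).
split; last first.
  by move=> z; apply: mule_ge0; [exact: (nK cK).2|exact: nf.2].
apply: emeasurable_funM.
  by apply: measurableT_comp (nK cK).1 _.
by apply: measurableT_comp (nnm_mull x nf).1 _; exact: measurable_snd.
Qed.

Let int_cst (c : \bar R) : (\int[v]_z c = c)%E.
Proof. by rewrite integral_cst // [X in (_ * X)%E](@probability_setT _ _ _ v) mule1. Qed.

Let meas_inv : measurable_fun setT (fun x : E => (x^-1)%g).
Proof. by apply: continuous_borel => z; exact: invg_continuous. Qed.

Let meas_mul : measurable_fun setT (fun xy : E * E => (xy.1 * xy.2)%g).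
Proof. by apply: mulg_borel; case: E_lc. Qed.

Let meas_mulV : measurable_fun setT (fun zy : E * E => (zy.2 * zy.1^-1)%g).
Proof.
apply: (measurableT_comp meas_mul (g := fun zy : E * E => (zy.2, (zy.1^-1)%g))).
apply: measurable_fun_pair; first exact: measurable_snd.
exact: (measurableT_comp meas_inv).
Qed.

Let meas_Vmul : measurable_fun setT (fun zy : E * E => (zy.1^-1 * zy.2)%g).
Proof.
apply: (measurableT_comp meas_mul (g := fun zy : E * E => ((zy.1^-1)%g, zy.2))).
apply: measurable_fun_pair; last exact: measurable_snd.
exact: (measurableT_comp meas_inv).
Qed.

Let indic_sub (A B : set E) (y z : E) : (A y -> B z) -> \1_A y <= \1_B z :> R.
Proof.
move=> AB; rewrite !indicE ler_nat; case: (boolP (y \in A)) => //.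
by rewrite inE => /AB h; rewrite mem_set.
Qed.

Let N_U_E K M f x : compact K -> dom M f -> (N K (U f) x)%:E =
  (r%:E * \int[v]_z gop pi (fun y => \1_K (y * z^-1)%g) (EFin \o f) x)%E.
Proof.
move=> cK df; have nf := dom_nnm df.
have dU := dom_iterU 1 df.
rewrite (N_EFin x cK dU).1.
rewrite -(gop_rw_op E_lc v (ws_fin W) (ws_r W) x (nK cK) nf).
rewrite -(mf_Z (mf_gop pi x (nK cK))) ?(ltW r0) //; last exact: nnm_rw_op.
congr (gop _ _ _ x); apply/funext => y /=.
by rewrite (U_EFin y df).
Qed.

(** A step [z] in the support of [v] carries [K] to [K z], inside the compact set [K S]. Thus a
    smoothing passes across [U] at the price of a larger compact set; [N_U_ge] and [U_N_le] rest on
    the same remark. *)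
Lemma N_U_le K M f x : compact K -> dom M f ->
  N K (U f) x <= r * N (mulset K S) f x.
Proof.
move=> cK df; have nf := dom_nnm df; have cKS := compact_mulset cK cS.
rewrite -lee_fin (N_U_E x cK df) EFinM (N_EFin x cKS df).1.
apply: lee_wpmul2l; first by rewrite lee_fin ltW.
rewrite -[leRHS]int_cst.
apply: (le_integral_support E_lc (ws_compact W)).
- exact: nnm_gop_param meas_mulV _.
- by split => // z; apply: gop_nonneg => //; exact: nK.
move=> z Sz; apply: gop_le => //.
- exact: (nnm_mulr z^-1%g (nK cK)).
- exact: nK.
- by move=> y; apply: indic_sub => h; exists (y * z^-1)%g, z; rewrite monoid.mulgVK.
Qed.

Lemma N_U_ge K M f x : compact K -> dom M f ->
  r * N K f x <= N (mulset K (invset S)) (U f) x.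
Proof.
move=> cK df; have nf := dom_nnm df.
have cKS := compact_mulset cK (compact_invset cS).
rewrite -lee_fin (N_U_E x cKS df) EFinM (N_EFin x cK df).1.
apply: lee_wpmul2l; first by rewrite lee_fin ltW.
rewrite -[leLHS]int_cst.
apply: (le_integral_support E_lc (ws_compact W)).
- by split => // z; apply: gop_nonneg => //; exact: nK.
- exact: nnm_gop_param meas_mulV _.
move=> z Sz; apply: gop_le => //.
- exact: nK.
- exact: (nnm_mulr z^-1%g (nK cKS)).
- move=> y; apply: indic_sub => h; exists y, (z^-1)%g; split => //.
  by rewrite /invset /= monoid.invgK.
Qed.

Lemma U_N_le K M f x : compact K -> dom M f ->
  U (N K f) x <= r * N (mulset S K) f x.
Proof.
move=> cK df; have nf := dom_nnm df; have cSK := compact_mulset cS cK.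
rewrite -lee_fin (U_EFin x (po_dom (posop_N cK) df)).
rewrite EFinM (N_EFin x cSK df).1.
apply: lee_wpmul2l; first by rewrite lee_fin ltW.
have -> : EFin \o N K f = gop pi \1_K (EFin \o f).
  by apply/funext => y; exact: (N_EFin y cK df).1.
rewrite (rw_op_gop v (ws_l W) x (nK cK) nf) -[leRHS]int_cst.
apply: (le_integral_support E_lc (ws_compact W)).
- exact: nnm_gop_param meas_Vmul _.
- by split => // z; apply: gop_nonneg => //; exact: nK.
move=> z Sz; apply: gop_le => //.
- exact: (nnm_mull z^-1%g (nK cK)).
- exact: nK.
- by move=> y; apply: indic_sub => h; exists z, (z^-1 * y)%g; rewrite monoid.mulVKg.
Qed.

(** Links condition (A), stated for convolution powers of [v], with iterates of the walk operator
    started at the identity. The induction uses that the walk commutes with left translations. *)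
Lemma convpow_iter j A : measurable A ->
  convpow v j A = iter j (rw_op v) (EFin \o (\1_A : E -> R)) 1%g.
Proof.
elim: j A => [|j IH] A mA; first by rewrite /convpow /= diracE indicE.
rewrite /convpow /=; apply: eq_integral => x _.
rewrite monoid.mul1g -[x in RHS]monoid.mulg1 -iter_rw_op_mull.
have mB : measurable [set (x^-1 * a)%g | a in A].
  rewrite (_ : [set _ | _ in _] = setT `&` (fun y : E => (x * y)%g) @^-1` A).
    by apply: continuous_borel => //; exact: mull_continuous.
  rewrite setTI; apply/seteqP; split=> [_ [y Ay <-]|y /= Ay].
    by rewrite /= monoid.mulVKg.
  by exists (x * y)%g => //; rewrite monoid.mulKg.
rewrite -/(convpow v j _) IH //; congr (iter _ _ _ _).
apply/funext => y /=; rewrite !indicE; congr (_%:R)%:E; congr nat_of_bool.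
apply/idP/idP; rewrite !inE; last first.
  by exists (x * y)%g => //; rewrite monoid.mulKg.
by move=> [z Az <-]; rewrite monoid.mulVKg.
Qed.

(** At the identity this is condition (A) for a continuous majorant of the indicator of [K],
    extended from sets to functions; a left translation brings it to any [x]. *)
Lemma conditionA_N K : compact K -> exists gam j, [/\ 0 < gam, (1 <= j)%N &
  forall M f x, dom M f -> gam * N K f x <= iter j U f x].
Proof.
move=> cK; have [f0 [Cf0 f00 f01]] := C0_dominates R E_lc cK.
have [gam [j [gam0 j1 hj]]] := ws_A W Cf0 f00.
have rj : 0 < r ^+ j by exact: exprn_gt0.
exists (r ^+ j * gam), j; split; rewrite ?mulr_gt0 // => M f x df.
have nf := dom_nnm df.
have nf0 : nnm (EFin \o f0).
  split; last by move=> y; rewrite lee_fin.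
  by apply/measurable_EFinP; apply: continuous_borel_real; case: Cf0.
rewrite -lee_fin (iterU_EFin j x df) -mulrA !EFinM (N_EFin x cK df).1.
apply: lee_wpmul2l; first by rewrite lee_fin ltW.
have nfx : nnm (fun y => (f (x * y)%g)%:E) by exact: (nnm_mull x nf).
have := mf_le_indic (mf_scale (ltW gam0) (mf_gop pi 1%g nf0))
  (mf_iter_rw_op E_lc v j 1%g) _ nfx.
have <- : iter j (rw_op v) (fun y => (EFin \o f) (x * y)%g) 1%g =
    iter j (rw_op v) (EFin \o f) x by rewrite iter_rw_op_mull monoid.mulg1.
move=> h.
apply: le_trans (h _); last first.
  move=> A mA; rewrite -(convpow_iter j mA); apply: le_trans (hj A mA).
  rewrite lee_pmul2l ?lte_fin // [leRHS]integral_mkcond.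
  rewrite /gop le_eqVlt; apply/orP; left; apply/eqP.
  apply: eq_integral => y _; rewrite monoid.mul1g /= patchE indicE.
  by case: ifP => _; rewrite ?mule1 ?mule0.
apply: lee_wpmul2l; first by rewrite lee_fin ltW.
rewrite /gop; apply: (mf_le (mf_integral pi)).
- by apply: nnmM => //; exact: nK.
- by apply: nnmM => //; exact: (nnm_mull 1%g nfx).
- move=> y; rewrite monoid.mul1g; apply: lee_wpmul2r; first exact: nfx.2.
  rewrite lee_fin indicE; case: (boolP (y \in K)) => [|_]; last exact: f00.
  by rewrite inE => /f01.
Qed.

End smoothing.

Local Notation N := indic_conv.

(** * Counting insertions *)

(** The sum of all products of [N] factors with one factor [B] and the others [A]. When [A = C + B]
    is expanded, each word in [C] and [B] appears as often as it contains [B]. *)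
Fixpoint insertions A B (N : nat) (f : E -> R) : E -> R :=
  if N is N'.+1 then insertions A B N' (A f) \+ iter N' A (B f) else fun=> 0.

Lemma insertionsE A B N f x : insertions A B N f x =
  \sum_(i < N) iter i A (B (iter (N.-1 - i) A f)) x.
Proof.
elim: N f => [|N IH] f; first by rewrite big_ord0.
rewrite big_ord_recr /= subnn IH; congr (_ + _).
apply: eq_bigr => i _.
by rewrite -iterSr (_ : (N.-1 - i).+1 = (N - i)%N) //; have := ltn_ord i; lia.
Qed.

Lemma dom0 : dom 0 (fun=> 0).
Proof. by split => // x; rewrite mul0r lexx. Qed.

Lemma posop_insertions A B b N : posop 1 A -> posop b B ->
  posop (N%:R * b) (insertions A B N).
Proof.
move=> pA pB; elim: N => [|N IH].
  rewrite mul0r; split => [M f _|M P f g _ _|c M f _ _].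
  - by rewrite mul0r; exact: dom0.
  - by apply/funext => x /=; rewrite addr0.
  - by apply/funext => x /=; rewrite mulr0.
rewrite -natr1 mulrDl mul1r; apply: posopD.
  by rewrite -[_ * _]mulr1; exact: (posop_comp IH pA).
rewrite -[b]mul1r -{1}(expr1n R N).
exact: (posop_comp (posop_iter N pA) pB).
Qed.

Lemma posop_sum A b (n : nat) (G : nat -> E -> R) M : posop b A ->
  (forall i, (i < n)%N -> dom M (G i)) ->
  exists2 M', dom M' (fun x => \sum_(i < n) G i x) &
  A (fun x => \sum_(i < n) G i x) = (fun x => \sum_(i < n) A (G i) x).
Proof.
move=> pA; elim: n => [|n IH] dG.
  exists 0; first by under eq_fun do rewrite big_ord0; exact: dom0.
  have -> : (fun x => \sum_(i < 0) G i x) = (fun x => 0 * (fun=> 0) x).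
    by apply/funext => x; rewrite big_ord0 mul0r.
  rewrite (po_Z pA (lexx 0) dom0).
  by apply/funext => x; rewrite big_ord0 mul0r.
have [|M' dM' E'] := IH; first by move=> i ni; apply: dG; rewrite ltnS ltnW.
have dn := dG n (leqnn _).
have -> : (fun x => \sum_(i < n.+1) G i x) =
    (fun x => \sum_(i < n) G i x) \+ G n.
  by apply/funext => x; rewrite big_ord_recr.
exists (M' + M); first exact: domD.
rewrite (po_D pA dM' dn) E'.
by apply/funext => x; rewrite big_ord_recr.
Qed.

(* An exponential Chebyshev bound for noncommuting operators: writing
   [A = C + B], the number of factors [B] in a product of [N] factors exceeds
   [K] only with small weight. *)
Lemma insertions_le A B b s N (K : R) M f x : posop 1 A -> posop b B ->
  (forall M f x, dom M f -> B f x <= A f x) -> 0 < s -> dom M f ->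
  insertions A B N f x <= K * iter N A f x +
    s^-1 * expR (- (s * K)) *
      iter N (fun g => A g \+ (fun x => (expR s - 1) * B g x)) f x.
Proof.
(* Behind the estimate is [k <= K + s^-1 * expR (s * (k - K))] for a word with [k] factors [B];
   weighted by [expR (s * k)], the words add up to a power of [Z = C + expR s * B]. *)
move=> pA pB BA s0; set Z := fun g => _.
have es0 : 0 <= expR s - 1 by rewrite subr_ge0 ltW // pexpR_gt1.
have pZ : posop (1 + (expR s - 1) * b) Z by apply: posopD => //; exact: posopZ.
have pC : posop 1 (fun f => A f \- B f) by exact: (posopB pA pB BA).
elim: N K M f x => [|N IH] K M f x df.
  have f0 := dom_f_ge0 x df.
  rewrite /= -mulrDl mulr_ge0 //.
  rewrite -(pmulr_rge0 _ s0) mulrDr mulrA mulfV ?lt0r_neq0 // mul1r.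
  have := expR_ge1Dx (- (s * K)); lra.
have dA := po_dom pA df; have dB := po_dom pB df; have dC := po_dom pC df.
have AE : A f = (A f \- B f) \+ B f by apply/funext => y /=; rewrite subrK.
have pI := posop_insertions N pA pB.
rewrite !iterSr [insertions _ _ _ _ _]/=.
(* Once a factor [B] is split off and counted, the threshold for the remaining word drops to
   [K - 1]. *)
have := IH K _ _ x dC; have := IH (K - 1) _ _ x dB.
have -> : insertions A B N (A f) x =
    insertions A B N (A f \- B f) x + insertions A B N (B f) x.
  by rewrite {1}AE (po_D pI dC dB).
have -> : iter N A (A f) x = iter N A (A f \- B f) x + iter N A (B f) x.
  by rewrite {1}AE (po_D (posop_iter N pA) dC dB).
have -> : iter N Z (Z f) x =
    iter N Z (A f \- B f) x + expR s * iter N Z (B f) x.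
  have -> : Z f = (A f \- B f) \+ (fun x => expR s * B f x).
    by apply/funext => y; rewrite /Z /=; ring.
  have es := expR_ge0 s.
  rewrite (po_D (posop_iter N pZ) dC (domZ es dB)) /=.
  by rewrite (po_Z (posop_iter N pZ) es dB).
have -> : expR (- (s * (K - 1))) = expR (- (s * K)) * expR s.
  by rewrite -expRD; congr expR; ring.
move=> h1 h2; have := lerD h1 h2.
set X := iter N Z (B f) x; set Y := iter N Z _ x.
set a := iter N A (B f) x; set c := iter N A _ x.
set e := expR (- (s * K)); move: (insertions _ _ _ _ _) (insertions _ _ _ _ _).
move=> i1 i2 h; rewrite -subr_ge0 in h; rewrite -subr_ge0.
by apply: le_trans h _; rewrite le_eqVlt; apply/orP; left; apply/eqP; ring.
Qed.

(** Take the threshold [(b + eps) * N] in [insertions_le]. The weighted operator has norm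
    [1 + (expR s - 1) * b], so the second term decays at the rate supplied by
    [concentration_rate]. *)
Lemma insertions_rate A B b eps : 0 <= b <= 1 -> 0 < eps <= 1 ->
  posop 1 A -> posop b B -> (forall M f x, dom M f -> B f x <= A f x) ->
  exists c q, [/\ 0 <= c, 0 < q < 1 & forall N M f x, dom M f ->
    insertions A B N f x <=
      (b + eps) * N%:R * iter N A f x + c * q ^+ N * (M * phi x)].
Proof.
move=> b01 e01 pA pB BA; have [s s0] := concentration_rate b01 e01.
set q := _ * _ => q01; exists s^-1, q; split => //.
  by rewrite invr_ge0 ltW.
move=> N M f x df.
apply: (le_trans (insertions_le N ((b + eps) * N%:R) x pA pB BA s0 df)).
rewrite lerD2l.
have es0 : 0 <= expR s - 1 by rewrite subr_ge0 ltW // pexpR_gt1.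
have pZ : posop (1 + (expR s - 1) * b)
    (fun g => A g \+ (fun x => (expR s - 1) * B g x)).
  by apply: posopD => //; exact: posopZ.
have [_ /(_ x)/andP[_ h]] := po_dom (posop_iter N pZ) df.
rewrite -!mulrA ler_pM2l ?invr_gt0 //.
apply: (le_trans (ler_wpM2l (expR_ge0 _) h)).
rewrite exprMn -!mulrA mulrA -expRM_natl.
have -> : N%:R * - (s * (b + eps)) = - (s * ((b + eps) * N%:R)) by ring.
by [].
Qed.

Lemma iter_iterU l i f : iter i (iter l U) f = iter (l * i) U f.
Proof.
elim: i => [|i IH]; first by rewrite muln0.
by rewrite iterS IH -iterD mulnS.
Qed.

Lemma dom_phi : dom 1 phi.
Proof.
split; first by have [] := ws_exp W.
by move=> x; rewrite mul1r lexx ltW // phi_gt0.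
Qed.

Lemma iterU_phi n : iter n U phi = phi.
Proof.
elim: n => //= n ->; apply/funext => x.
change (r * fine (rw_op v (EFin \o phi) x) = phi x).
by rewrite rw_op_phi /= mulVKf // lt0r_neq0 // (ws_r0 W).
Qed.

(* Inserting [B], of duration [l], at every time [t < T]: one block
   decomposition for each residue class of [t] modulo [l]. *)
Lemma insertions_times l B b eps : (0 < l)%N -> 0 <= b <= 1 -> 0 < eps <= 1 ->
  posop b B -> (forall M f x, dom M f -> B f x <= iter l U f x) ->
  exists c q, [/\ 0 <= c, 0 < q < 1 & forall N M f x, dom M f ->
    insertions U B (l * N) f x <=
      (b + eps) * (l * N)%:R * iter (l * N + l).-1 U f x
      + c * q ^+ N * (M * phi x)].
Proof.
move=> l0 b01 e01 pB BU.
have pUl : posop 1 (iter l U) by exact: posop_iterU.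
have [c [q [c0 q01 H]]] := insertions_rate b01 e01 pUl pB BU.
exists (l%:R * c), q; split; rewrite ?mulr_ge0 // => N M f x df.
rewrite insertionsE.
rewrite (sum_blocks (fun t => iter t U (B (iter ((l * N).-1 - t) U f)) x)).
apply: (@le_trans _ _ (\sum_(a < l) ((b + eps) * N%:R * iter (l * N + l).-1 U f x
    + c * q ^+ N * (M * phi x)))); last first.
  rewrite sumr_const card_ord -[_ *+ l]mulr_natl mulrDr natrM.
  by rewrite le_eqVlt; apply/orP; left; apply/eqP; ring.
(* The residue class [a] leaves [a] factors outside the blocks on one side and [l.-1 - a] on the
   other, so the total length is the same for all classes. *)
apply: ler_sum => a _; set k := (l.-1 - a)%N.
have dk : dom M (iter k U f) by exact: dom_iterU.
pose G i := iter i (iter l U) (B (iter (N.-1 - i) (iter l U) (iter k U f))).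
have dG i : dom (1 ^+ i * (b * (1 ^+ (N.-1 - i) * M))) (G i).
  apply: (po_dom (posop_iter i pUl)); apply: (po_dom pB).
  exact: (po_dom (posop_iter _ pUl)).
have dG' i : (i < N)%N -> dom (b * M) (G i).
  by move=> _; have := dG i; rewrite !expr1n !mul1r.
have [M' dM' E'] := posop_sum (posop_iterU a) dG'.
have -> : \sum_(i < N) iter (a + l * i) U
    (B (iter ((l * N).-1 - (a + l * i)) U f)) x =
    iter a U (fun y => \sum_(i < N) G i y) x.
  rewrite E'; apply: eq_bigr => i _; rewrite /G !iter_iterU -!iterD.
  congr (iter _ _ (B (iter _ _ _)) x).
  rewrite /k; have := ltn_ord i; have := ltn_ord a; nia.
have -> : (fun y => \sum_(i < N) G i y) = insertions (iter l U) B N (iter k U f).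
  by apply/funext => y; rewrite insertionsE.
have [b0 _] := andP b01; have [e0 _] := andP e01; have [q0 _] := andP q01.
have be0 : 0 <= (b + eps) * N%:R by rewrite mulr_ge0 // addr_ge0 // ltW.
have M0 := dom_ge0 df.
have cq0 : 0 <= c * q ^+ N * M by rewrite !mulr_ge0 // exprn_ge0 // ltW.
have dI : dom M (iter N (iter l U) (iter k U f)).
  by rewrite iter_iterU; exact: dom_iterU.
have dP := domZ be0 dI; have dQ := domZ cq0 dom_phi.
have pa := posop_iterU a.
have dJ : dom (N%:R * b * M) (insertions (iter l U) B N (iter k U f)).
  exact: (po_dom (posop_insertions N pUl pB)).
have := po_le pa dJ (domD dP dQ) _ x.
rewrite (po_D pa dP dQ) (po_Z pa be0 dI) (po_Z pa cq0 dom_phi) /= iterU_phi.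
rewrite iter_iterU -!iterD -!mulrA.
have -> : (a + (l * N + k))%N = (l * N + l).-1.
  by rewrite /k; have := ltn_ord a; lia.
apply=> y; have := H N _ _ y dk.
rewrite iter_iterU -iterD => h; apply: (le_trans h).
by rewrite le_eqVlt; apply/orP; left; apply/eqP; ring.
Qed.

(** Inserting [A + B], that is [k] further steps, gives the same power of [U] at each of the [T]
    places. *)
Lemma insertions_split k A B T f M x : posop 1 A -> posop 1 B ->
  (forall M f, dom M f -> iter k U f = A f \+ B f) -> dom M f ->
  insertions U A T f x + insertions U B T f x =
  T%:R * iter (T + k).-1 U f x.
Proof.
move=> pA pB AB df; rewrite !insertionsE -big_split /=.
rewrite (eq_bigr (fun=> iter (T + k).-1 U f x)) => [|i _].
  by rewrite sumr_const card_ord mulr_natl.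
have di := dom_iterU (T.-1 - i) df.
have dA := po_dom pA di; have dB := po_dom pB di.
transitivity (iter i U (A (iter (T.-1 - i) U f) \+ B (iter (T.-1 - i) U f)) x).
  by rewrite (po_D (posop_iterU i) dA dB).
rewrite -(AB _ _ di) -!iterD; congr (iter _ U f x).
by have := ltn_ord i; lia.
Qed.

Lemma insertionsZ A b c T f M x : 0 <= c -> posop b A -> dom M f ->
  insertions U (fun f x => c * A f x) T f x = c * insertions U A T f x.
Proof.
move=> c0 pA df; rewrite !insertionsE mulr_sumr; apply: eq_bigr => i _.
have di := dom_iterU (T.-1 - i) df.
by rewrite (po_Z (posop_iterU i) c0 (po_dom pA di)).
Qed.

(** By [insertions_split], the insertions of [A] are [T] copies of [U^(T+k-1)] minus those of [B].
    As a part of [U^k] of mass [del], [B] accounts for at most [2 * del * T] copies; as a part of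
    [U^l], [gam * A] accounts for at most [(gam + gam * del) * T] copies of [U^(T+l-1)]. Division by
    [gam * T] gives the claim. *)
Lemma smoothing_comparison k l A B gam del :
  (0 < k)%N -> (0 < l)%N -> 0 < gam <= 1 -> 0 < del <= 1 ->
  posop 1 A -> posop del B ->
  (forall M f, dom M f -> iter k U f = A f \+ B f) ->
  (forall M f x, dom M f -> gam * A f x <= iter l U f x) ->
  exists c q, [/\ 0 <= c, 0 < q < 1 & forall M f x n, dom M f ->
    (1 - del *+ 2) * iter (n + k) U f x <=
      (1 + del) * iter (n + l) U f x + c * q ^+ n * (M * phi x)].
Proof.
move=> k0 l0 /andP[g0 g1] /andP[d0 d1] pA pB AB AU.
have pB1 : posop 1 B by apply: (posop_weaken d1).
have pgA : posop gam (fun f x => gam * A f x).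
  by rewrite -[X in posop X]mulr1; apply: posopZ => //; exact: ltW.
(* The tolerance for [gam * A] is [gam * del], which becomes [del] after division by [gam]. *)
have gd01 : 0 < gam * del <= 1.
  by rewrite mulr_gt0 //= mulr_ile1 // ltW.
have g01 : 0 <= gam <= 1 by rewrite ltW.
have d01 : 0 <= del <= 1 by rewrite ltW.
have d01' : 0 < del <= 1 by rewrite d0.
have [c1 [q1 [c10 /andP[q10 q11] H1]]] :=
  insertions_times l0 g01 gd01 pgA AU.
have BU M f x : dom M f -> B f x <= iter k U f x.
  move=> df; rewrite (AB _ _ df) /= lerDr.
  exact: dom_f_ge0 x (po_dom pA df).
have [c2 [q2 [c20 /andP[q20 q21] H2]]] := insertions_times k0 d01 d01' pB BU.
pose q := Num.max q1 q2.
have q01 : 0 < q < 1 by rewrite /q lt_max q10 /= gt_max q11.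
have kl0 : (0 < k * l)%N by rewrite muln_gt0 k0.
have [c3 [q3 [c30 q301 H3]]] := geometric_blocks q01 kl0.
have [q0 q1'] := andP q01.
(* The value 1 serves the times shorter than one block, where the trivial bound [M * phi x] is
   used. *)
pose c4 := Num.max ((c1 + gam * c2) / gam) 1.
have c40 : 0 <= c4 by rewrite le_max ler01 orbT.
exists (c4 * c3), q3; split => //; first by rewrite mulr_ge0.
suff main M f x n : dom M f -> (1 - del *+ 2) * iter (n + k) U f x <=
    (1 + del) * iter (n + l) U f x + c4 * q ^+ (n.+1 %/ (k * l)) * (M * phi x).
  move=> M f x n df; apply: le_trans (main M f x n df) _.
  rewrite lerD2l -[c4 * c3 * _]mulrA ler_wpM2r //.
    by rewrite mulr_ge0 ?(dom_ge0 df) // ltW // phi_gt0.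
  by rewrite ler_wpM2l.
move=> df; have [M0 ph0] : 0 <= M /\ 0 < phi x.
  by split; [exact: dom_ge0 _ _ df|exact: phi_gt0 _].
set m := (n.+1 %/ (k * l))%N.
have [m0|m0] := posnP m.
  rewrite m0 expr0 mulr1.
  have [_ /(_ x)/andP[a0 a1]] := dom_iterU (n + k) df.
  have [_ /(_ x)/andP[b0 _]] := dom_iterU (n + l) df.
  apply: (@le_trans _ _ (M * phi x)).
    by apply: (le_trans _ a1); rewrite mulr2n; nra.
  apply: (@le_trans _ _ (c4 * (M * phi x))).
    by rewrite ler_peMl ?le_max ?lexx ?orbT // mulr_ge0 // ltW.
  by rewrite lerDr mulr_ge0 // addr_ge0 // ltW.
set rem := (n.+1 %% (k * l))%N.
have nE : (n.+1 = m * (k * l) + rem)%N by exact: divn_eq.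
set g := iter rem U f.
have dg : dom M g by exact: dom_iterU.
(* A multiple of both block lengths, so that both block decompositions are exact; the remaining
   steps are put into [g]. *)
pose T := (k * l * m)%N.
have T0 : (0 < T)%N by rewrite muln_gt0 kl0.
have E1 : T = (l * (k * m))%N by rewrite /T; ring.
have E2 : T = (k * (l * m))%N by rewrite /T; ring.
have nE' : (n.+1 = T + rem)%N by rewrite nE /T mulnC.
have nk : (n + k = (T + k).-1 + rem)%N.
  by clear -nE' T0; clearbody T rem; lia.
have nl : (n + l = (T + l).-1 + rem)%N.
  by clear -nE' T0; clearbody T rem; lia.
rewrite nk nl !(iterD _ rem) -/g.
have h1 := H1 (k * m)%N M g x dg; rewrite -E1 in h1.
have h2 := H2 (l * m)%N M g x dg; rewrite -E2 in h2.
rewrite (insertionsZ T x (ltW g0) pA dg) in h1.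
have h3 := insertions_split T x pA pB1 AB dg.
set u := iter (T + k).-1 U g x in h2 h3 *.
set w := iter (T + l).-1 U g x in h1 *.
set a := insertions U A T g x in h1 h3.
set b := insertions U B T g x in h2 h3.
set Q := q ^+ m.
have qle e (p : nat) : 0 < e -> e <= q -> e < 1 -> (0 < p)%N -> e ^+ (p * m) <= Q.
  move=> e0 eq e1 p0; apply: (@le_trans _ _ (e ^+ m)).
    by rewrite ler_wiXn2l ?ltW //; rewrite leq_pmull.
  by rewrite lerXn2r // nnegrE ltW.
have Q1 : q1 ^+ (k * m) <= Q by apply: qle => //; rewrite le_max lexx.
have Q2 : q2 ^+ (l * m) <= Q by apply: qle => //; rewrite le_max lexx orbT.
have T1 : 1 <= T%:R :> R by rewrite ler1n.
set P := M * phi x in h1 h2 *.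
have P0 : 0 <= P by rewrite mulr_ge0 // ltW.
have Q0 : 0 <= Q by rewrite exprn_ge0 // ltW.
have e1 : c1 * q1 ^+ (k * m) * P <= c1 * Q * P.
  by rewrite ler_wpM2r // ler_wpM2l.
have e2 : c2 * q2 ^+ (l * m) * P <= c2 * Q * P.
  by rewrite ler_wpM2r // ler_wpM2l.
have c4E : (c1 + gam * c2) <= gam * c4.
  by rewrite -ler_pdivrMl // mulrC le_max lexx.
have : T%:R * (gam * ((1 - del *+ 2) * u)) <=
    T%:R * (gam * ((1 + del) * w + c4 * Q * P)).
  have h3' : a = T%:R * u - b by rewrite -h3 addrK.
  have t1 : gam * (T%:R * u - b) <=
    (gam + gam * del) * T%:R * w + c1 * Q * P.
    by rewrite -h3'; apply: le_trans h1 _; rewrite lerD2l.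
  have t2 : gam * b <= gam * ((del + del) * T%:R * u + c2 * Q * P).
    apply: ler_wpM2l; first exact: ltW.
    by apply: le_trans h2 _; rewrite lerD2l.
  have t3 : (c1 + gam * c2) * (Q * P) <= T%:R * (gam * c4 * (Q * P)).
    apply: (@le_trans _ _ (gam * c4 * (Q * P))).
      by rewrite ler_wpM2r // mulr_ge0.
    by rewrite ler_peMl // !mulr_ge0 // ltW.
  have h := lerD (lerD t1 t2) t3; rewrite -subr_ge0.
  rewrite [X in 0 <= X](_ : _ = ((gam + gam * del) * T%:R * w + c1 * Q * P
    + gam * ((del + del) * T%:R * u + c2 * Q * P)
    + T%:R * (gam * c4 * (Q * P))) - (gam * (T%:R * u - b) + gam * b
    + (c1 + gam * c2) * (Q * P))); last by rewrite mulr2n; ring.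
  by rewrite subr_ge0.
by rewrite ler_pM2l ?ltr0n // ler_pM2l.
Qed.

(** * Asymptotic superinvariance *)

Lemma pos_measure_compact (mu : {measure set E -> \bar R}) :
  (0 < mu setT)%E -> forall (K : nat -> set E), (forall n, compact (K n)) ->
  \bigcup_n K n = setT -> exists n, (0 < mu (K n))%E.
Proof.
move=> mu0 K cK KT; apply: contrapT => /forallNP h.
have mK n : measurable (K n) by exact: (borel_compact hE).
have : (mu setT <= 0)%E.
  rewrite -KT; apply: le_trans (measure_sigma_subadditive mu mK _ _) _ => //.
    by rewrite KT.
  rewrite eseries0 // => n _ _; apply/eqP; rewrite eq_le measure_ge0 andbT.
  by rewrite leNgt; exact/negP.
by rewrite leNgt mu0.
Qed.

Lemma iterU_N_le n K : compact K -> exists2 K', compact K' &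
  forall M f x, dom M f -> iter n U (N K f) x <= r ^+ n * N K' f x.
Proof.
move=> cK; elim: n => [|n [K' cK' IH]].
  by exists K => // M f x _; rewrite expr0 mul1r.
exists (mulset (msupport v) K').
  by apply: compact_mulset => //; exact: ws_compact W.
move=> M f x df /=; have dN := po_dom (posop_N cK) df.
have dN' := po_dom (posop_N cK') df.
have rn0 : 0 <= r ^+ n by rewrite exprn_ge0 // ltW.
apply: (@le_trans _ _ (U (fun y => r ^+ n * N K' f y) x)).
  apply: (po_le posop_U (dom_iterU n dN) (domZ rn0 dN')) => y.
  exact: IH df.
rewrite (po_Z posop_U rn0 dN') exprSr -mulrA ler_wpM2l //.
exact: (U_N_le x cK' df).
Qed.

Lemma N_iterU_le n K : compact K -> exists2 K', compact K' &
  forall M f x, dom M f -> N K (iter n U f) x <= r ^+ n * N K' f x.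
Proof.
move=> cK; elim: n => [|n [K' cK' IH]].
  by exists K => // M f x _; rewrite expr0 mul1r.
exists (mulset K' (msupport v)).
  by apply: compact_mulset => //; exact: ws_compact W.
move=> M f x df; rewrite iterSr.
apply: (le_trans (IH _ _ x (po_dom posop_U df))).
rewrite exprSr -mulrA ler_wpM2l ?exprn_ge0 // ?(ltW r0) //.
exact: (N_U_le x cK' df).
Qed.

Lemma N_iterU_ge n K : compact K -> exists2 K', compact K' &
  forall M f x, dom M f -> r ^+ n * N K f x <= N K' (iter n U f) x.
Proof.
move=> cK; elim: n => [|n [K' cK' IH]].
  by exists K => // M f x _; rewrite expr0 mul1r.
exists (mulset K' (invset (msupport v))).
  apply: compact_mulset => //; apply: compact_invset; exact: ws_compact W.
move=> M f x df; rewrite exprS -mulrA.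
apply: (@le_trans _ _ (r * N K' (iter n U f) x)).
  by apply: ler_wpM2l; [exact: ltW|exact: IH df].
exact: (N_U_ge x cK' (dom_iterU n df)).
Qed.

(** Condition (A) supplies one exponent [j]; adding [m] or [m.+1] steps, with a larger compact set
    in (A), yields two consecutive exponents with a common constant. The bound [m <= l] later keeps
    the delay [l - k] from truncating. *)
Lemma iterU_ge_N m K : compact K -> exists l gam,
  [/\ (0 < l)%N, (m <= l)%N, 0 < gam <= 1 & forall M f x, dom M f ->
    gam * N K f x <= iter l U f x /\ gam * N K f x <= iter l.+1 U f x].
Proof.
move=> cK.
have [K1 cK1 H1] := N_iterU_ge m cK.
have [K2 cK2 H2] := N_iterU_ge m.+1 cK.
have cK12 := compactU cK1 cK2.
have [g [j [g0 j0 H]]] := conditionA_N cK12.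
have rm0 n : 0 < r ^+ n by rewrite exprn_gt0.
pose gam := Num.min 1 (g * Num.min (r ^+ m) (r ^+ m.+1)).
exists (j + m)%N, gam; split; first by rewrite addn_gt0 j0.
- exact: leq_addl.
- by rewrite lt_min ltr01 ge_min lexx mulr_gt0 // lt_min !rm0.
move=> M f x df.
have dn n := dom_iterU n df.
have Ng0 : 0 <= N K f x by exact: dom_f_ge0 x (po_dom (posop_N cK) df).
have gamle n : n = m \/ n = m.+1 -> gam * N K f x <= g * (r ^+ n * N K f x).
  move=> nm; rewrite mulrA ler_wpM2r //.
  apply: (@le_trans _ _ (g * Num.min (r ^+ m) (r ^+ m.+1))).
    by rewrite ge_min lexx orbT.
  by rewrite ler_pM2l // ge_min; case: nm => ->; rewrite lexx ?orbT.
split.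
  apply: (le_trans (gamle m _)); first by left.
  rewrite iterD; apply: le_trans (H _ _ x (dn m)).
  rewrite ler_pM2l //; apply: (le_trans (H1 _ _ x df)).
  exact: (N_setU x cK1 cK2 (dn m)).1.
apply: (le_trans (gamle m.+1 _)); first by right.
rewrite -addnS iterD; apply: le_trans (H _ _ x (dn m.+1)).
rewrite ler_pM2l //; apply: (le_trans (H2 _ _ x df)).
exact: (N_setU x cK1 cK2 (dn m.+1)).2.
Qed.

Lemma N_phi K x : compact K -> N K phi x = wt K * phi x.
Proof. by move=> cK; rewrite /indic_conv gop_phi // mulrC. Qed.

Lemma po_B b A M P f g : posop b A -> dom M f -> dom P g ->
  (forall x, g x <= f x) -> A (f \- g) = A f \- A g.
Proof.
move=> pA df dg gf; have dfg := domB df dg gf.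
have {2}-> : f = (f \- g) \+ g by apply/funext => x /=; rewrite subrK.
by rewrite (po_D pA dfg dg); apply/funext => x /=; rewrite addrK.
Qed.

(* Up to a part of small mass, some convolution power of the law of the walk
   has a bounded compactly supported density. *)
Lemma regular_part del : 0 < del -> exists k A B K c,
  [/\ (0 < k)%N, posop 1 A, posop del B,
    (forall M f, dom M f -> iter k U f = A f \+ B f) &
    [/\ compact K, 0 < c & forall M f x, dom M f -> A f x <= c * N K f x]].
Proof.
move=> del0.
have [KK [cKK _ KKT _]] := compact_exhaustion E_lc.
have [i pi0] := pos_measure_compact (ws_pos W) cKK KKT.
set K0 := KK i in pi0; have cK0 : compact K0 by exact: cKK.
have [gam [j [g0 j0 H]]] := conditionA_N cK0.
(* The [phi]-mass of the smoothing part of [U^j]. The rest [C] multiplies [phi] by [1 - t], so its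
   powers become small in norm. *)
pose t := gam * wt K0.
have t0 : 0 < t by rewrite mulr_gt0 // wt_gt0.
pose C f := iter j U f \- (fun x => gam * N K0 f x).
have pN := posopZ (ltW g0) (posop_N cK0).
have pj := posop_iterU j.
have pC1 : posop 1 C by exact: (posopB pj pN).
have Cphi : C phi = (fun x => (1 - t) * phi x).
  apply/funext => x; rewrite /C /= iterU_phi N_phi //.
  by rewrite /t mulrBl mul1r mulrA.
have dphi := dom_phi.
have t1 : t <= 1.
  have := dom_f_ge0 1%g (po_dom pC1 dphi).
  by rewrite Cphi phi1 mulr1 subr_ge0.
have pC : posop (1 - t) C.
  split; [|exact: (po_D pC1)|exact: (po_Z pC1)] => M f df.
  have [mC C0] := po_dom pC1 df; split => // x.
  have /andP[-> _] /= := C0 x; have M0 := dom_ge0 df.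
  have dM := domZ M0 dphi.
  apply: (le_trans (po_le pC1 df dM _ x)).
    by move=> y; have [_ /(_ y)/andP[]] := df.
  by rewrite (po_Z pC1 M0 dphi) Cphi mulrCA mulrA.
have [p p0 tp] : exists2 p, (0 < p)%N & (1 - t) ^+ p <= del.
  have t01 : `|1 - t| < 1 by rewrite ger0_norm ?subr_ge0 // ltrBlDr ltrDl.
  have := @cvg_geometric R 1 _ t01; move/cvgrPdist_le => /(_ _ del0).
  move=> [n _ /(_ n.+1)] /(_ (leqnSn n)).
  rewrite /geometric /= mul1r sub0r normrN ger0_norm ?exprn_ge0 ?subr_ge0 // => h.
  by exists n.+1.
have pCi q : posop 1 (iter q C) by rewrite -(expr1n R q); exact: posop_iter.
(* In the expansion, every product other than the power of [C] contains a smoothing factor. Moving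
   the other factors across it only enlarges the compact set and the constant. *)
have claim q : exists K c, [/\ compact K, 0 < c &
    forall M f x, dom M f -> iter q C f x <= iter (j * q) U f x /\
      iter (j * q) U f x - iter q C f x <= c * N K f x].
  elim: q => [|q [K [c [cK c0 IH]]]].
    exists set0, 1; split => //; first exact: compact0.
    move=> M f x df; rewrite muln0 subrr mul1r; split => //.
    exact: (dom_f_ge0 x (po_dom (posop_N compact0) df)).
  have [K1 cK1 H1] := iterU_N_le j cK.
  have [K2 cK2 H2] := N_iterU_le (j * q) cK0.
  have cK12 := compactU cK1 cK2.
  exists (K1 `|` K2), (c * r ^+ j + gam * r ^+ (j * q)); split => //.
    by rewrite addr_gt0 // mulr_gt0 // exprn_gt0.
  move=> M f x df.
  have d1 := dom_iterU (j * q) df; have d2 := po_dom (pCi q) df.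
  have le12 y : iter q C f y <= iter (j * q) U f y by have [] := IH _ _ y df.
  have dK := domZ (ltW c0) (po_dom (posop_N cK) df).
  have eq1 : iter (j * q.+1) U f x - iter q.+1 C f x =
      iter j U (iter (j * q) U f \- iter q C f) x + gam * N K0 (iter q C f) x.
    rewrite (po_B pj d1 d2 le12) mulnS iterD [iter q.+1 C f]/= /C /=.
    by ring.
  have n1 : 0 <= iter j U (iter (j * q) U f \- iter q C f) x.
    exact: (dom_f_ge0 x (po_dom pj (domB d1 d2 le12))).
  have n2 : 0 <= gam * N K0 (iter q C f) x.
    exact: (dom_f_ge0 x (po_dom pN d2)).
  have n3 : gam * N K0 (iter q C f) x <= gam * N K0 (iter (j * q) U f) x.
    exact: (po_le pN d2 d1).
  split; first by rewrite -subr_ge0 eq1 addr_ge0.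
  rewrite eq1 mulrDl; apply: lerD.
    apply: (@le_trans _ _ (iter j U (fun y => c * N K f y) x)).
      by apply: (po_le pj (domB d1 d2 le12) dK) => y; have [] := IH _ _ y df.
    rewrite (po_Z pj (ltW c0) (po_dom (posop_N cK) df)) -mulrA ler_pM2l //.
    apply: (le_trans (H1 _ _ x df)); rewrite ler_pM2l ?exprn_gt0 //.
    exact: (N_setU x cK1 cK2 df).1.
  apply: (le_trans n3); rewrite -mulrA ler_pM2l //.
  apply: (le_trans (H2 _ _ x df)); rewrite ler_pM2l ?exprn_gt0 //.
  exact: (N_setU x cK1 cK2 df).2.
have [K [c [cK c0 HK]]] := claim p.
exists (j * p)%N, (fun f => iter (j * p) U f \- iter p C f), (iter p C), K, c.
split => //.
- by rewrite muln_gt0 j0.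
- apply: posopB; [exact: (posop_iterU)|exact: pCi|].
  by move=> M f x df; have [] := HK _ _ x df.
- by apply: (posop_weaken tp); exact: posop_iter.
- by move=> M f df; apply/funext => x /=; rewrite subrK.
- by split => // M f x df; have [] := HK _ _ x df.
Qed.

(** The regular part [A] of [U^k] is at most a smoothing, and a smoothing is at most a multiple of
    [U^l] and of [U^(l+1)]. The comparison thus applies with both exponents and leaves the delays
    [l - k] and [l - k + 1]. *)
Lemma almost_superinvariant del : 0 < del <= 1 -> exists t, forall s,
  s = t \/ s = t.+1 -> exists c q, [/\ 0 <= c, 0 < q < 1 &
    forall M f x n, dom M f ->
    (1 - del) * iter n U f x <= iter (n + s) U f x + c * q ^+ n * (M * phi x)].
Proof.
(* With thirds, [(1 + e) * (1 - 3 * e) <= 1 - 2 * e], so the factor [1 + e] can be divided out. *)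
move=> /andP[del0 del1]; pose e := del / 3.
have e0 : 0 < e by rewrite divr_gt0.
have eE : del = e + e + e by rewrite /e; lra.
have [k [A [B [K [c [k0 pA pB AB [cK c0 AN]]]]]]] := regular_part e0.
have [l [gam [l0 kl /andP[g0 g1] H]]] := iterU_ge_N k cK.
pose g := Num.min 1 (gam / c).
have g01 : 0 < g <= 1 by rewrite lt_min ltr01 divr_gt0 //= ge_min lexx.
have gA M f x : dom M f -> g * A f x <= gam * N K f x.
  move=> df; have A0 := dom_f_ge0 x (po_dom pA df).
  apply: (@le_trans _ _ (gam / c * A f x)).
    by rewrite ler_wpM2r // ge_min lexx orbT.
  by rewrite -mulrA ler_pM2l // ler_pdivrMl //; exact: AN df.
have e01 : 0 < e <= 1 by rewrite e0 /= ler_pdivrMr //; lra.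
have core s : (0 < s)%N -> (k <= s)%N ->
    (forall M f x, dom M f -> gam * N K f x <= iter s U f x) ->
    exists c q, [/\ 0 <= c, 0 < q < 1 & forall M f x n, dom M f ->
    (1 - del) * iter n U f x <=
      iter (n + (s - k)) U f x + c * q ^+ n * (M * phi x)].
  move=> s0 ks Hs.
  have gAs M f x : dom M f -> g * A f x <= iter s U f x.
    by move=> df; apply: le_trans (gA _ _ x df) (Hs _ _ x df).
  have [c1 [q [c10 /andP[q0 q1] Hc]]] :=
    smoothing_comparison k0 s0 g01 e01 pA pB AB gAs.
  (* The division undoes the shift from [n] to [n - k]; the 1 makes the error term exceed
     [M * phi x] at the times [n < k], out of reach of the shift. *)
  pose c2 := Num.max 1 c1 / q ^+ k.
  have mx0 : 0 <= Num.max 1 c1 by rewrite le_max ler01.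
  exists c2, q; split; rewrite ?q0 //.
    by rewrite divr_ge0 // exprn_ge0 // ltW.
  move=> M f x n df; set Mp := M * phi x.
  have Mp0 : 0 <= Mp.
    by rewrite mulr_ge0 ?(dom_ge0 df) // ltW // phi_gt0.
  have [_ /(_ x)/andP[u0 u1]] := dom_iterU n df.
  have [_ /(_ x)/andP[w0 w1]] := dom_iterU (n + (s - k)) df.
  rewrite -/Mp in u1.
  have [nk|nk] := ltnP n k.
    apply: (@le_trans _ _ Mp); first by apply: (le_trans _ u1); nra.
    rewrite ler_wpDl // -/Mp ler_peMl //.
    rewrite /c2 mulrAC ler_pdivlMr ?exprn_gt0 // mul1r.
    apply: (@le_trans _ _ (1 * q ^+ n)).
      by rewrite mul1r ler_wiXn2l ?(ltW q0) ?(ltW q1) // ltnW.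
    by rewrite ler_wpM2r ?le_max ?lexx // exprn_ge0 // ltW.
  have := Hc M f x (n - k)%N df; rewrite subnK //.
  have -> : (n - k + s)%N = (n + (s - k))%N by clear -nk ks; lia.
  set u := iter n U f x in u0 u1 *; set w := iter _ U f x in w0 w1 *.
  have -> : q ^+ (n - k) = q ^+ n / q ^+ k.
    by rewrite -expfB_cond // (gt_eqF q0).
  move=> h.
  have h2 : c1 * (q ^+ n / q ^+ k) * Mp <= c2 * q ^+ n * Mp.
    rewrite ler_wpM2r // /c2 mulrCA mulrC ler_wpM2r // ?exprn_ge0 ?(ltW q0) //.
    by rewrite ler_wpM2r ?invr_ge0 ?exprn_ge0 ?(ltW q0) // le_max lexx orbT.
  set X := c1 * (q ^+ n / q ^+ k) * Mp in h h2.
  have X0 : 0 <= X.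
    apply: mulr_ge0 => //; apply: mulr_ge0 => //.
    by apply: divr_ge0; apply: exprn_ge0; exact: ltW.
  apply: (@le_trans _ _ (w + X)); last by rewrite lerD2l.
  rewrite mulr2n in h.
  have : (1 + e) * ((1 - del) * u) <= (1 + e) * (w + X).
    apply: (@le_trans _ _ ((1 - (e + e)) * u)); last by nra.
    by rewrite mulrA ler_wpM2r //; rewrite eE; nra.
  by rewrite ler_pM2l // addr_gt0.
exists (l - k)%N => s [->|->].
  by apply: core => // M f x df; have [] := H _ _ x df.
have -> : (l - k).+1 = (l.+1 - k)%N by clear -kl; lia.
apply: core => //; first exact: leqW.
by move=> M f x df; have [] := H _ _ x df.
Qed.

(** * Pairings with bounded functions of compact support *)

Definition ccf K (c : R) f :=
  [/\ measurable_fun setT f, (forall x, 0 <= f x <= c) & forall x, ~ K x -> f x = 0].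

Lemma ccf_indic K : compact K -> ccf K 1 \1_K.
Proof.
move=> cK; split.
- by apply: measurable_indic; exact: borel_compact.
- by move=> x; rewrite indicE; case: (_ \in _); rewrite ?lexx ?ler01.
- by move=> x nKx; rewrite indicE memNset.
Qed.

Lemma ccf_dom K c f : compact K -> ccf K c f -> exists M, dom M f.
Proof. by move=> cK [mf f0 fK]; exact: dom_compact _ _ _ cK mf f0 fK. Qed.

Lemma ccf_nnm K c f : ccf K c f -> nnm (EFin \o f).
Proof.
move=> [mf f0 _]; split; first exact/measurable_EFinP.
by move=> x; rewrite lee_fin; have /andP[] := f0 x.
Qed.

Lemma ccf_ge0 K c f : ccf K c f -> 0 <= c.
Proof. by move=> [_ /(_ 1%g)/andP[h1 h2] _]; exact: le_trans h1 h2. Qed.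

Lemma ccf_f_ge0 K c f x : ccf K c f -> 0 <= f x.
Proof. by move=> [_ /(_ x)/andP[]]. Qed.

Lemma ccf_le_indic K c f x : ccf K c f -> f x <= c * \1_K x.
Proof.
move=> [_ f0 fK]; rewrite indicE; have [Kx|nKx] := pselect (K x).
  by rewrite mem_set // mulr1; have /andP[] := f0 x.
by rewrite memNset // mulr0 fK.
Qed.

Definition pairing h f : R := fine (\int[pi]_x (h x * f x)%:E)%E.

Lemma pair_EFin K c h M f : compact K -> ccf K c h -> dom M f ->
  (pairing h f)%:E = (\int[pi]_x (h x * f x)%:E)%E.
Proof.
move=> cK ch df; have nh := ccf_nnm ch; have nf := dom_nnm df.
have M0 := dom_ge0 df; have c0 := ccf_ge0 ch.
apply/esym; apply: (@fine_EFin _ (c * M * wt K)).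
  by apply: integral_ge0 => x _; exact: (nnmM nh nf).2.
have nKp : nnm (fun x => (\1_K x * phi x)%:E).
  exact: (nnmM (nK cK) nnm_phi).
rewrite EFinM -(wt_EFin cK) -(mf_Z (mf_integral pi)) ?mulr_ge0 //.
apply: (mf_le (mf_integral pi)); first exact: (nnmM nh nf).
  by apply: nnmZ => //; rewrite mulr_ge0.
move=> x; rewrite -EFinM lee_fin mulrACA.
have h0 := ccf_f_ge0 x ch; have f0 := dom_f_ge0 x df.
apply: ler_pM => //; first exact: ccf_le_indic ch.
by have [_ /(_ x)/andP[]] := df.
Qed.

Record posfun (m : (E -> R) -> R) : Prop := PosFun {
  pf_ge0 : forall M f, dom M f -> 0 <= m f ;
  pf_D : forall M P f g, dom M f -> dom P g -> m (f \+ g) = m f + m g ;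
  pf_Z : forall c M f, 0 <= c -> dom M f -> m (fun x => c * f x) = c * m f }.

Lemma pf_le m M P f g : posfun m -> dom M f -> dom P g ->
  (forall x, f x <= g x) -> m f <= m g.
Proof.
move=> pm df dg fg; have dgf := domB dg df fg.
have -> : g = f \+ (g \- f) by apply/funext => y /=; rewrite addrC subrK.
by rewrite (pf_D pm df dgf) lerDl (pf_ge0 pm dgf).
Qed.

Lemma pf_comp m b A : posfun m -> posop b A -> posfun (fun f => m (A f)).
Proof.
move=> pm pA; split.
- by move=> M f df; exact: pf_ge0 pm _ _ (po_dom pA df).
- move=> M P f g df dg; rewrite (po_D pA df dg).
  exact: (pf_D pm (po_dom pA df) (po_dom pA dg)).
- move=> c M f c0 df; rewrite (po_Z pA c0 df).
  exact: (pf_Z pm c0 (po_dom pA df)).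
Qed.

Lemma pf_scale m c : 0 <= c -> posfun m -> posfun (fun f => c * m f).
Proof.
move=> c0 pm; split.
- by move=> M f df; rewrite mulr_ge0 // (pf_ge0 pm df).
- by move=> M P f g df dg; rewrite (pf_D pm df dg) mulrDr.
- by move=> a M f a0 df; rewrite (pf_Z pm a0 df) mulrCA.
Qed.

Lemma pf_B m m' : posfun m -> posfun m' ->
  (forall M f, dom M f -> m' f <= m f) -> posfun (fun f => m f - m' f).
Proof.
move=> pm pm' mm'; split.
- by move=> M f df; rewrite subr_ge0 (mm' M).
- by move=> M P f g df dg; rewrite (pf_D pm df dg) (pf_D pm' df dg); ring.
- by move=> a M f a0 df; rewrite (pf_Z pm a0 df) (pf_Z pm' a0 df); ring.
Qed.

Lemma posfun_pair K c h : compact K -> ccf K c h -> posfun (pairing h).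
Proof.
move=> cK ch; have nh := ccf_nnm ch.
have nhf M f : dom M f -> nnm (fun x => (h x * f x)%:E).
  by move=> df; exact: (nnmM nh (dom_nnm df)).
split.
- move=> M f df; apply: fine_ge0; apply: integral_ge0 => x _.
  exact: (nhf _ _ df).2.
- move=> M P f g df dg; apply: EFin_inj.
  rewrite EFinD (pair_EFin cK ch df) (pair_EFin cK ch dg).
  rewrite (pair_EFin cK ch (domD df dg)).
  rewrite -(mf_D (mf_integral pi) (nhf _ _ df) (nhf _ _ dg)).
  by apply: eq_integral => x _ /=; rewrite mulrDr.
- move=> a M f a0 df; apply: EFin_inj.
  rewrite EFinM (pair_EFin cK ch df) (pair_EFin cK ch (domZ a0 df)).
  rewrite -(mf_Z (mf_integral pi) a0 (nhf _ _ df)).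
  by apply: eq_integral => x _ /=; rewrite -EFinM mulrCA.
Qed.

Lemma pair_le_l K c h K' c' h' M f : compact K -> compact K' ->
  ccf K c h -> ccf K' c' h' -> dom M f -> (forall x, h x <= h' x) ->
  pairing h f <= pairing h' f.
Proof.
move=> cK cK' ch ch' df hh'.
rewrite -lee_fin (pair_EFin cK ch df) (pair_EFin cK' ch' df).
apply: (mf_le (mf_integral pi)).
- exact: (nnmM (ccf_nnm ch) (dom_nnm df)).
- exact: (nnmM (ccf_nnm ch') (dom_nnm df)).
- by move=> x; rewrite lee_fin ler_wpM2r // (dom_f_ge0 x df).
Qed.

Lemma pairZl K c h M f a : compact K -> ccf K c h -> dom M f -> 0 <= a ->
  pairing (fun x => a * h x) f = a * pairing h f.
Proof.
move=> cK ch df a0; have nhf := nnmM (ccf_nnm ch) (dom_nnm df).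
apply: EFin_inj; rewrite EFinM (pair_EFin cK ch df).
rewrite /pairing.
have -> : (\int[pi]_x (a * h x * f x)%:E = \int[pi]_x (a * (h x * f x))%:E)%E.
  by apply: eq_integral => x _; rewrite mulrA.
have -> : (\int[pi]_x (a * (h x * f x))%:E = (a * pairing h f)%:E)%E.
  rewrite EFinM (pair_EFin cK ch df) -(mf_Z (mf_integral pi) a0 nhf).
  by apply: eq_integral => x _; rewrite -!EFinM.
by rewrite /= EFinM (pair_EFin cK ch df).
Qed.

Lemma ccfZ K c h a : 0 <= a -> ccf K c h -> ccf K (a * c) (fun x => a * h x).
Proof.
move=> a0 [mh h0 hK]; split.
- exact: measurable_funM.
- by move=> x; have /andP[? ?] := h0 x; rewrite mulr_ge0 //= ler_wpM2l.
- by move=> x /hK ->; rewrite mulr0.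
Qed.

Lemma pair_le_indic K c h M f : compact K -> ccf K c h -> dom M f ->
  pairing h f <= c * pairing \1_K f.
Proof.
move=> cK ch df; have ci := ccf_indic cK; have c0 := ccf_ge0 ch.
rewrite -(pairZl cK ci df c0).
apply: (pair_le_l cK cK ch (ccfZ c0 ci) df) => x; exact: ccf_le_indic ch.
Qed.

(** Seen from a point of [K], the set [K^-1 K'] covers [K']. *)
Lemma N_ge_pair K K' M f x : compact K -> compact K' -> dom M f -> K x ->
  pairing \1_K' f <= N (mulset (invset K) K') f x.
Proof.
move=> cK cK' df Kx; have nf := dom_nnm df.
have cKK := compact_mulset (compact_invset cK) cK'.
rewrite -lee_fin (pair_EFin cK' (ccf_indic cK') df) (N_EFin x cKK df).1.
rewrite (gop_translate (ws_l W) x (nK cKK) nf).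
apply: (mf_le (mf_integral pi)).
- exact: (nnmM (nK cK') nf).
- by apply: nnmM => //; exact: (nnm_mull x^-1%g (nK cKK)).
- move=> y; rewrite -EFinM lee_fin ler_wpM2r ?(dom_f_ge0 y df) //.
  rewrite !indicE ler_nat; case: (boolP (y \in K')) => //.
  rewrite inE => K'y; rewrite mem_set //.
  by exists x^-1%g, y; rewrite /invset /= monoid.invgK.
Qed.

(** A lower bound uniform over the starting points in [K], by means of which any pairing can be
    compared with the return sequence. *)
Lemma harnack K K' : compact K -> compact K' -> exists l gam,
  [/\ (0 < l)%N, 0 < gam & forall M f x, dom M f -> K x ->
    gam * pairing \1_K' f <= iter l U f x /\
    gam * pairing \1_K' f <= iter l.+1 U f x].
Proof.
move=> cK cK'; have cKK := compact_mulset (compact_invset cK) cK'.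
have [l [gam [l0 _ /andP[g0 _] H]]] := iterU_ge_N 0 cKK.
exists l, gam; split => // M f x df Kx; have [H1 H2] := H _ _ x df.
have le := ler_wpM2l (ltW g0) (N_ge_pair cK cK' df Kx).
by split; apply: (le_trans le).
Qed.

(** * The return sequence *)

Definition ret K n : R := pairing \1_K (iter n U \1_K).

Lemma indic_dom K : compact K -> exists M, dom M (\1_K : E -> R).
Proof. by move=> cK; exact: (ccf_dom cK (ccf_indic cK)). Qed.

Lemma ret0 K : compact K -> (ret K 0)%:E = pi K.
Proof.
move=> cK; have [M dM] := indic_dom cK.
rewrite (pair_EFin cK (ccf_indic cK) dM).
rewrite (eq_integral (EFin \o \1_K)); last first.
  by move=> x _ /=; rewrite indicE; case: (_ \in _); rewrite ?mulr1 ?mulr0.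
by rewrite integral_indic ?setIT //; exact: borel_compact.
Qed.

(** A lower bound that multiplies under composition, which turns the return sequence into a
    supermultiplicative one up to constants. *)
Definition growth K t c := forall x, c * \1_K x <= iter t U \1_K x.

Lemma growthD K s t a b : compact K -> 0 <= b -> growth K s a -> growth K t b ->
  growth K (s + t) (a * b).
Proof.
move=> cK b0 Ga Gb x; have [M dM] := indic_dom cK.
rewrite iterD; apply: (@le_trans _ _ (iter s U (fun y => b * \1_K y) x)).
  rewrite (po_Z (posop_iterU s) b0 dM) mulrAC mulrC.
  by rewrite ler_wpM2l.
exact: (po_le (posop_iterU s) (domZ b0 dM) (dom_iterU t dM) Gb).
Qed.

Lemma growth_iter K t c p : compact K -> 0 <= c -> growth K t c ->
  growth K (t * p) (c ^+ p).
Proof.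
move=> cK c0 G; elim: p => [|p IH].
  by move=> x; rewrite muln0 expr0 mul1r.
by rewrite mulnS exprS; apply: growthD => //; exact: exprn_ge0.
Qed.

Lemma growth_le K t a b : a <= b -> growth K t b -> growth K t a.
Proof.
by move=> ab G x; apply: le_trans (G x); rewrite ler_wpM2r.
Qed.

Lemma growth_ret K : compact K -> exists l gam, [/\ (0 < l)%N, 0 < gam &
  forall n, growth K (l + n) (gam * ret K n) /\
            growth K (l.+1 + n) (gam * ret K n)].
Proof.
move=> cK; have [l [gam [l0 g0 H]]] := harnack cK cK.
have [M dM] := indic_dom cK.
exists l, gam; split => // n.
have dn := dom_iterU n dM.
have aux s x : (K x -> gam * ret K n <= iter s U (iter n U \1_K) x) ->
    gam * ret K n * \1_K x <= iter (s + n) U \1_K x.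
  move=> h; rewrite iterD indicE; have [Kx|nKx] := pselect (K x).
    by rewrite mem_set // mulr1; exact: h.
  by rewrite memNset // mulr0; exact: dom_f_ge0 x (dom_iterU s dn).
by split=> x; apply: aux => Kx; have [] := H _ _ x dn Kx.
Qed.

(** The exponents [l] and [l.+1] are coprime, so their combinations fill all integers from [l * l]
    on. *)
Lemma growth_all K : compact K -> (0 < pi K)%E -> exists J, forall n, (J <= n)%N ->
  exists2 c, 0 < c & growth K n c.
Proof.
move=> cK pK; have [l [gam [l0 g0 H]]] := growth_ret cK.
have [H1 H2] := H 0%N; rewrite !addn0 in H1 H2.
set c := gam * ret K 0 in H1 H2.
have c0 : 0 < c by rewrite mulr_gt0 // -lte_fin ret0.
exists (l * l)%N => n ln.
(* Since [l.+1] is 1 modulo [l], the remainder counts the steps of length [l.+1]; [l * l <= n] keeps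
   the subtraction from truncating. *)
pose b := (n %% l)%N; pose a := (n %/ l - b)%N.
have lb : (b < l)%N by rewrite ltn_mod.
have bl : (b <= n %/ l)%N by apply: (leq_trans (ltnW lb)); rewrite leq_divRL.
have nE : n = (l * a + l.+1 * b)%N.
  rewrite {1}(divn_eq n l) -/b -(subnK bl) -/a; ring.
exists (c ^+ a * c ^+ b); first by rewrite mulr_gt0 // exprn_gt0.
rewrite nE; apply: growthD => //; first by rewrite exprn_ge0 // ltW.
  by apply: growth_iter => //; exact: ltW.
by apply: growth_iter => //; exact: ltW.
Qed.

(* Fekete's argument: [ret K] is supermultiplicative up to constants. *)
Lemma ret_lower K c : compact K -> (0 < pi K)%E -> 0 < c ->
  (forall q, 0 < q < 1 -> forall n0, exists2 n, (n0 <= n)%N & c * q ^+ n <= ret K n) ->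
  forall q, 0 < q < 1 -> exists n0, forall n, (n0 <= n)%N -> q ^+ n <= ret K n.
Proof.
move=> cK pK c0 H q /andP[q0 q1].
(* Two intermediate rates: the gap from [q2] to [q1'] absorbs [gam], [c] and the [l] extra steps of
   one period, the gap from [q1'] to [q] the constants of the incomplete period. *)
pose q1' := (q + 1) / 2; pose q2 := (q1' + 1) / 2.
have qq1 : q < q1' by rewrite /q1'; lra.
have q1lt : q1' < 1 by rewrite /q1'; lra.
have q12 : q1' < q2 by rewrite /q2; lra.
have q2lt : q2 < 1 by rewrite /q2; lra.
have q10 : 0 < q1' by apply: lt_trans qq1.
have q20 : 0 < q2 by apply: lt_trans q12.
have [l [gam [l0 g0 G]]] := growth_ret cK.
have r1 : 1 < q2 / q1' by rewrite ltr_pdivlMr // mul1r.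
have [n1 Hn1] := expr_large (q1' ^+ l / (gam * c)) r1.
have q201 : 0 < q2 < 1 by rewrite q20.
have [n n1n Hn] := H q2 q201 n1.
pose T := (l + n)%N; have T0 : (0 < T)%N by rewrite addn_gt0 l0.
have GT : growth K T (q1' ^+ T).
  apply: growth_le (G n).1; rewrite /T exprD.
  have := Hn1 n n1n; rewrite (expr_div_n q2 q1') ler_pdivrMr ?mulr_gt0 //.
  rewrite [X in _ <= X -> _]mulrAC ler_pdivlMr ?exprn_gt0 // => h.
  by apply: (le_trans h); rewrite mulrC -mulrA ler_pM2l.
have [J HJ] := growth_all cK pK.
have [c' c'0 Hc'] := @min_pos R (growth K) J (J + T) HJ (@growth_le K).
have r2 : 1 < q1' / q by rewrite ltr_pdivlMr // mul1r.
have [n2 Hn2] := expr_large ((c' * ret K 0)^-1) r2.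
have a0 : 0 < ret K 0 by rewrite -lte_fin ret0.
exists (maxn n2 J) => m; rewrite geq_max => /andP[n2m Jm].
pose p := ((m - J) %/ T)%N; pose rho := (J + (m - J) %% T)%N.
have mE : m = (rho + T * p)%N.
  by rewrite /rho /p -addnA addnC [(T * _)%N]mulnC [(_ %% _ + _)%N]addnC
    -divn_eq subnK.
have Gm : growth K m (c' * q1' ^+ m).
  apply: (@growth_le _ _ _ (c' * (q1' ^+ T) ^+ p)).
    rewrite ler_pM2l // -exprM mE exprD ler_piMl ?exprn_ge0 ?(ltW q10) //.
    by rewrite exprn_ile1 // ltW.
  rewrite {1}mE; apply: growthD => //.
  - by rewrite !exprn_ge0 // ltW.
  - apply: Hc'; rewrite /rho leq_addr ltn_add2l ltn_mod T0 //.
  - by apply: growth_iter => //; rewrite exprn_ge0 // ltW.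
have [M dM] := indic_dom cK.
have pf := posfun_pair cK (ccf_indic cK).
have cq0 : 0 <= c' * q1' ^+ m by rewrite mulr_ge0 ?exprn_ge0 // ltW.
apply: (@le_trans _ _ (c' * q1' ^+ m * ret K 0)).
  have := Hn2 m n2m; rewrite (expr_div_n q1' q) ler_pdivlMr ?exprn_gt0 //.
  rewrite ler_pdivrMl ?mulr_gt0 // => h; apply: (le_trans h).
  by rewrite mulrAC.
rewrite /ret /= -(pf_Z pf cq0 dM).
exact: (pf_le pf (domZ cq0 dM) (dom_iterU m dM) Gm).
Qed.

Lemma mf_exhaustion (L : (E -> \bar R) -> \bar R) (K : nat -> set E) :
  monotone_functional L -> (0 < L (fun=> 1%:E))%E ->
  (forall n, compact (K n)) -> {homo K : m n / (m <= n)%N >-> m `<=` n} ->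
  \bigcup_n K n = setT ->
  exists n0, forall n, (n0 <= n)%N -> (0 < L (EFin \o \1_(K n)))%E.
Proof.
move=> mL L0 cK hK KT.
have nd x : nondecreasing_seq (fun n => (EFin \o \1_(K n)) x : \bar R).
  move=> n m nm; rewrite lee_fin !indicE ler_nat.
  case: (boolP (x \in K n)) => //; rewrite inE => /(hK _ _ nm) h.
  by rewrite mem_set.
have [n Ln] : exists n, (0 < L (EFin \o \1_(K n)))%E.
  apply: contrapT => /forallNP h.
  have := mf_cvg mL (fun n => nK (cK n)) nd.
  rewrite (_ : (fun x => limn _) = (fun=> 1%:E)); last first.
    apply/funext => x.
    have [n _ Kx] : (\bigcup_n K n) x by rewrite KT.
    apply/cvg_lim => //; apply: cvg_near_cst; exists n => // m /= nm.
    by rewrite indicE mem_set //; exact: hK Kx.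
  move=> cv; move: L0; rewrite ltNge => /negP; apply.
  apply: (cvge_le _ cv); apply: nearW => n.
  by rewrite leNgt; apply/negP.
exists n => m nm; apply: (lt_le_trans Ln); apply: (mf_le mL); try exact: nK.
by move=> x; exact: nd.
Qed.

Lemma pos_fin_lower (y : \bar R) : (0 < y)%E -> exists2 b : R, 0 < b & (b%:E <= y)%E.
Proof.
case: y => [y|_|//]; first by rewrite lte_fin => y0; exists y.
by exists 1 => //; rewrite leey.
Qed.

Lemma fine_le (y : \bar R) : (0 <= y)%E -> ((fine y)%:E <= y)%E.
Proof. by case: y => [y|_|] //=; rewrite leey. Qed.

Lemma minorization_fun m beta (s : E -> R) (mu : {measure set E -> \bar R}) :
  measurable_fun setT s -> (forall x, 0 <= s x) ->
  minorization v m beta s mu -> forall (f : E -> \bar R) x, nnm f ->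
  ((beta * s x)%:E * \int[mu]_y f y <= iter m (rw_op v) f x)%E.
Proof.
move=> ms s0 [m1 b0 H] f x nf.
have bs0 : 0 <= beta * s x by rewrite mulr_ge0 // ltW.
apply: (mf_le_indic (mf_scale bs0 (mf_integral mu)) (mf_iter_rw_op E_lc v m x)) => //.
move=> A mA; apply: le_trans (H x A mA).
by rewrite /= integral_indic // setIT.
Qed.

Lemma int_rw_op_ge0 (mu : {measure set E -> \bar R}) n (f : E -> R) : nnm (EFin \o f) ->
  0 <= int_rw_op v mu n f.
Proof.
move=> nf; apply: fine_ge0; apply: integral_ge0 => x _.
exact: (nnm_iter_rw_op E_lc v n nf).2.
Qed.

(** The small function gives [P^m 1_K >= beta mu1(K) s], the small measure
    [P^m' f >= beta' mu(f) s']. With [f = P^n P^m 1_K] these bracket [mu (P^n s)], and the integral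
    over [K] remains to be taken. [K] is chosen so large that [pi], [mu1] and [s' pi] all charge
    it. *)
Lemma small_ret s mu : small_function v pi s -> small_measure v pi mu ->
  exists K m0 c, [/\ compact K, (0 < pi K)%E, 0 < c &
    forall n, c * (r ^+ n * int_rw_op v mu n s) <= ret K (n + m0)].
Proof.
move=> [[ms s0 _] [m [beta [mu1 [pmu1 min1]]]]].
move=> [pmu [m' [beta' [s' [[ms' s'0 is'0] min2]]]]].
have [m1 b0 _] := min1; have [m'1 b'0 _] := min2.
have ns : nnm (EFin \o s).
  by split; [exact/measurable_EFinP|move=> x; rewrite lee_fin].
have ns' : nnm (EFin \o s').
  by split; [exact/measurable_EFinP|move=> x; rewrite lee_fin].
have [KK [cKK hKK KKT _]] := compact_exhaustion E_lc.
have mfs' : monotone_functional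
      (fun f : E -> \bar R => \int[pi]_x ((s' x)%:E * f x))%E.
  apply: (@mf_comp _ _ _ _ _ _ (fun (f : E -> \bar R) x => (s' x)%:E * f x)%E (mf_integral pi)).
    by move=> f nf; exact: nnmM.
  by move=> x; apply: mf_scale => //; exact: mf_eval.
have int1 (mu' : {measure set E -> \bar R}) :
    (0 < mu' setT)%E -> (0 < \int[mu']_x 1%:E)%E.
  by move=> p; rewrite integral_cst // mul1e.
have [n1 H1] := mf_exhaustion (mf_integral pi) (int1 _ (ws_pos W)) cKK hKK KKT.
have [n2 H2] := mf_exhaustion (mf_integral mu1) (int1 _ pmu1) cKK hKK KKT.
have is'1 : (0 < \int[pi]_x ((s' x)%:E * 1%:E))%E.
  by under eq_integral do rewrite mule1.
have [n3 H3] := mf_exhaustion mfs' is'1 cKK hKK KKT.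
pose K := KK (maxn n1 (maxn n2 n3)); have cK : compact K by exact: cKK.
have mK := borel_compact hE cK.
have n1K : (n1 <= maxn n1 (maxn n2 n3))%N by exact: leq_maxl.
have n2K : (n2 <= maxn n1 (maxn n2 n3))%N by rewrite maxnCA leq_maxl.
have n3K : (n3 <= maxn n1 (maxn n2 n3))%N by rewrite maxnA leq_maxr.
have := H1 _ n1K; rewrite -/K /= integral_indic // setIT => piK.
have := H2 _ n2K; rewrite -/K /= integral_indic // setIT => mu1K.
have {}H3 := H3 _ n3K; rewrite -/K in H3.
have [b b1 bmu] := pos_fin_lower mu1K.
have [e e1 es'] := pos_fin_lower H3.
have rm0 : 0 < r ^+ (m' + m) by rewrite exprn_gt0.
exists K, (m' + m)%N, (r ^+ (m' + m) * (beta' * (beta * b) * e)); split => //.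
  by rewrite !mulr_gt0.
move=> n; set u := int_rw_op v mu n s.
have u0 : 0 <= u by exact: int_rw_op_ge0.
have bb0 : 0 <= beta * b by rewrite mulr_ge0 // ltW.
pose P k (f : E -> \bar R) := iter k (rw_op v) f.
have nP k (f : E -> \bar R) : nnm f -> nnm (P k f) by exact: nnm_iter_rw_op.
have nPs : nnm (P n (EFin \o s)) by exact: nP.
have step1 x : ((beta * b)%:E * (s x)%:E <= P m (EFin \o \1_K) x)%E.
  have [_ _ H] := min1; apply: le_trans (H x K mK).
  rewrite -EFinM mulrAC EFinM; apply: lee_wpmul2l => //.
  by rewrite lee_fin mulr_ge0 // ltW.
have step2 x : ((beta * b)%:E * P n (EFin \o s) x <=
    P n (P m (EFin \o \1_K)) x)%E.
  have mP := mf_iter_rw_op E_lc v n x.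
  rewrite -(mf_Z mP bb0 ns); apply: (mf_le mP) => //.
    exact: nnmZ.
  by apply: nP; exact: nK.
have step3 : ((beta * b * u)%:E <= \int[mu]_x P n (P m (EFin \o \1_K)) x)%E.
  apply: (@le_trans _ _ (\int[mu]_x ((beta * b)%:E * P n (EFin \o s) x))%E).
    rewrite (mf_Z (mf_integral mu) bb0 nPs) EFinM; apply: lee_wpmul2l.
      by rewrite lee_fin.
    by apply: fine_le; exact: (mf_ge0 (mf_integral mu) nPs).
  apply: (mf_le (mf_integral mu)); [exact: nnmZ|by apply/nP/nP; exact: nK|].
  exact: step2.
have step4 x : ((beta' * s' x * (beta * b * u))%:E <=
    P (m' + (n + m))%N (EFin \o \1_K) x)%E.
  rewrite /P iterD [iter (n + m) _ _]iterD -!/(P _ _) EFinM.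
  apply: le_trans (minorization_fun ms' s'0 min2 x _).
    by apply: lee_wpmul2l => //; rewrite lee_fin mulr_ge0 // ltW.
  by apply/nP/nP; exact: nK.
have NE : (n + (m' + m) = m' + (n + m))%N by ring.
have [M dM] := indic_dom cK.
pose N := (m' + (n + m))%N.
have c0 : 0 <= r ^+ N * (beta' * (beta * b * u)).
  by rewrite !mulr_ge0 ?exprn_ge0 // ltW.
rewrite NE -/N -lee_fin.
rewrite (pair_EFin cK (ccf_indic cK) (dom_iterU N dM)).
apply: (@le_trans _ _ ((r ^+ N * (beta' * (beta * b * u)))%:E * e%:E)%E).
  rewrite -EFinM lee_fin /N -NE (exprD r n) le_eqVlt.
  by apply/orP; left; apply/eqP; ring.
apply: (@le_trans _ _ (\int[pi]_x ((r ^+ N * (beta' * (beta * b * u)))%:E *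
    ((s' x)%:E * (\1_K x)%:E)))%E).
  rewrite (mf_Z (mf_integral pi) c0 (nnmM ns' (nK cK))).
  by apply: lee_wpmul2l.
apply: (mf_le (mf_integral pi)).
- by apply: nnmZ => //; exact: (nnmM ns' (nK cK)).
- exact: (nnmM (nK cK) (dom_nnm (dom_iterU N dM))).
move=> x; rewrite -!EFinM indicE; case: (boolP (x \in K)) => _; last first.
  by rewrite !mulr0 mul0r.
rewrite mulr1 mul1r (iterU_EFin N x dM) -(mulrA (r ^+ N)) EFinM.
apply: lee_wpmul2l; first by rewrite lee_fin exprn_ge0 // ltW.
by rewrite mulrAC; exact: step4.
Qed.

(** If [r ^+ n * u n] stayed below [q ^+ n] from some time on, the power series would converge
    beyond its radius [r]. *)
Lemma convergence_ret : convergence_parameter v pi r%:E ->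
  exists K c, [/\ compact K, (0 < pi K)%E, 0 < c &
    forall q, 0 < q < 1 -> forall n0, exists2 n, (n0 <= n)%N & c * q ^+ n <= ret K n].
Proof.
move=> [s [mu [sms smmu rad]]].
have [K [m0 [c [cK pK c0 H]]]] := small_ret sms smmu.
exists K, c; split => // q /andP[q0 q1] n0.
have ns : nnm (EFin \o s).
  have [[ms s0 _] _] := sms.
  by split; [exact/measurable_EFinP|move=> x; rewrite lee_fin].
pose u n := int_rw_op v mu n s.
have u0 n : 0 <= u n by exact: int_rw_op_ge0.
suff [n n0n Hn] : exists2 n, (n0 <= n)%N & q ^+ n <= r ^+ n * u n.
  exists (n + m0)%N; first by apply: (leq_trans n0n); exact: leq_addr.
  apply: le_trans (H n); rewrite ler_pM2l //; apply: le_trans Hn.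
  by rewrite exprD ler_piMr ?exprn_ge0 ?(ltW q0) // exprn_ile1 // ltW.
apply: contrapT => h.
have hn n : (n0 <= n)%N -> r ^+ n * u n < q ^+ n.
  by move=> n0n; rewrite ltNge; apply/negP => ?; apply: h; exists n.
pose q' := (q + 1) / 2.
have qq' : q < q' by rewrite /q'; lra.
have q'1 : q' < 1 by rewrite /q'; lra.
have q'0 : 0 < q' by apply: lt_trans qq'.
(* A point beyond [r] at which the terms are still dominated by powers of [q / q'], as
   [q < q' < 1]. *)
pose x := r / q'; have x0 : 0 < x by rewrite divr_gt0.
have rx : r < x by rewrite /x ltr_pdivlMr // gtr_pMr.
have cvx : cvgn (pseries u x).
  pose z := q / q'.
  have z0 : 0 < z by rewrite divr_gt0.
  have z1 : z < 1 by rewrite ltr_pdivrMr // mul1r.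
  (* The sum bounds the terms before [n0], the 1 those from [n0] on. *)
  pose C := 1 + \sum_(i < n0) (u i * x ^+ i) / z ^+ i.
  have tge n : 0 <= u n * x ^+ n by rewrite mulr_ge0 // exprn_ge0 // ltW.
  have C1 : 1 <= C.
    by rewrite lerDl sumr_ge0 // => i _; rewrite divr_ge0 // exprn_ge0 // ltW.
  have bd n : u n * x ^+ n <= C * z ^+ n.
    rewrite -ler_pdivrMr ?exprn_gt0 //.
    have [nn0|n0n] := ltnP n n0.
      rewrite /C ler_wpDl // (bigD1 (Ordinal nn0)) //= lerDl.
      by rewrite sumr_ge0 // => i _; rewrite divr_ge0 // exprn_ge0 // ltW.
    apply: le_trans C1; rewrite ler_pdivrMr ?exprn_gt0 // mul1r.
    rewrite /x /z (expr_div_n r q') (expr_div_n q q') mulrA ler_pM2r ?invr_gt0 ?exprn_gt0 //.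
    by rewrite mulrC ltW // hn.
  rewrite /pseries; apply: (series_le_cvg tge _ bd).
    by move=> n; rewrite mulr_ge0 ?exprn_ge0 // ?(ltW z0) // (le_trans ler01).
  by apply: (@is_cvg_geometric_series R C z); rewrite ger0_norm // ltW.
have : (x%:E <= r%:E)%E.
  rewrite -rad; apply: ereal_sup_ubound.
  by exists x => //=; rewrite ger0_norm // ltW.
by rewrite lee_fin leNgt rx.
Qed.

Lemma ret_subexponential : convergence_parameter v pi r%:E ->
  exists K, [/\ compact K, (0 < pi K)%E & forall q, 0 < q < 1 ->
    exists n0, forall n, (n0 <= n)%N -> q ^+ n <= ret K n].
Proof.
move=> /convergence_ret[K [c [cK pK c0 H]]]; exists K; split => //.
exact: (ret_lower cK pK c0 H).
Qed.

Lemma posfun_superinvariant del : 0 < del <= 1 -> exists t, forall s,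
  s = t \/ s = t.+1 -> forall m M f, posfun m -> dom M f ->
  almost_nondecreasing (fun n => m (iter n U f)) del s.
Proof.
move=> del01; have [t Ht] := almost_superinvariant del01.
exists t => s st m M f pm df; have [c [q [c0 q01 H]]] := Ht s st.
have [q0 _] := andP q01; have [_ d1] := andP del01.
have dphi := dom_phi; have M0 := dom_ge0 df.
exists (c * (M * m phi)), q; split => //.
  by rewrite mulr_ge0 // mulr_ge0 // (pf_ge0 pm dphi).
move=> n; have dn := dom_iterU n df; have dns := dom_iterU (n + s) df.
have d10 : 0 <= 1 - del by rewrite subr_ge0.
have cq0 : 0 <= c * q ^+ n * M by rewrite !mulr_ge0 // exprn_ge0 // ltW.
rewrite -(pf_Z pm d10 dn).
have -> : c * (M * m phi) * q ^+ n = c * q ^+ n * M * m phi by ring.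
rewrite -(pf_Z pm cq0 dphi) -(pf_D pm dns (domZ cq0 dphi)).
apply: (pf_le pm (domZ d10 dn) (domD dns (domZ cq0 dphi))) => x /=.
by have := H M f x n df; rewrite !mulrA.
Qed.

Lemma almost_nondecreasingD (x y : nat -> R) del s :
  almost_nondecreasing x del s -> almost_nondecreasing y del s ->
  almost_nondecreasing (fun n => x n + y n) del s.
Proof.
move=> [c1 [q1 [c10 /andP[q10 q11] H1]]] [c2 [q2 [c20 /andP[q20 q21] H2]]].
pose q := Num.max q1 q2.
exists (c1 + c2), q; split; first exact: addr_ge0.
  by rewrite lt_max q10 /= gt_max q11.
move=> n; have := H1 n; have := H2 n.
have e1 : c1 * q1 ^+ n <= c1 * q ^+ n.
  rewrite ler_wpM2l // lerXn2r ?nnegrE ?(ltW q10) //.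
    by rewrite le_max (ltW q10).
  by rewrite le_max lexx.
have e2 : c2 * q2 ^+ n <= c2 * q ^+ n.
  rewrite ler_wpM2l // lerXn2r ?nnegrE ?(ltW q20) //.
    by rewrite le_max (ltW q10).
  by rewrite le_max lexx orbT.
rewrite mulrDr mulrDl; lra.
Qed.

Lemma ccf_U K c f : compact K -> ccf K c f ->
  exists K' c', compact K' /\ ccf K' c' (U f).
Proof.
move=> cK cf; have [M df] := ccf_dom cK cf.
have cS : compact (msupport v) by exact: ws_compact W.
have cK' := compact_mulset cK (compact_invset cS).
have [a [b [a0 b0 ab]]] := phi_bounds cK'.
have [mU U0] := po_dom posop_U df; rewrite mul1r in U0.
have M0 := dom_ge0 df.
have Uz x : ~ mulset K (invset (msupport v)) x -> U f x = 0.
  move=> nKx; apply: EFin_inj; rewrite (U_EFin x df).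
  have nf := nnm_mull x (dom_nnm df).
  suff -> : rw_op v (EFin \o f) x = 0%E by rewrite mule0.
  apply/eqP; rewrite eq_le; apply/andP; split; last first.
    exact: (mf_ge0 (mf_rw_op v x) (dom_nnm df)).
  rewrite -(integral0 v setT).
  apply: (le_integral_support E_lc (ws_compact W) nf).
    by split => // y; rewrite lexx.
  move=> y Sy; rewrite lee_fin; have [_ _ ->] := cf => // Kxy.
  apply: nKx; exists (x * y)%g, y^-1%g; split => //.
    by rewrite /invset /= monoid.invgK.
  by rewrite monoid.mulgK.
exists (mulset K (invset (msupport v))), (M * b); split => //; split => // x.
have /andP[-> h] /= := U0 x.
have [Kx|nKx] := pselect (mulset K (invset (msupport v)) x).
  by apply: (le_trans h); rewrite ler_wpM2l //; have /andP[] := ab x Kx.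
by rewrite Uz // mulr_ge0 // ltW.
Qed.

(** * Slow variation of the pairings *)

Section asymptotic_invariance.
Variable K0 : set E.
Hypothesis cK0 : compact K0.
Hypothesis pK0 : (0 < pi K0)%E.
Let a n := ret K0 n.
Let ci0 : ccf K0 1 (\1_K0 : E -> R). Proof. exact: (ccf_indic cK0). Qed.
Let a00 : 0 < a 0. Proof. by rewrite -lte_fin ret0. Qed.

Lemma ret_bounded : exists C, forall n, a n <= C.
Proof.
have [M dM] := indic_dom cK0.
exists (M * pairing \1_K0 phi) => n.
rewrite -(pf_Z (posfun_pair cK0 ci0) (dom_ge0 dM) dom_phi).
have dMp := domZ (dom_ge0 dM) dom_phi.
apply: (pf_le (posfun_pair cK0 ci0) (dom_iterU n dM) dMp) => x.
by have [_ /(_ x)/andP[]] := dom_iterU n dM.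
Qed.

(** Harnack's bound from [K0] to [K], averaged over [K0]: after [l] steps, a start on [K0] dominates
    any bounded density on [K]. *)
Lemma dominate_left K c h : compact K -> ccf K c h -> exists l b, 0 <= b /\
  forall M f, dom M f -> pairing h f <= b * pairing \1_K0 (iter l U f).
Proof.
move=> cK ch; have [l [gam [_ g0 H]]] := harnack cK0 cK.
have c0 := ccf_ge0 ch; have [M0 dM0] := indic_dom cK0.
exists l, (c / (gam * a 0)); split; first by rewrite divr_ge0 // mulr_ge0 // ltW.
move=> M f df; have ci := ccf_indic cK.
have p0 := pf_ge0 (posfun_pair cK ci) df.
apply: (le_trans (pair_le_indic cK ch df)).
rewrite -mulrA ler_wpM2l // ler_pdivlMl ?mulr_gt0 //.
have gp0 : 0 <= gam * pairing \1_K f by rewrite mulr_ge0 // ltW.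
rewrite mulrAC -(pf_Z (posfun_pair cK0 ci0) gp0 dM0).
apply: (pf_le (posfun_pair cK0 ci0) (domZ gp0 dM0) (dom_iterU l df)) => x.
rewrite indicE; have [Kx|nKx] := pselect (K0 x).
  by rewrite mem_set // mulr1; have [] := H _ _ x df Kx.
by rewrite memNset // mulr0; exact: dom_f_ge0 x (dom_iterU l df).
Qed.

Lemma dominate_right K c f : compact K -> ccf K c f -> exists l b, 0 <= b /\
  forall x, f x <= b * iter l U \1_K0 x.
Proof.
move=> cK cf; have [l [gam [_ g0 H]]] := harnack cK cK0.
have c0 := ccf_ge0 cf; have [M0 dM0] := indic_dom cK0.
have b0 : 0 <= c / (gam * a 0) by rewrite divr_ge0 // mulr_ge0 // ltW.
exists l, (c / (gam * a 0)); split => // x.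
have [Kx|nKx] := pselect (K x).
  have [_ /(_ x)/andP[_ h] _] := cf; apply: (le_trans h).
  rewrite -mulrA ler_peMr // ler_pdivlMl ?mulr_gt0 // mulr1.
  by have [] := H _ _ x dM0 Kx.
have [_ _ ->] // := cf; rewrite mulr_ge0 //.
exact: dom_f_ge0 x (dom_iterU l dM0).
Qed.

(* The complement of [h, f] inside [K0, K0] is again a sum of two pairings. *)
Lemma pair_complement K c h K' c' f : compact K -> ccf K c h ->
  compact K' -> ccf K' c' f -> exists D L (y : nat -> R),
  [/\ 0 <= D, (forall n, 0 <= y n),
    (forall n, pairing h (iter n U f) + y n = D * a (n + L)%N) &
    forall del s, (forall m M f, posfun m -> dom M f ->
       almost_nondecreasing (fun n => m (iter n U f)) del s) ->
      almost_nondecreasing y del s].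
Proof.
move=> cK ch cK' cf; have [M df] := ccf_dom cK' cf.
have [M0 dM0] := indic_dom cK0.
have [l2 [b2 [b20 H2]]] := dominate_left cK ch.
have [l1 [b1 [b10 H1]]] := dominate_right cK' cf.
pose m1 f := b2 * pairing \1_K0 (iter l2 U f).
have pm1 : posfun m1.
  apply: pf_scale => //.
  exact: (pf_comp (posfun_pair cK0 ci0) (posop_iterU l2)).
pose m2 f := m1 f - pairing h f.
have pm2 : posfun m2.
  by apply: pf_B => //; exact: (posfun_pair cK ch).
have dl1 := domZ b10 (dom_iterU l1 dM0).
pose g := (fun x => b1 * iter l1 U \1_K0 x) \- f.
have dg := domB dl1 df H1; rewrite -/g in dg.
(* With [g + f] a multiple of an iterate of the indicator of [K0] and [m2 = m1 - h], the complement
   is [m1 (U^n (g + f)) - <h, U^n f>]. Written as this sum, it consists of positive functionals on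
   nonnegative functions, to which superinvariance applies. *)
pose y n := m1 (iter n U g) + m2 (iter n U f).
exists (b2 * b1), (l1 + l2)%N, y; split.
- exact: mulr_ge0.
- move=> n; rewrite /y addr_ge0 //.
    exact: (pf_ge0 pm1 (dom_iterU n dg)).
  exact: (pf_ge0 pm2 (dom_iterU n df)).
- move=> n; have dgn := dom_iterU n dg; have dfn := dom_iterU n df.
  have -> : pairing h (iter n U f) + y n = m1 (iter n U g) + m1 (iter n U f).
    by rewrite /y /m2; ring.
  rewrite -(pf_D pm1 dgn dfn) -(po_D (posop_iterU n) dg df).
  have -> : g \+ f = (fun x => b1 * iter l1 U \1_K0 x).
    by apply/funext => x; rewrite /g /= subrK.
  rewrite (po_Z (posop_iterU n) b10 (dom_iterU l1 dM0)).
  rewrite (pf_Z pm1 b10 (dom_iterU n (dom_iterU l1 dM0))).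
  rewrite /m1 -!iterD mulrCA mulrA /a /ret.
  by rewrite (_ : (l2 + n + l1 = n + (l1 + l2))%N) //; lia.
- move=> del s Hs; apply: almost_nondecreasingD; first exact: Hs pm1 dg.
  exact: Hs pm2 df.
Qed.

Hypothesis a_sub : forall q, 0 < q < 1 ->
  exists n0, forall n, (n0 <= n)%N -> q ^+ n <= a n.
Variable F : set_system nat.
Context {FF : Filter F}.
Hypothesis Foo : \oo `<=` F.
Hypothesis Fj : forall j e, 0 < e ->
  \forall n \near F, `|a (n + j)%N - a n| <= e * a n.

Lemma pair_bounded K c h K' c' f : compact K -> ccf K c h ->
  compact K' -> ccf K' c' f -> exists2 D, 0 <= D &
  \forall n \near F, 0 <= pairing h (iter n U f) <= D * a n.
Proof.
move=> cK ch cK' cf; have [M df] := ccf_dom cK' cf.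
have [D [L [y [D0 y0 xy _]]]] := pair_complement cK ch cK' cf.
exists (D * 2); first by rewrite mulr_ge0.
have := Fj L (@ltr01 R); apply: filterS => n; rewrite mul1r => /ler_normlP[_ hn].
rewrite (pf_ge0 (posfun_pair cK ch) (dom_iterU n df)) /=.
apply: (@le_trans _ _ (D * a (n + L)%N)); first by rewrite -xy lerDl.
by rewrite -mulrA ler_wpM2l //; lra.
Qed.

Lemma pair_slow K c h K' c' f : compact K -> ccf K c h ->
  compact K' -> ccf K' c' f -> forall e, 0 < e -> \forall n \near F,
  `|pairing h (iter n.+1 U f) - pairing h (iter n U f)| <= e * a n.
Proof.
move=> cK ch cK' cf; have [M df] := ccf_dom cK' cf.
have [K1 [c1 [cK1 cU]]] := ccf_U cK' cf; have dU := po_dom posop_U df.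
have [D [L [y [D0 y0 xy Hy]]]] := pair_complement cK ch cK' cf.
have [D' [L' [y' [D'0 y'0 xy' Hy']]]] := pair_complement cK ch cK1 cU.
have {}xy' n : pairing h (iter n.+1 U f) + y' n = D' * a (n + L')%N.
  by rewrite iterSr.
have ph := posfun_pair cK ch.
have x0 n : 0 <= pairing h (iter n U f) by exact: (pf_ge0 ph (dom_iterU n df)).
apply: (slow_increment (x := fun n => pairing h (iter n U f)) a_sub Foo Fj
  D0 D'0 x0 y0 y'0 xy xy').
move=> del del01; have [t Ht] := posfun_superinvariant del01.
exists t => s st; split.
- exact: Ht ph df.
- by apply: Hy; exact: Ht.
- rewrite (_ : _ \o S = (fun n => pairing h (iter n U (U f)))).
    exact: Ht ph dU.
  by apply/funext => n /=; rewrite -iterSr.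
- by apply: Hy'; exact: Ht.
Qed.

End asymptotic_invariance.

(** * Absolute continuity of the limits *)

Definition mass (f : E -> R) : R := fine (\int[pi]_x (f x)%:E)%E.

Lemma mass_EFin K c f : compact K -> ccf K c f ->
  (\int[pi]_x (f x)%:E)%E = (mass f)%:E.
Proof.
move=> cK cf; have nf := ccf_nnm cf; have mK := borel_compact hE cK.
have c0 := ccf_ge0 cf.
have fin : (\int[pi]_x (f x)%:E < +oo)%E.
  apply: (@le_lt_trans _ _ (\int[pi]_x (c%:E * (\1_K x)%:E))%E).
    apply: (mf_le (mf_integral pi)) => //; first exact: (nnmZ c0 (nK cK)).
    by move=> x; rewrite -EFinM lee_fin; exact: ccf_le_indic cf.
  rewrite (mf_Z (mf_integral pi) c0 (nK cK)) integral_indic // setIT.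
  by rewrite lte_mul_pinfty ?lee_fin // (ws_fin W cK).
rewrite /mass fineK // ge0_fin_numE //.
exact: (mf_ge0 (mf_integral pi) nf).
Qed.

Lemma mass_ge0 f : (forall x, 0 <= f x) -> 0 <= mass f.
Proof.
by move=> f0; apply: fine_ge0; apply: integral_ge0 => x _; rewrite lee_fin.
Qed.

(* Smoothing on the left commutes with the walk, which moves by
   multiplication on the right. *)
Definition lsmooth h (f : E -> \bar R) z : \bar R :=
  (\int[pi]_x ((h x)%:E * f (x * z)%g))%E.

Lemma nnm_lsmooth h (f : E -> \bar R) : nnm (EFin \o h) -> nnm f ->
  nnm (lsmooth h f).
Proof.
move=> nh nf.
apply: (@nnm_partial_integral _ _ _ _ _ pi spi
  (fun zx : E * E => ((h zx.2)%:E * f (zx.2 * zx.1)%g)%E)).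
split; last by move=> z; apply: mule_ge0; [exact: (nh.2 z.2)|exact: nf.2].
apply: emeasurable_funM.
  by apply: measurableT_comp nh.1 _; exact: measurable_snd.
have mm : measurable_fun setT (fun xy : E * E => (xy.1 * xy.2)%g).
  by apply: mulg_borel; case: E_lc.
apply: (measurableT_comp nf.1 (g := fun zx : E * E => (zx.2 * zx.1)%g)).
apply: (measurableT_comp mm (g := fun zx : E * E => (zx.2, zx.1))).
by apply: measurable_fun_pair; [exact: measurable_snd|exact: measurable_fst].
Qed.

Lemma rw_op_lsmooth h (f : E -> \bar R) z : nnm (EFin \o h) -> nnm f ->
  rw_op v (lsmooth h f) z = lsmooth h (rw_op v f) z.
Proof.
move=> nh nf.
pose G (yx : E * E) := ((h yx.2)%:E * f (yx.2 * (z * yx.1))%g)%E.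
have nG : nnm G.
  split; last by move=> yx; apply: mule_ge0; [exact: (nh.2 yx.2)|exact: nf.2].
  apply: emeasurable_funM.
    by apply: measurableT_comp nh.1 _; exact: measurable_snd.
  have mm : measurable_fun setT (fun xy : E * E => (xy.1 * xy.2)%g).
    by apply: mulg_borel; case: E_lc.
  apply: (measurableT_comp nf.1 (g := fun yx : E * E => (yx.2 * (z * yx.1))%g)).
  apply: (measurableT_comp mm (g := fun yx : E * E => (yx.2, (z * yx.1)%g))).
  apply: measurable_fun_pair; first exact: measurable_snd.
  apply: (measurableT_comp (f := fun y : E => (z * y)%g)); last exact: measurable_fst.
  by apply: continuous_borel; exact: mull_continuous.
transitivity (\int[v]_y \int[pi]_x G (y, x))%E.
  by apply: eq_integral => y _; apply: eq_integral => x _.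
have sv : sigma_finite setT v by exact: sigma_finiteT.
rewrite (tonelli sv spi nG); apply: eq_integral => x _.
rewrite /G /= /rw_op -ge0_integralZl_EFin //.
- by apply: eq_integral => y _; rewrite monoid.mulgA.
- by move=> y _; exact: nf.2.
- exact: (nnm_mull _ nf).1.
- by have := nh.2 x; rewrite lee_fin.
Qed.

Lemma iter_rw_op_lsmooth n h (f : E -> \bar R) z : nnm (EFin \o h) -> nnm f ->
  iter n (rw_op v) (lsmooth h f) z = lsmooth h (iter n (rw_op v) f) z.
Proof.
move=> nh nf; elim: n z => //= n IH z.
rewrite -(rw_op_lsmooth z nh (nnm_iter_rw_op E_lc v n nf)).
by congr (rw_op v _ z); apply/funext => y; exact: IH.
Qed.

Lemma pair_iterU_EFin K c h M f n : compact K -> ccf K c h -> dom M f ->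
  (pairing h (iter n U f))%:E =
  ((r ^+ n)%:E * iter n (rw_op v) (lsmooth h (EFin \o f)) 1%g)%E.
Proof.
move=> cK ch df; have nh := ccf_nnm ch; have nf := dom_nnm df.
have rn0 : 0 <= r ^+ n by rewrite exprn_ge0 // ltW.
rewrite iter_rw_op_lsmooth // (pair_EFin cK ch (dom_iterU n df)).
rewrite /lsmooth.
have nP := nnm_iter_rw_op E_lc v n nf.
rewrite -(mf_Z (mf_integral pi) rn0 (nnmM nh (nnm_mulr 1%g nP))).
apply: eq_integral => x _; rewrite EFinM (iterU_EFin n x df) monoid.mulg1.
by rewrite muleCA.
Qed.

(** In the integral of [h x * f (x * z)] either factor can be bounded by its supremum; right
    invariance of [pi] removes [z] from the mass of the other. *)
Lemma lsmooth_le K c h K' c' (f : E -> R) z : compact K -> ccf K c h ->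
  compact K' -> ccf K' c' f ->
  (lsmooth h (EFin \o f) z <=
    (c * mass f * \1_(mulset (invset K) K') z)%:E)%E /\
  (lsmooth h (EFin \o f) z <=
    (c' * mass h * \1_(mulset (invset K) K') z)%:E)%E.
Proof.
move=> cK ch cK' cf; have nh := ccf_nnm ch; have nf := ccf_nnm cf.
have c0 := ccf_ge0 ch; have c'0 := ccf_ge0 cf.
have [Kz|nKz] := pselect (mulset (invset K) K' z); last first.
  suff -> : lsmooth h (EFin \o f) z = 0%E.
    have [hh ff] : (forall x, 0 <= h x) /\ (forall x, 0 <= f x).
      by split => x; [exact: ccf_f_ge0 ch|exact: ccf_f_ge0 cf].
    by split; rewrite lee_fin mulr_ge0 // mulr_ge0 // mass_ge0.
  rewrite -[RHS](integral0 pi setT); apply: eq_integral => x _.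
  have [Kx|nKx] := pselect (K x); last first.
    by have [_ _ ->] := ch; rewrite ?mul0e.
  have [_ _ fz] := cf; rewrite /= fz ?mule0 // => Kxz; apply: nKz.
  exists x^-1%g, (x * z)%g; split => //; last by rewrite monoid.mulKg.
  by rewrite /invset /= monoid.invgK.
have nfz := nnm_mulr z nf.
rewrite indicE mem_set // !mulr1 !EFinM; split.
  rewrite -(mass_EFin cK' cf) -[X in (_ <= _ * X)%E](haar_mulr z (ws_r W) nf).
  rewrite -(mf_Z (mf_integral pi) c0 nfz); apply: (mf_le (mf_integral pi)).
  - exact: nnmM.
  - exact: nnmZ.
  - move=> x; apply: lee_wpmul2r; first exact: nfz.2.
    by rewrite lee_fin; have [_ /(_ x)/andP[]] := ch.
rewrite -(mass_EFin cK ch) -(mf_Z (mf_integral pi) c'0 nh).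
apply: (mf_le (mf_integral pi)).
- exact: nnmM.
- exact: nnmZ.
- move=> x; rewrite muleC; apply: lee_wpmul2r; first exact: nh.2.
  by rewrite lee_fin; have [_ /(_ (x * z)%g)/andP[]] := cf.
Qed.

Section absolute_continuity.
Variable K0 : set E.
Hypothesis cK0 : compact K0.
Hypothesis pK0 : (0 < pi K0)%E.

(** The pairing is the value at the identity of an iterate of [lsmooth h f], hence at most [s] times
    that of the indicator of [K3]. Left translation by a point of [K0] bounds this by the iterate of
    the indicator of [K0 K3] there, and averaging over [K0] returns to a pairing. *)
Lemma pair_lsmooth_le K c h M f K3 s n : compact K -> ccf K c h -> dom M f ->
  compact K3 -> 0 <= s ->
  (forall z, lsmooth h (EFin \o f) z <= (s * \1_K3 z)%:E)%E ->
  pairing h (iter n U f) <=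
    s / ret K0 0 * pairing \1_K0 (iter n U \1_(mulset K0 K3)).
Proof.
move=> cK ch df cK3 s0 H; have cK4 := compact_mulset cK0 cK3.
have [M3 d3] := indic_dom cK3; have [M4 d4] := indic_dom cK4.
have [M0 d0] := indic_dom cK0; have ci0 := ccf_indic cK0.
have a0 : 0 < ret K0 0 by rewrite -lte_fin ret0.
have rn0 : 0 <= r ^+ n by rewrite exprn_ge0 // ltW.
have h1 : pairing h (iter n U f) <= s * iter n U \1_K3 1%g.
  rewrite -lee_fin (pair_iterU_EFin n cK ch df) EFinM (iterU_EFin n 1%g d3).
  rewrite muleCA; apply: lee_wpmul2l; first by rewrite lee_fin.
  rewrite -(mf_Z (mf_iter_rw_op E_lc v n 1%g) s0 (nK cK3)).
  apply: (mf_le (mf_iter_rw_op E_lc v n 1%g)).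
  - by apply: nnm_lsmooth; [exact: ccf_nnm ch|exact: dom_nnm df].
  - by apply: nnmZ => //; exact: nK.
  - exact: H.
set u := iter n U \1_K3 1%g in h1.
have u0 : 0 <= u by exact: dom_f_ge0 _ (dom_iterU n d3).
have h2 : u * ret K0 0 <= pairing \1_K0 (iter n U \1_(mulset K0 K3)).
  rewrite /ret -(pf_Z (posfun_pair cK0 ci0) u0 d0).
  apply: (pf_le (posfun_pair cK0 ci0) (domZ u0 d0) (dom_iterU n d4)) => x.
  rewrite indicE; have [Kx|nKx] := pselect (K0 x); last first.
    by rewrite memNset // mulr0; exact: dom_f_ge0 _ (dom_iterU n d4).
  rewrite mem_set // mulr1 -lee_fin (iterU_EFin n _ d3) (iterU_EFin n _ d4).
  apply: lee_wpmul2l; first by rewrite lee_fin.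
  rewrite -[x in leRHS]monoid.mulg1 -iter_rw_op_mull.
  apply: (mf_le (mf_iter_rw_op E_lc v n 1%g)).
  - exact: nK.
  - exact: (nnm_mull x (nK cK4)).
  - move=> y; rewrite lee_fin !indicE ler_nat.
    case: (boolP (y \in K3)) => //; rewrite inE => K3y.
    by rewrite mem_set //; exists x, y.
apply: (le_trans h1); rewrite -mulrA ler_wpM2l // ler_pdivlMl //.
by rewrite mulrC.
Qed.

Let a n := ret K0 n.
Hypothesis a_sub : forall q, 0 < q < 1 ->
  exists n0, forall n, (n0 <= n)%N -> q ^+ n <= a n.
Variable F : set_system nat.
Context {FF : Filter F}.
Hypothesis Foo : \oo `<=` F.
Hypothesis Fj : forall j e, 0 < e ->
  \forall n \near F, `|a (n + j)%N - a n| <= e * a n.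

(** The same [n] serve all [h] and [f] carried by [K] and [K'], so the bounds by Haar mass survive
    in the limit. *)
Lemma pair_ac K K' : compact K -> compact K' -> exists2 D, 0 <= D &
  \forall n \near F, forall c h c' f, ccf K c h -> ccf K' c' f ->
    pairing h (iter n U f) <= D * (c * mass f) * a n /\
    pairing h (iter n U f) <= D * (c' * mass h) * a n.
Proof.
move=> cK cK'; have cK3 := compact_mulset (compact_invset cK) cK'.
have cK4 := compact_mulset cK0 cK3.
have a0 : 0 < ret K0 0 by rewrite -lte_fin ret0.
have [D D0 HD] := pair_bounded cK0 pK0 Fj cK0 (ccf_indic cK0) cK4
  (ccf_indic cK4).
exists (D / ret K0 0); first by rewrite divr_ge0 // ltW.
apply: filterS HD => n /andP[_ Hn] c h c' f ch cf.
have [M df] := ccf_dom cK' cf.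
have step s : 0 <= s -> (forall z, lsmooth h (EFin \o f) z <=
    (s * \1_(mulset (invset K) K') z)%:E)%E ->
    pairing h (iter n U f) <= D / ret K0 0 * s * a n.
  move=> s0 H; apply: (le_trans (pair_lsmooth_le n cK ch df cK3 s0 H)).
  have -> : D / ret K0 0 * s * a n = s / ret K0 0 * (D * a n) by ring.
  by apply: ler_wpM2l => //; rewrite divr_ge0 // ltW.
have [hh ff] : (forall x, 0 <= h x) /\ (forall x, 0 <= f x).
  by split => x; [exact: ccf_f_ge0 ch|exact: ccf_f_ge0 cf].
split; apply: step.
- by rewrite mulr_ge0 ?(ccf_ge0 ch) // mass_ge0.
- by move=> z; exact: (lsmooth_le z cK ch cK' cf).1.
- by rewrite mulr_ge0 ?(ccf_ge0 cf) // mass_ge0.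
- by move=> z; exact: (lsmooth_le z cK ch cK' cf).2.
Qed.

End absolute_continuity.

(** * Measures defined by absolutely continuous functionals *)

(** The first three properties pass to limits along an ultrafilter but give finite additivity only;
    the bound [ac_le] by Haar mass supplies countable additivity. *)
Record ac_functional (l : (E -> R) -> R) : Prop := AcFunctional {
  ac_ge0 : forall K c f, compact K -> ccf K c f -> 0 <= l f ;
  ac_D : forall K c f c' g, compact K -> ccf K c f -> ccf K c' g ->
    l (f \+ g) = l f + l g ;
  ac_Z : forall K c f a, compact K -> ccf K c f -> 0 <= a ->
    l (fun x => a * f x) = a * l f ;
  ac_le : forall K, compact K -> exists2 C, 0 <= C &
    forall c f, ccf K c f -> l f <= C * mass f }.

Lemma ccf_sub K A : measurable A -> A `<=` K -> ccf K 1 (\1_A : E -> R).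
Proof.
move=> mA AK; split; first exact: measurable_indic.
- by move=> x; rewrite indicE; case: (_ \in _); rewrite ?lexx ?ler01.
- by move=> x nKx; rewrite indicE memNset // => /AK.
Qed.

Lemma ccfD K c f c' g : ccf K c f -> ccf K c' g -> ccf K (c + c') (f \+ g).
Proof.
move=> [mf f0 fK] [mg g0 gK]; split; first exact: measurable_funD.
- move=> x /=; have /andP[? ?] := f0 x; have /andP[? ?] := g0 x.
  by rewrite addr_ge0 //= lerD.
- by move=> x nKx /=; rewrite fK ?gK ?addr0.
Qed.

Lemma ccfB K c f c' g : ccf K c f -> ccf K c' g -> (forall x, g x <= f x) ->
  ccf K c (f \- g).
Proof.
move=> [mf f0 fK] [mg g0 gK] gf; split; first exact: measurable_funB.
- move=> x /=; have /andP[? ?] := f0 x; have /andP[? ?] := g0 x.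
  by rewrite subr_ge0 gf /= lerBlDr ler_wpDr.
- by move=> x nKx /=; rewrite fK ?gK ?subr0.
Qed.

Lemma mass_ac K c f c' g : compact K -> ccf K c f -> ccf K c' g ->
  mass (f \+ g) = mass f + mass g.
Proof.
move=> cK cf cg; apply: EFin_inj; rewrite EFinD.
rewrite -(mass_EFin cK cf) -(mass_EFin cK cg).
rewrite -(mass_EFin cK (ccfD cf cg)).
exact: (mf_D (mf_integral pi) (ccf_nnm cf) (ccf_nnm cg)).
Qed.

Section functional_measure.
Variable l : (E -> R) -> R.
Hypothesis Hl : ac_functional l.

(** The missing part [f - f_n] has Haar mass tending to 0 by monotone convergence, and [ac_le]
    carries this over to [l]. *)
Lemma ac_lim K c f (f_ : nat -> E -> R) : compact K -> ccf K c f ->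
  (forall n, ccf K c (f_ n)) -> (forall x, nondecreasing_seq (f_ ^~ x)) ->
  (forall x, f_ n x @[n --> \oo] --> f x) -> l (f_ n) @[n --> \oo] --> l f.
Proof.
move=> cK cf cf_ nd cv.
have le n x : f_ n x <= f x.
  rewrite -(cvg_lim (@Rhausdorff R) (cv x)).
  by apply: nondecreasing_cvgn_le; [exact: nd|exact: cvgP (cv x)].
have [C C0 HC] := ac_le Hl cK.
have cm : mass (f_ n) @[n --> \oo] --> mass f.
  apply: fine_cvg; rewrite -(mass_EFin cK cf).
  rewrite (_ : (fun x => _ : \bar R) = (fun n => \int[pi]_x (EFin \o f_ n) x)%E) //.
  rewrite (_ : (\int[pi]_x (f x)%:E)%E =
      (\int[pi]_x limn (fun n => (EFin \o f_ n) x))%E); last first.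
    apply: eq_integral => x _; apply/esym/cvg_lim => //.
    by apply: cvg_EFin; [exact: nearW|exact: cv].
  apply: (mf_cvg (mf_integral pi)).
    by move=> n; exact: ccf_nnm (cf_ n).
  by move=> x n m nm; rewrite lee_fin; exact: nd.
apply: (@squeeze_cvgr _ _ _ _ (fun n => l f - C * (mass f - mass (f_ n)))
  (fun=> l f)).
- apply: nearW => n; have cB := ccfB cf (cf_ n) (le n).
  have fE : f = (f \- f_ n) \+ f_ n by apply/funext => x /=; rewrite subrK.
  have lE : l f = l (f \- f_ n) + l (f_ n) by rewrite {1}fE (ac_D Hl cK cB (cf_ n)).
  have mE : mass f = mass (f \- f_ n) + mass (f_ n).
    by rewrite {1}fE (mass_ac cK cB (cf_ n)).
  apply/andP; split; last by rewrite lE lerDr (ac_ge0 Hl cK cB).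
  by rewrite lE mE addrK; have := HC _ _ cB; lra.
- rewrite -[X in _ --> X]subr0 -[X in _ --> _ - X](mulr0 C).
  apply: cvgB; first exact: cvg_cst.
  apply: cvgM; first exact: cvg_cst.
  by rewrite -[X in _ --> X](subrr (mass f)); apply: cvgB => //; exact: cvg_cst.
- exact: cvg_cst.
Qed.

Lemma ac_zero : l (fun=> 0) = 0.
Proof.
have := ac_Z Hl (@compact0 E) (ccf_sub (@measurable0 _ E) (@sub0set _ _))
  (lexx 0).
rewrite mul0r => e; rewrite -[RHS]e; congr l.
by apply/funext => x; rewrite mul0r.
Qed.

Lemma ac_sum K (G : nat -> set E) n : compact K ->
  (forall i, measurable (G i)) -> (forall i, G i `<=` K) -> trivIset setT G ->
  l \1_(\big[setU/set0]_(i < n) G i) = \sum_(i < n) l \1_(G i).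
Proof.
move=> cK mG GK tG; elim: n => [|n IH].
  rewrite !big_ord0 -[RHS]ac_zero; congr l.
  by apply/funext => x; rewrite indicE in_set0.
have mU m : measurable (\big[setU/set0]_(i < m) G i).
  by apply: bigsetU_measurable => i _.
have UK m : \big[setU/set0]_(i < m) G i `<=` K.
  by rewrite -bigcup_mkord => x [i _]; exact: GK.
rewrite [RHS]big_ord_recr /= -IH -(ac_D Hl cK (ccf_sub (mU n) (UK n))
  (ccf_sub (mG n) (GK n))); congr l; rewrite big_ord_recr /=.
apply/funext => x /=; rewrite !indicE in_setU.
case: (boolP (x \in G n)) => [|_]; last by rewrite orbF addr0.
rewrite inE => Gx; rewrite memNset ?add0r //.
rewrite -bigcup_mkord => -[i /= ni Gix].
have /trivIsetP/(_ i n Logic.I Logic.I) := tG.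
rewrite neq_ltn ni => /(_ isT) GG.
by have : (G i `&` G n) x by []; rewrite GG.
Qed.

(** The absolute value makes nonnegativity hold for every [A], including nonmeasurable ones; on
    measurable sets it changes nothing. The proofs are arguments so that the measure structure can
    be attached to the function itself. *)
Definition local_measure (cl : ac_functional l) K (cK : compact K) D
  (mD : measurable D) (DK : D `<=` K) A : \bar R := (`|l \1_(A `&` D)|)%:E.

Section local_measure.
Variables (K : set E) (cK : compact K) (D : set E) (mD : measurable D).
Variable DK : D `<=` K.
Local Notation lm := (local_measure Hl cK mD DK).

Let lm0 : lm set0 = 0%E.
Proof.
rewrite /local_measure set0I (_ : \1_set0 = (fun=> 0)) ?ac_zero ?normr0 //.
by apply/funext => x; rewrite indicE in_set0.
Qed.

Let lm_ge0 A : (0 <= lm A)%E. Proof. by rewrite lee_fin. Qed.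

Let lm_sigma : semi_sigma_additive lm.
Proof.
move=> G mG tG mU; pose H i := G i `&` D.
have mH i : measurable (H i) by exact: measurableI.
have HK i : H i `<=` K by move=> x [_ /DK].
have tH : trivIset setT H by exact: trivIset_setIr.
have mHU n : measurable (\big[setU/set0]_(i < n) H i).
  by apply: bigsetU_measurable => i _.
have HUK n : \big[setU/set0]_(i < n) H i `<=` K.
  by rewrite -bigcup_mkord => x [i _]; exact: HK.
have UK : \bigcup_n G n `&` D `<=` K by move=> x [_ /DK].
have mUD : measurable (\bigcup_n G n `&` D) by exact: measurableI.
have pos B : measurable B -> B `<=` K -> `|l \1_B| = l \1_B.
  by move=> mB BK; rewrite ger0_norm // (ac_ge0 Hl cK (ccf_sub mB BK)).
rewrite (_ : (fun n => _) = EFin \o (fun n => l \1_(\big[setU/set0]_(i < n) H i))).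
  rewrite /local_measure pos //; apply: cvg_EFin; first exact: nearW.
  apply: (ac_lim cK (ccf_sub mUD UK)) => [n|x n m nm|x].
  - exact: ccf_sub.
  - rewrite !indicE ler_nat; case: (boolP (x \in _)) => //.
    rewrite inE -bigcup_mkord => -[i /= ni Hx]; rewrite mem_set //.
    by rewrite -bigcup_mkord; exists i => //; exact: leq_trans ni nm.
  - apply: cvg_near_cst.
    have [[[i _ Gx] Dx]|nx] := pselect ((\bigcup_n G n `&` D) x).
      exists i.+1 => // n /= ni; rewrite !indicE !mem_set //.
        by split => //; exists i.
      by rewrite -bigcup_mkord; exists i.
    apply: nearW => n; rewrite !indicE !memNset //.
    rewrite -bigcup_mkord => -[i _ [Gx Dx]]; apply: nx; split => //.
    by exists i.
apply/funext => n; rewrite /= (ac_sum n cK mH HK tH) -sumEFin big_mkord.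
by apply: eq_bigr => i _; rewrite /local_measure (pos _ (mH i) (HK i)).
Qed.

HB.instance Definition _ := isMeasure.Build _ _ _ lm lm0 lm_ge0 lm_sigma.

End local_measure.

Lemma ac_simple K c g : compact K -> ccf K c g -> finite_set (range g) ->
  forall L : (E -> \bar R) -> \bar R, monotone_functional L ->
  (forall A, measurable A -> A `<=` K -> L (EFin \o \1_A) = (l \1_A)%:E) ->
  L (EFin \o g) = (l g)%:E.
Proof.
move=> cK cg fg L mL LE; have [mg g0 gK] := cg.
have mK := borel_compact hE cK.
pose A y := g @^-1` [set y] `&` K.
have mA y : measurable (A y).
  by apply: measurableI => //; rewrite -[X in measurable X]setTI; exact: mg.
have AK y : A y `<=` K by move=> x [].
have gE : g = (fun x => \sum_(y <- fset_set (range g)) (y * \1_(A y) x)).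
  apply/funext => x; rewrite (bigD1_seq (g x)) ?fset_uniq //=; last first.
    by rewrite in_fset_set // inE; exists x.
  rewrite big1 ?addr0.
    rewrite indicE; have [Kx|nKx] := pselect (K x).
      by rewrite mem_set ?mulr1 //; split.
    by rewrite memNset ?gK ?mulr0 // => -[].
  move=> y yg; rewrite indicE memNset ?mulr0 // => -[/= gy _].
  by rewrite gy eqxx in yg.
have y0 y : y \in fset_set (range g) -> 0 <= y.
  by rewrite in_fset_set // inE => -[x _ <-]; have /andP[] := g0 x.
have step (s : seq R) : (forall y, y \in s -> 0 <= y) ->
    (exists c, ccf K c (fun x => \sum_(y <- s) (y * \1_(A y) x))) /\
    l (fun x => \sum_(y <- s) (y * \1_(A y) x)) = \sum_(y <- s) y * l \1_(A y).
  elim: s => [|y s IH] s0.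
    split; last by rewrite big_nil -[RHS]ac_zero; congr l; apply/funext => x;
      rewrite big_nil.
    exists 1; rewrite (_ : (fun x => _) = \1_set0); first exact: ccf_sub.
    by apply/funext => x; rewrite big_nil indicE in_set0.
  have [|[c1 h1] h2] := IH; first by move=> z zs; apply: s0; rewrite inE zs orbT.
  have y00 : 0 <= y by apply: s0; rewrite inE eqxx.
  have cA := ccf_sub (mA y) (@AK y).
  have -> : (fun x => \sum_(z <- y :: s) (z * \1_(A z) x)) =
      (fun x => y * \1_(A y) x) \+ (fun x => \sum_(z <- s) (z * \1_(A z) x)).
    by apply/funext => x /=; rewrite big_cons.
  split; first by eexists; exact: (ccfD (ccfZ y00 cA) h1).
  by rewrite (ac_D Hl cK (ccfZ y00 cA) h1) big_cons h2 (ac_Z Hl cK cA y00).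
rewrite [in RHS]gE (step _ y0).2 -sumEFin.
rewrite (_ : EFin \o g = (fun x => \sum_(y <- fset_set (range g))
    (y%:E * (EFin \o \1_(A y)) x)%E)); last first.
  by apply/funext => x /=; rewrite {1}gE -sumEFin.
rewrite mf_sum // => [|y ys]; last by apply: nnmZ; [exact: y0|exact: nnm_indic].
rewrite big_seq [RHS]big_seq; apply: eq_bigr => y ys.
by rewrite (mf_Z mL (y0 _ ys)) ?LE //; exact: nnm_indic.
Qed.

Lemma ac_integral K c f : compact K -> ccf K c f ->
  forall L : (E -> \bar R) -> \bar R, monotone_functional L ->
  (forall A, measurable A -> A `<=` K -> L (EFin \o \1_A) = (l \1_A)%:E) ->
  L (EFin \o f) = (l f)%:E.
Proof.
move=> cK cf L mL LE; have nf := ccf_nnm cf.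
pose g := nnsfun_approx measurableT nf.1.
have gcv x : (EFin \o g n) x @[n --> \oo] --> (f x)%:E.
  exact: (@cvg_nnsfun_approx _ _ _ _ measurableT _ nf.1
    (fun y _ => nf.2 y) x Logic.I).
have gnd x : nondecreasing_seq (g ^~ x).
  move=> n m nm.
  by have /lefP := @nd_nnsfun_approx _ _ _ _ measurableT _ nf.1 n m nm; exact.
have gcv' x : g n x @[n --> \oo] --> f x by exact: (fine_cvg (gcv x)).
have gle n x : g n x <= f x.
  rewrite -(cvg_lim (@Rhausdorff R) (gcv' x)).
  by apply: nondecreasing_cvgn_le; [exact: gnd|exact: cvgP (gcv' x)].
have cg n : ccf K c (g n).
  have [mf f0 fK] := cf; split => //.
    move=> x; have /andP[_ fc] := f0 x; rewrite (le_trans (gle n x) fc) andbT.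
    exact: fun_ge0.
  by move=> x /fK fx; apply/le_anti; rewrite -{1}fx gle /=; exact: fun_ge0.
have h1 : (l (g n))%:E @[n --> \oo] --> (l f)%:E.
  by apply: cvg_EFin; [exact: nearW|exact: ac_lim cf cg gnd gcv'].
have h2 := mf_cvg mL (fun n => ccf_nnm (cg n))
  (fun x n m nm => gnd x n m nm : ((g n x)%:E <= (g m x)%:E)%E).
have fE : EFin \o f = (fun x => limn (fun n => (EFin \o g n) x)).
  by apply/funext => x; apply/esym/cvg_lim => //; exact: gcv.
rewrite fE; apply: cvg_unique h2 _ => //.
rewrite (_ : (fun n => _) = (fun n => (l (g n))%:E)) //.
by apply/funext => n; apply: (ac_simple cK (cg n)) => //; exact: fimfunP.
Qed.

(** The sum of the local measures on the disjoint pieces of a compact exhaustion. A compact set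
    meets finitely many pieces, so there finite additivity of [l] identifies the sum. *)
Lemma ac_measure : exists M : {measure set E -> \bar R},
  finite_on_compacts M /\
  forall K c f, compact K -> ccf K c f -> (\int[M]_x (f x)%:E)%E = (l f)%:E.
Proof.
have [KK [cKK hKK KKT KKc]] := compact_exhaustion E_lc.
have mKK n : measurable (KK n) by exact: borel_compact.
have mD n : measurable (seqDU KK n).
  by apply: measurableD => //; apply: bigsetU_measurable.
have DK n : seqDU KK n `<=` KK n by exact: subDsetl.
pose M : {measure set E -> \bar R} :=
  mseries (fun n => local_measure Hl (cKK n) (mD n) (DK n)) 0.
have ME K A : compact K -> measurable A -> A `<=` K -> M A = (l \1_A)%:E.
  move=> cK mA AK; have [n0 Kn0] := KKc _ cK.
  pose AD n := A `&` seqDU KK n.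
  have mAD n : measurable (AD n) by exact: measurableI.
  have AU : \big[setU/set0]_(i < n0.+1) AD i = A.
    rewrite -big_distrr /= -bigsetU_seqDU; apply/setIidPl.
    apply: (subset_trans AK); apply: (subset_trans Kn0).
    by rewrite big_ord_recr /=; exact: subsetUr.
  have tAD : trivIset setT AD.
    by apply: trivIset_setIl; exact: trivIset_seqDU.
  rewrite -[in RHS]AU (ac_sum _ cK mAD) //; last by move=> i x [/AK].
  rewrite -sumEFin /M /= /mseries.
  rewrite (nneseries_split 0 n0.+1) // add0n big_mkord eseries0 ?adde0.
    apply: eq_bigr => i _; rewrite -[LHS]/((`|l \1_(AD i)|)%:E) ger0_norm //.
    by apply: (ac_ge0 Hl cK); apply: ccf_sub => // x [/AK].
  move=> i ni _; rewrite -[LHS]/((`|l \1_(AD i)|)%:E) (_ : AD i = set0).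
    by rewrite (_ : \1_set0 = (fun=> 0)) ?ac_zero ?normr0 //;
      apply/funext => x; rewrite indicE in_set0.
  rewrite -subset0 => x [Ax [_]]; apply.
  by rewrite -bigcup_mkord; exists n0 => //; exact/Kn0/AK.
exists M; split.
  by move=> K cK; rewrite (ME K) ?ltry //; exact: borel_compact.
move=> K c f cK cf; apply: (ac_integral cK cf (mf_integral M)) => A mA AK.
by rewrite integral_indic // setIT (ME K).
Qed.

End functional_measure.

Lemma pairDl K c h c' h' M f : compact K -> ccf K c h -> ccf K c' h' ->
  dom M f -> pairing (h \+ h') f = pairing h f + pairing h' f.
Proof.
move=> cK ch ch' df; apply: EFin_inj; rewrite EFinD.
rewrite (pair_EFin cK ch df) (pair_EFin cK ch' df).
rewrite (pair_EFin cK (ccfD ch ch') df).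
rewrite -(mf_D (mf_integral pi) (nnmM (ccf_nnm ch) (dom_nnm df))
  (nnmM (ccf_nnm ch') (dom_nnm df))).
by apply: eq_integral => x _ /=; rewrite mulrDl EFinD.
Qed.

(** * Left translations *)

Definition ltrans (a : E) (h : E -> R) x := h (a * x)%g.

Lemma ccf_ltrans K c h a : compact K -> ccf K c h ->
  ccf (mulset [set a^-1%g] K) c (ltrans a h).
Proof.
move=> cK [mh h0 hK]; split => [|x|x nx].
- by apply: measurableT_comp mh _; apply: continuous_borel; exact: mull_continuous.
- exact: h0.
- apply: hK => Kax; apply: nx; exists a^-1%g, (a * x)%g; split => //.
  by rewrite monoid.mulKg.
Qed.

Lemma compact_ltrans K (a : E) : compact K -> compact (mulset [set a] K).
Proof. by move=> cK; apply: compact_mulset => //; exact: compact_set1. Qed.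

Lemma dom_ltrans M f a : dom M f -> dom (M * phi a) (ltrans a f).
Proof.
move=> [mf f0]; split.
  by apply: measurableT_comp mf _; apply: continuous_borel; exact: mull_continuous.
by move=> x; rewrite /ltrans -mulrA -(phiM); exact: f0.
Qed.

Lemma iterU_ltrans n M f a : dom M f ->
  iter n U (ltrans a f) = ltrans a (iter n U f).
Proof.
move=> df; apply/funext => x; apply: EFin_inj.
rewrite (iterU_EFin n x (dom_ltrans a df)) /ltrans (iterU_EFin n _ df).
by rewrite -iter_rw_op_mull.
Qed.

Lemma pair_ltrans K c h M f a : compact K -> ccf K c h -> dom M f ->
  pairing (ltrans a^-1%g h) f = pairing h (ltrans a f).
Proof.
move=> cK ch df; apply: EFin_inj.
rewrite (pair_EFin cK ch (dom_ltrans a df)).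
have cK' := @compact_ltrans K (a^-1)^-1%g cK.
rewrite (pair_EFin cK' (ccf_ltrans _ cK ch) df).
have nhf : nnm (fun x => (ltrans a^-1%g h x * f x)%:E).
  exact: (nnmM (ccf_nnm (ccf_ltrans _ cK ch)) (dom_nnm df)).
rewrite -(haar_mull a (ws_l W) nhf); apply: eq_integral => x _.
by rewrite /ltrans monoid.mulKg.
Qed.

(** * Limit forms *)

Section limit_form.
Variable K0 : set E.
Hypothesis cK0 : compact K0.
Hypothesis pK0 : (0 < pi K0)%E.
Let a n := ret K0 n.
Hypothesis a_sub : forall q, 0 < q < 1 ->
  exists n0, forall n, (n0 <= n)%N -> q ^+ n <= a n.
Variable F : set_system nat.
Hypothesis FU : UltraFilter F.
Hypothesis Foo : \oo `<=` F.
Hypothesis Fj : forall j e, 0 < e ->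
  \forall n \near F, `|a (n + j)%N - a n| <= e * a n.

Let FP : ProperFilter F := ultra_proper.

Let a_gt0 : \forall n \near F, 0 < a n.
Proof.
have h2 : 0 < (2^-1 : R) < 1 by apply/andP; split; lra.
have [n0 H] := a_sub h2; apply: Foo; exists n0 => // n /= /H; apply: lt_le_trans.
by rewrite exprn_gt0 // invr_gt0.
Qed.

Definition limform h f : R := lim (pairing h (iter n U f) / a n @[n --> F]).

Lemma limform_cvg K c h K' c' f : compact K -> ccf K c h ->
  compact K' -> ccf K' c' f ->
  pairing h (iter n U f) / a n @[n --> F] --> limform h f.
Proof.
move=> cK ch cK' cf; have [D D0 HD] := pair_bounded cK0 pK0 Fj cK ch cK' cf.
suff : cvg (pairing h (iter n U f) / a n @[n --> F]) by [].
apply: (@ultra_bounded_cvg _ _ _ D) => //.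
near=> n; have an : 0 < a n by near: n.
have /andP[x0 xD] : 0 <= pairing h (iter n U f) <= D * a n by near: n.
by rewrite divr_ge0 ?(ltW an) //= ler_pdivrMr.
Unshelve. all: by end_near. Qed.

Lemma limform_eq h f y : pairing h (iter n U f) / a n @[n --> F] --> y ->
  limform h f = y.
Proof. by move=> cv; apply/cvg_lim. Qed.

Lemma limform_ge0 K c h K' c' f : compact K -> ccf K c h ->
  compact K' -> ccf K' c' f -> 0 <= limform h f.
Proof.
move=> cK ch cK' cf; have [M df] := ccf_dom cK' cf.
apply: (cvgr_to_ge (limform_cvg cK ch cK' cf)).
apply: filterS a_gt0 => n an; rewrite divr_ge0 ?(ltW an) //.
exact: (pf_ge0 (posfun_pair cK ch) (dom_iterU n df)).
Qed.

Lemma limformDr K c h K' c' f c'' g : compact K -> ccf K c h ->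
  compact K' -> ccf K' c' f -> ccf K' c'' g ->
  limform h (f \+ g) = limform h f + limform h g.
Proof.
move=> cK ch cK' cf cg; apply: limform_eq.
have [M df] := ccf_dom cK' cf; have [M' dg] := ccf_dom cK' cg.
apply: cvg_ext (cvgD (limform_cvg cK ch cK' cf) (limform_cvg cK ch cK' cg)).
move=> n /=.
rewrite (po_D (posop_iterU n) df dg).
rewrite (pf_D (posfun_pair cK ch) (dom_iterU n df) (dom_iterU n dg)).
by rewrite mulrDl.
Qed.

Lemma limformZr K c h K' c' f b : compact K -> ccf K c h ->
  compact K' -> ccf K' c' f -> 0 <= b ->
  limform h (fun x => b * f x) = b * limform h f.
Proof.
move=> cK ch cK' cf b0; apply: limform_eq; have [M df] := ccf_dom cK' cf.
apply: cvg_ext (cvgMl_tmp (a := b) (limform_cvg cK ch cK' cf)) => n /=.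
rewrite (po_Z (posop_iterU n) b0 df).
by rewrite (pf_Z (posfun_pair cK ch) b0 (dom_iterU n df)) mulrA.
Qed.

Lemma limformDl K c h c' h' K' c'' f : compact K -> ccf K c h ->
  ccf K c' h' -> compact K' -> ccf K' c'' f ->
  limform (h \+ h') f = limform h f + limform h' f.
Proof.
move=> cK ch ch' cK' cf; apply: limform_eq; have [M df] := ccf_dom cK' cf.
apply: cvg_ext (cvgD (limform_cvg cK ch cK' cf) (limform_cvg cK ch' cK' cf)).
move=> n /=.
by rewrite (pairDl cK ch ch' (dom_iterU n df)) mulrDl.
Qed.

Lemma limformZl K c h K' c' f b : compact K -> ccf K c h ->
  compact K' -> ccf K' c' f -> 0 <= b ->
  limform (fun x => b * h x) f = b * limform h f.
Proof.
move=> cK ch cK' cf b0; apply: limform_eq; have [M df] := ccf_dom cK' cf.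
apply: cvg_ext (cvgMl_tmp (a := b) (limform_cvg cK ch cK' cf)) => n /=.
by rewrite (pairZl cK ch (dom_iterU n df) b0) mulrA.
Qed.

Lemma limformU K c h K' c' f : compact K -> ccf K c h ->
  compact K' -> ccf K' c' f -> limform h (U f) = limform h f.
Proof.
move=> cK ch cK' cf; apply: limform_eq.
have [K1 [c1 [cK1 cU]]] := ccf_U cK' cf.
apply/cvgrPdist_le => e e0; have e2 : 0 < e / 2 by rewrite divr_gt0.
have /cvgrPdist_le/(_ _ e2) h1 := limform_cvg cK ch cK' cf.
have h2 := pair_slow cK0 pK0 a_sub Foo Fj cK ch cK' cf e2; have {}h2 := h2 (@filter_filter _ _ FP).
near=> n; have an : 0 < a n by near: n.
have : `|limform h f - pairing h (iter n U f) / a n| <= e / 2 by near: n.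
have : `|pairing h (iter n.+1 U f) - pairing h (iter n U f)| <= e / 2 * a n by near: n.
rewrite -ler_pdivrMr // -[X in _ / X](gtr0_norm an) -normf_div mulrBl -iterSr.
rewrite -[X in _ -> _ -> `|X| <= _](subrKA (pairing h (iter n U f) / a n)) => h3 h4.
rewrite (splitr e); apply: (le_trans (ler_normD _ _)); apply: lerD => //.
by rewrite distrC.
Unshelve. all: by end_near. Qed.

Lemma limform1 : limform \1_K0 \1_K0 = 1.
Proof.
apply: limform_eq; apply: cvg_near_cst; apply: filterS a_gt0 => n an.
by rewrite divff // gt_eqF.
Qed.

Lemma limform_le K K' : compact K -> compact K' -> exists2 D, 0 <= D &
  forall c h c' f, ccf K c h -> ccf K' c' f ->
    limform h f <= D * (c * mass f) /\ limform h f <= D * (c' * mass h).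
Proof.
move=> cK cK'; have [D D0 HD] := pair_ac cK0 pK0 Fj cK cK'.
exists D => // c h c' f ch cf.
have cv := limform_cvg cK ch cK' cf.
by split; apply: (cvgr_to_le cv); apply: filterS2 a_gt0 HD => n an;
  move=> /(_ _ _ _ _ ch cf)[h1 h2]; rewrite ler_pdivrMr.
Qed.

Lemma limform_ltrans K c h K' c' f b : compact K -> ccf K c h ->
  compact K' -> ccf K' c' f ->
  limform (ltrans b^-1%g h) f = limform h (ltrans b f).
Proof.
move=> cK ch cK' cf; have [M df] := ccf_dom cK' cf.
apply: limform_eq.
apply: cvg_ext (limform_cvg cK ch (@compact_ltrans _ b^-1%g cK')
  (ccf_ltrans b cK' cf)) => n.
by rewrite (pair_ltrans b cK ch (dom_iterU n df)) (iterU_ltrans n b df).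
Qed.

Lemma limform_acr K c h : compact K -> ccf K c h -> ac_functional (limform h).
Proof.
move=> cK ch; split.
- by move=> K' c' f cK' cf; exact: limform_ge0 cK ch cK' cf.
- by move=> K' c' f c'' g cK' cf cg; exact: limformDr cK ch cK' cf cg.
- by move=> K' c' f b cK' cf b0; exact: limformZr cK ch cK' cf b0.
- move=> K' cK'; have [D D0 HD] := limform_le cK cK'.
  exists (D * c); first by rewrite mulr_ge0 // (ccf_ge0 ch).
  by move=> c' f cf; rewrite -mulrA; exact: (HD _ _ _ _ ch cf).1.
Qed.

Lemma limform_acl K' c' f : compact K' -> ccf K' c' f ->
  ac_functional (limform ^~ f).
Proof.
move=> cK' cf; split.
- by move=> K c h cK ch; exact: limform_ge0 cK ch cK' cf.
- by move=> K c h c'' h' cK ch ch'; exact: limformDl cK ch ch' cK' cf.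
- by move=> K c h b cK ch b0; exact: limformZl cK ch cK' cf b0.
- move=> K cK; have [D D0 HD] := limform_le cK cK'.
  exists (D * c'); first by rewrite mulr_ge0 // (ccf_ge0 cf).
  by move=> c h ch; rewrite -mulrA; exact: (HD _ _ _ _ ch cf).2.
Qed.

End limit_form.

Lemma mf_eq_compact (L1 L2 : (E -> \bar R) -> \bar R) :
  monotone_functional L1 -> monotone_functional L2 ->
  (forall K A, compact K -> measurable A -> A `<=` K ->
    L1 (EFin \o \1_A) = L2 (EFin \o \1_A)) ->
  forall f : E -> \bar R, nnm f -> L1 f = L2 f.
Proof.
move=> mL1 mL2 L12; apply: mf_eq_indic => // A mA.
have [KK [cKK hKK KKT _]] := compact_exhaustion E_lc.
have mAK n : measurable (A `&` KK n).
  by apply: measurableI => //; exact: borel_compact.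
have nd x : nondecreasing_seq (fun n => (EFin \o \1_(A `&` KK n)) x : \bar R).
  move=> n m nm; rewrite lee_fin !indicE ler_nat.
  case: (boolP (x \in _)) => //; rewrite inE => -[Ax /(hKK _ _ nm) h].
  by rewrite mem_set.
have AE : EFin \o \1_A = (fun x => limn (fun n => (EFin \o \1_(A `&` KK n)) x : \bar R)).
  apply/funext => x; apply/esym/cvg_lim => //; apply: cvg_near_cst.
  have [n _ Kx] : (\bigcup_n KK n) x by rewrite KKT.
  exists n => // m /= nm; rewrite !indicE in_setI.
  by rewrite [x \in KK m]mem_set ?andbT //; exact: hKK Kx.
have h1 := mf_cvg mL1 (fun n => nnm_indic R (mAK n)) nd.
have h2 := mf_cvg mL2 (fun n => nnm_indic R (mAK n)) nd.
rewrite AE; apply: cvg_unique h1 _ => //.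
rewrite (_ : (fun n => _) = (fun n => L2 (EFin \o \1_(A `&` KK n)))) //.
by apply/funext => n; apply: (L12 (KK n)) => // x [].
Qed.

Lemma rw_op_indic A x : measurable A ->
  rw_op v (EFin \o \1_A) x = rw_kernel v x A.
Proof.
move=> mA; rewrite /rw_op /rw_kernel.
have -> : [set (x^-1 * a)%g | a in A] = (fun y => (x * y)%g) @^-1` A.
  apply/seteqP; split => [y [a Aa <-]|y /= Ay]; first by rewrite /= monoid.mulVKg.
  by exists (x * y)%g => //; rewrite monoid.mulKg.
have mB : measurable ((fun y => (x * y)%g) @^-1` A).
  rewrite -[X in measurable X]setTI.
  by apply: continuous_borel => //; exact: mull_continuous.
by rewrite -[X in v X]setIT -[RHS]integral_indic.
Qed.

(** * Functionals invariant under the walk *)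

Section invariant_functional.
Variable nu : {measure set E -> \bar R}.
Hypothesis hB : unique_invariant_measure v r nu.

(** Represented by a measure, invariance of [l] under [U] becomes [r]-invariance of the measure, to
    which the uniqueness in (B) applies. *)
Lemma invariant_functional l : ac_functional l ->
  (forall K c f, compact K -> ccf K c f -> l (U f) = l f) ->
  exists2 b, 0 <= b & forall K c f, compact K -> ccf K c f ->
    ((l f)%:E = b%:E * \int[nu]_x (f x)%:E)%E.
Proof.
move=> lac lU; have [M [Mfin ME]] := ac_measure lac.
have Minv (f : E -> \bar R) : nnm f -> (\int[M]_x f x = r%:E * \int[M]_x rw_op v f x)%E.
  have mM := mf_scale (ltW r0)
    (mf_comp (mf_integral M) (nnm_rw_op E_lc v) (mf_rw_op v)).
  move=> nf; apply: (mf_eq_compact (mf_integral M) mM _ nf) => {f nf}.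
  move=> K A cK mA AK; have cA := ccf_sub mA AK.
  have [P dA] := ccf_dom cK cA; have [K1 [c1 [cK1 cU]]] := ccf_U cK cA.
  rewrite (ME K 1 \1_A cK cA) -(lU K 1 _ cK cA) -(ME _ _ _ cK1 cU).
  rewrite -(mf_Z (mf_integral M) (ltW r0)).
    by apply: eq_integral => x _; rewrite (U_EFin x dA).
  by apply: nnm_rw_op => //; exact: nnm_indic.
(* An invariant measure is nonzero by definition, so the zero functional is treated apart, with
   [b = 0]. *)
have [M0|M0] := eqVneq (M setT) 0%E.
  exists 0 => // K c f cK cf; rewrite -(ME K c f cK cf) mul0e.
  rewrite null_set_integral //; first exact: (ccf_nnm cf).1.
have iM : invariant_measure v r M.
  split => //; first by rewrite lt_neqAle eq_sym M0 /=.
  move=> A mA; rewrite -[X in M X]setIT -[LHS]integral_indic //.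
  rewrite [LHS](Minv _ (nnm_indic R mA)).
  by congr (_ * _)%E; apply: eq_integral => x _; exact: rw_op_indic.
have [_ _ /(_ M iM Mfin)[b b0 Hb]] := hB.
exists b; first exact: ltW.
move=> K c f cK cf; rewrite -(ME K c f cK cf).
apply: (mf_eq_indic (mf_integral M) (mf_scale (ltW b0) (mf_integral nu))).
  by move=> A mA; rewrite !integral_indic // !setIT Hb.
exact: ccf_nnm cf.
Qed.

End invariant_functional.

(** * Weights and the invariant measure of density 1 / phi *)

Definition wmul (w : E -> R) f x := w x * f x.

Definition weight (w : E -> R) := [/\ measurable_fun setT w,
  (forall x, 0 <= w x) &
  forall K, compact K -> exists2 b, 0 <= b & forall x, K x -> w x <= b].

Lemma ccf_wmul w K c f : weight w -> compact K -> ccf K c f ->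
  exists c', ccf K c' (wmul w f).
Proof.
move=> [mw w0 wb] cK [mf f0 fK]; have [b b0 Hb] := wb K cK.
exists (b * c); split; first exact: measurable_funM.
- move=> x; have /andP[fx0 fxc] := f0 x; rewrite mulr_ge0 //=.
  have [Kx|nKx] := pselect (K x); first by rewrite ler_pM // Hb.
  by rewrite /wmul fK // mulr0 mulr_ge0 // (le_trans fx0).
- by move=> x /fK; rewrite /wmul => ->; rewrite mulr0.
Qed.

Lemma weight_phi : weight phi.
Proof.
split; first by case: (ws_exp W).
- by move=> x; rewrite ltW // phi_gt0.
- move=> K cK; have [a [b [a0 b0 H]]] := phi_bounds cK.
  by exists b; [exact: ltW|move=> x /H/andP[]].
Qed.

Lemma weight_phiV : weight (fun x => (phi x)^-1).
Proof.
split.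
- rewrite (_ : (fun x => _) = phi \o (fun x => x^-1%g)).
    apply: measurableT_comp; first by case: (ws_exp W).
    apply: continuous_borel; exact: invg_continuous.
  by apply/funext => x /=; rewrite phiV.
- by move=> x; rewrite invr_ge0 ltW // phi_gt0.
- move=> K cK; have [a [b [a0 b0 H]]] := phi_bounds cK.
  exists a^-1; first by rewrite invr_ge0 ltW.
  by move=> x /H/andP[h _]; rewrite lef_pV2 // posrE // phi_gt0.
Qed.

Lemma wmul_phiVK f : wmul (fun x => (phi x)^-1) (wmul phi f) = f.
Proof.
apply/funext => x; rewrite /wmul mulrA mulVf ?mul1r //.
by rewrite gt_eqF // phi_gt0.
Qed.

Lemma ac_mass : ac_functional mass.
Proof.
split.
- by move=> K c f cK cf; apply: mass_ge0 => x; exact: ccf_f_ge0 cf.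
- by move=> K c f c' g cK cf cg; exact: (mass_ac cK cf cg).
- move=> K c f a cK cf a0; apply: EFin_inj; rewrite EFinM.
  rewrite -(mass_EFin cK cf) -(mass_EFin cK (ccfZ a0 cf)).
  rewrite -(mf_Z (mf_integral pi) a0 (ccf_nnm cf)).
  by apply: eq_integral => x _; rewrite EFinM.
- by move=> K cK; exists 1 => // c f _; rewrite mul1r.
Qed.

Lemma ac_wmul w l : weight w -> ac_functional l ->
  ac_functional (fun f => l (wmul w f)).
Proof.
move=> ww lac; split.
- move=> K c f cK cf; have [c' cwf] := ccf_wmul ww cK cf.
  exact: (ac_ge0 lac cK cwf).
- move=> K c f c' g cK cf cg.
  have [a cwf] := ccf_wmul ww cK cf; have [b cwg] := ccf_wmul ww cK cg.
  rewrite -(ac_D lac cK cwf cwg); congr l.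
  by apply/funext => x; rewrite /wmul /= mulrDr.
- move=> K c f a cK cf a0; have [c' cwf] := ccf_wmul ww cK cf.
  rewrite -(ac_Z lac cK cwf a0); congr l.
  by apply/funext => x; rewrite /wmul /= mulrCA.
- move=> K cK; have [C C0 HC] := ac_le lac cK.
  have [mw w0 wb] := ww; have [b b0 Hb] := wb K cK.
  exists (C * b); first exact: mulr_ge0.
  move=> c f cf; have [c' cwf] := ccf_wmul ww cK cf.
  apply: (le_trans (HC _ _ cwf)); rewrite -mulrA ler_wpM2l //.
  rewrite -(ac_Z ac_mass cK cf b0) -lee_fin -(mass_EFin cK cwf).
  rewrite -(mass_EFin cK (ccfZ b0 cf)); apply: (mf_le (mf_integral pi)).
  + exact: ccf_nnm cwf.
  + exact: ccf_nnm (ccfZ b0 cf).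
  + move=> x; rewrite lee_fin /wmul; have [Kx|nKx] := pselect (K x).
      by rewrite ler_wpM2r ?(ccf_f_ge0 x cf) // Hb.
    by have [_ _ ->] // := cf; rewrite !mulr0.
Qed.

Definition vmass f := mass (wmul (fun x => (phi x)^-1) f).

(** By multiplicativity, [(phi x)^-1 * f (x * y)] is [phi y] times the value of [phi^-1 f] at
    [x * y]. Right invariance removes [y] from the latter, and the integral of [phi] against [v]
    cancels [r]. *)
Lemma vmassU K c f : compact K -> ccf K c f -> vmass (U f) = vmass f.
Proof.
move=> cK cf; have [M df] := ccf_dom cK cf.
have [K1 [c1 [cK1 cU]]] := ccf_U cK cf.
have [c2 cw] := ccf_wmul weight_phiV cK cf.
have [c3 cwU] := ccf_wmul weight_phiV cK1 cU.
apply: EFin_inj; rewrite -(mass_EFin cK1 cwU) -(mass_EFin cK cw).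
set F := EFin \o wmul (fun x => (phi x)^-1) f.
have nF : nnm F by exact: ccf_nnm cw.
pose G (xy : E * E) := ((phi xy.2)%:E * F (xy.1 * xy.2)%g)%E.
have mm : measurable_fun setT (fun xy : E * E => (xy.1 * xy.2)%g).
  by apply: mulg_borel; case: E_lc.
have nG : nnm G.
  split; last first.
    by move=> xy; apply: mule_ge0; [exact: nnm_phi.2|exact: nF.2].
  apply: emeasurable_funM; last exact: (measurableT_comp nF.1 mm).
  by apply: (measurableT_comp nnm_phi.1); exact: measurable_snd.
have sv : sigma_finite setT v by exact: sigma_finiteT.
transitivity (r%:E * \int[pi]_x \int[v]_y G (x, y))%E.
  rewrite -(mf_Z (mf_integral pi) (ltW r0) (nnm_partial_integral sv nG)).
  apply: eq_integral => x _; rewrite /wmul EFinM (U_EFin x df) muleCA.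
  congr (_ * _)%E; rewrite /rw_op.
  rewrite -ge0_integralZl_EFin //; first last.
  - by rewrite invr_ge0 ltW // phi_gt0.
  - exact: (nnm_mull x (ccf_nnm cf)).1.
  - by move=> y _; rewrite lee_fin (ccf_f_ge0 _ cf).
  apply: eq_integral => y _; rewrite /G /F /wmul /= phiM -!EFinM.
  have x0 := phi_gt0 x; have y0 := phi_gt0 y.
  by congr (_%:E); field; rewrite !gt_eqF.
rewrite (tonelli spi sv nG).
transitivity (r%:E * \int[v]_y ((phi y)%:E * \int[pi]_x F x))%E.
  congr (_ * _)%E; apply: eq_integral => y _.
  rewrite -(haar_mulr y (ws_r W) nF) -ge0_integralZl_EFin //.
  - by move=> x _; exact: nF.2.
  - exact: (nnm_mulr y nF).1.
  - by rewrite ltW // phi_gt0.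
rewrite ge0_integralZr //; first last.
- exact: (mf_ge0 (mf_integral pi) nF).
- by move=> y _; exact: nnm_phi.2.
- exact: nnm_phi.1.
by rewrite (ws_int W) muleA -EFinM divff ?mul1e // gt_eqF.
Qed.

Lemma vmass_ltrans K c f a : compact K -> ccf K c f ->
  vmass (ltrans a f) = phi a * vmass f.
Proof.
move=> cK cf; have cK' := @compact_ltrans K a^-1%g cK.
have [c2 cw] := ccf_wmul weight_phiV cK cf.
have [c3 cwt] := ccf_wmul weight_phiV cK' (ccf_ltrans a cK cf).
apply: EFin_inj; rewrite EFinM -(mass_EFin cK' cwt) -(mass_EFin cK cw).
have nF := ccf_nnm cw; rewrite -(haar_mull a (ws_l W) nF).
rewrite -(mf_Z (mf_integral pi) _ (nnm_mull a nF)); last first.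
  by rewrite ltW // phi_gt0.
apply: eq_integral => x _; rewrite /wmul /ltrans /= phiM -EFinM.
have x0 := phi_gt0 x; have a0 := phi_gt0 a.
by congr (_%:E); field; rewrite !gt_eqF.
Qed.

Lemma mass_gt0 K c f : compact K -> ccf K c f ->
  (0 < pi [set x | (0 < f x)%R])%E -> 0 < mass f.
Proof.
move=> cK cf pf; rewrite lt_neqAle; apply/andP; split; last first.
  by apply: mass_ge0 => x; exact: ccf_f_ge0 cf.
apply/eqP => m0; have := mass_EFin cK cf; rewrite -m0 => i0.
have [mf f0 _] := cf; have nf := ccf_nnm cf.
have /ae_eq_integral_abs : (\int[pi]_(x in setT) `|(f x)%:E| = 0)%E.
  by rewrite -[RHS]i0; apply: eq_integral => x _; rewrite gee0_abs ?nf.2.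
move=> /(_ measurableT nf.1)[N [mN N0 sN]].
have : (pi [set x | (0 < f x)%R] <= pi N)%E.
  apply: le_measure; rewrite ?inE //.
    rewrite -[X in measurable X]setTI (_ : [set x | 0 < f x] = f @^-1` `]0, +oo[).
      exact: mf.
    by apply/seteqP; split => x; rewrite /= in_itv /= andbT.
  move=> x /= fx; apply: sN => /= /(_ Logic.I)[] fx0.
  by rewrite fx0 ltxx in fx.
by rewrite N0 leNgt pf.
Qed.

(** * Uniqueness of the invariant form *)

Section invariant_forms.
Variable nu : {measure set E -> \bar R}.
Hypothesis hB : unique_invariant_measure v r nu.

Local Notation iphi := (fun x => (phi x)^-1).

Variable K0 : set E.
Hypothesis cK0 : compact K0.
Hypothesis pK0 : (0 < pi K0)%E.
Let g0 : E -> R := \1_K0.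
Let cg0 : ccf K0 1 g0. Proof. exact: (ccf_indic cK0). Qed.

Lemma wmul_gt0 w : weight w -> (forall x, 0 < w x) -> 0 < mass (wmul w g0).
Proof.
move=> ww w0; have [c cw] := ccf_wmul ww cK0 cg0.
apply: (mass_gt0 cK0 cw).
rewrite (_ : [set x | _] = K0) //; apply/seteqP; split => x /=.
  by rewrite /wmul /g0 indicE; case: (boolP (x \in K0)); rewrite ?inE // mulr0 ltxx.
by move=> Kx; rewrite /wmul /g0 indicE mem_set // mulr1.
Qed.

Lemma vmass_gt0 : 0 < vmass g0.
Proof.
apply: wmul_gt0; first exact: weight_phiV.
by move=> x; rewrite invr_gt0 phi_gt0.
Qed.

Lemma invariant_measure_vmass : exists2 b, 0 < b & forall K c f, compact K ->
  ccf K c f -> (\int[nu]_x (f x)%:E = (b * vmass f)%:E)%E.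
Proof.
have vac := ac_wmul weight_phiV ac_mass.
have [b b0 Hb] := invariant_functional hB vac vmassU.
have {}b0 : 0 < b.
  rewrite lt_neqAle b0 andbT; apply/eqP => b00.
  have := Hb _ _ _ cK0 cg0; rewrite -b00 mul0e => -[v0].
  by have := vmass_gt0; rewrite /vmass v0 ltxx.
exists b^-1 => [|K c f cK cf]; first by rewrite invr_gt0.
by rewrite EFinM (Hb _ _ _ cK cf) muleA -EFinM mulVf ?mul1e // gt_eqF.
Qed.

Variable B : (E -> R) -> (E -> R) -> R.
Hypothesis Br : forall K c h, compact K -> ccf K c h -> ac_functional (B h).
Hypothesis Bl : forall K c f, compact K -> ccf K c f ->
  ac_functional (B ^~ f).
Hypothesis BU : forall K c h K' c' f, compact K -> ccf K c h ->
  compact K' -> ccf K' c' f -> B h (U f) = B h f.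
Hypothesis Btr : forall K c h K' c' f b, compact K -> ccf K c h ->
  compact K' -> ccf K' c' f -> B (ltrans b^-1%g h) f = B h (ltrans b f).

Lemma form_right K c h K' c' f : compact K -> ccf K c h -> compact K' ->
  ccf K' c' f -> B h f * vmass g0 = B h g0 * vmass f.
Proof.
move=> cK ch cK' cf; have [b b0 Hb] := invariant_measure_vmass.
have [a a0 Ha] := invariant_functional hB (Br cK ch)
  (fun _ _ _ cK' cf => BU cK ch cK' cf).
have e K1 c1 f1 : compact K1 -> ccf K1 c1 f1 -> B h f1 = a * (b * vmass f1).
  by move=> cK1 cf1; apply: EFin_inj; rewrite (Ha _ _ _ cK1 cf1) (Hb _ _ _ cK1 cf1).
by rewrite (e _ _ _ cK' cf) (e _ _ _ cK0 cg0); ring.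
Qed.

(** Translating the first argument is the same as translating the second inversely, which multiplies
    [vmass] by a value of [phi]; the weight [phi^-1] compensates this factor and makes [tl] left
    invariant. *)
Let tl h := B (wmul iphi h) g0.

Let tl_ltrans K c h b : compact K -> ccf K c h -> tl (ltrans b h) = tl h.
Proof.
move=> cK ch; have [c' cw] := ccf_wmul weight_phiV cK ch.
have cKb := @compact_ltrans K b^-1%g cK.
have cwb := ccf_ltrans b cK cw.
have cK0b := @compact_ltrans K0 b%g cK0.
have cg0b := ccf_ltrans b^-1%g cK0 cg0; rewrite monoid.invgK in cg0b.
have b0 := phi_gt0 b; have v0 := vmass_gt0.
have -> : tl (ltrans b h) = phi b * B (ltrans b (wmul iphi h)) g0.
  rewrite /tl -(ac_Z (Bl cK0 cg0) cKb cwb (ltW b0)); congr (B _ g0).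
  apply/funext => x; rewrite /wmul /ltrans phiM.
  by have x0 := phi_gt0 x; field; rewrite !gt_eqF.
rewrite -[b in ltrans b]monoid.invgK (Btr _ cK cw cK0 cg0).
have := form_right cK cw cK0b cg0b.
rewrite (vmass_ltrans b^-1%g cK0 cg0) phiV -/(tl h) => e.
apply: (mulIf (lt0r_neq0 v0)); rewrite -mulrA e; field.
by rewrite gt_eqF.
Qed.

(** The measure representing [tl] is left invariant, so uniqueness of Haar measure applies; it is
    tested on [phi h] and [phi g0], where the weight in [tl] cancels. *)
Lemma form_left K c h : compact K -> ccf K c h ->
  B h g0 * mass (wmul phi g0) = B g0 g0 * mass (wmul phi h).
Proof.
move=> cK ch.
have [T [T_fin TE]] := ac_measure (ac_wmul weight_phiV (Bl cK0 cg0)).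
have T_l (f : E -> \bar R) (a : E) : nnm f ->
    (\int[T]_x f (a * x)%g = \int[T]_x f x)%E.
  have mT : monotone_functional (fun f : E -> \bar R => \int[T]_x f (a * x)%g)%E.
    exact: (mf_comp (L := fun f : E -> \bar R => (\int[T]_x f x)%E)
      (A := fun (f : E -> \bar R) (x : E) => f (a * x)%g) (mf_integral T)
      (fun (k : E -> \bar R) nk => nnm_mull a nk) (fun x => @mf_eval _ E R (a * x)%g)).
  move=> nf; apply: (mf_eq_compact mT (mf_integral T) _ nf) => K1 A cK1 mA AK1.
  have cA := ccf_sub mA AK1.
  rewrite [RHS](TE _ _ _ cK1 cA) -/(tl _) -(tl_ltrans a cK1 cA).
  by rewrite -(TE _ _ _ (@compact_ltrans K1 a^-1%g cK1) (ccf_ltrans a cK1 cA)).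
have [c1 ch'] := ccf_wmul weight_phi cK ch.
have [c2 cg'] := ccf_wmul weight_phi cK0 cg0.
have := haar_unique E_lc (ws_fin W) (ws_r W) (ws_l W) cK0 pK0 T_fin T_l
  (ccf_nnm ch') (ccf_nnm cg').
rewrite [X in (X * _)%E = _](TE _ _ _ cK ch') [X in _ = (X * _)%E](TE _ _ _ cK0 cg').
rewrite !(wmul_phiVK) [X in (_ * X)%E = _](mass_EFin cK0 cg').
by rewrite [X in _ = (_ * X)%E](mass_EFin cK ch') -!EFinM => -[].
Qed.

(** Each argument is determined up to a factor, and the normalization at [g0] fixes the product. The
    value therefore does not depend on the ultrafilter behind [B]. *)
Lemma form_unique K c h K' c' f : compact K -> ccf K c h -> compact K' ->
  ccf K' c' f -> B g0 g0 = 1 ->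
  B h f = mass (wmul phi h) * vmass f / (mass (wmul phi g0) * vmass g0).
Proof.
move=> cK ch cK' cf B1; have v0 := vmass_gt0.
have m0 : 0 < mass (wmul phi g0).
  by apply: (wmul_gt0 weight_phi) => x; exact: phi_gt0.
have := form_left cK ch; rewrite B1 mul1r => <-.
rewrite mulrAC -(mulrA _ (mass _)) mulrAC -(form_right cK ch cK' cf).
by field; rewrite !gt_eqF.
Qed.

End invariant_forms.

(** * Ratio limits *)

Lemma integral_diff (M : {measure set E -> \bar R}) (p m : E -> R) a b :
  nnm (EFin \o p) -> nnm (EFin \o m) ->
  (\int[M]_x (p x)%:E = a%:E)%E -> (\int[M]_x (m x)%:E = b%:E)%E ->
  (\int[M]_x (p x - m x)%:E = (a - b)%:E)%E.
Proof.
move=> np nm pa mb.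
have ip f c : nnm (EFin \o f) -> (\int[M]_x (f x)%:E = c%:E)%E ->
    M.-integrable setT (EFin \o f).
  move=> nf fc; apply/integrableP; split; first exact: nf.1.
  rewrite (_ : (\int[M]_x _)%E = c%:E) ?ltry // -fc.
  by apply: eq_integral => x _; rewrite gee0_abs // nf.2.
rewrite EFinB -pa -mb -integralB_EFin //; [exact: ip np pa|exact: ip nm mb].
Qed.

(** Signed functions enter the walk operator only as differences of functions in [dom], whose
    iterates are finite and can be subtracted. *)
Lemma iter_rw_op_diff n M (p m : E -> R) x : dom M p -> dom M m ->
  iter n (rw_op v) (EFin \o (p \- m)) x =
  (r ^- n * (iter n U p x - iter n U m x))%:E.
Proof.
move=> dp dm; elim: n x => [|n IH] x; first by rewrite expr0 invr1 mul1r.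
have {}IH := funext IH; rewrite iterS {}IH.
have dpn := dom_iterU n dp; have dmn := dom_iterU n dm.
have Ux k : dom M k -> (\int[v]_y (k (x * y)%g)%:E = (r^-1 * U k x)%:E)%E.
  move=> dk; rewrite EFinM (U_EFin x dk) muleA -EFinM mulVf ?mul1e //.
  by rewrite gt_eqF.
rewrite /rw_op.
have -> : (\int[v]_y (r ^- n * (iter n U p (x * y)%g - iter n U m (x * y)%g))%:E)%E
  = (\int[v]_y (r ^- n * iter n U p (x * y)%g - r ^- n * iter n U m (x * y)%g)%:E)%E.
  by apply: eq_integral => y _; rewrite mulrBr.
have rn : 0 <= r ^- n by rewrite invr_ge0 exprn_ge0 // ltW.
have nn k : dom M k -> nnm (EFin \o (fun y => r ^- n * k (x * y)%g)).
  by move=> dk; exact: (nnmZ rn (nnm_mull x (dom_nnm dk))).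
have Un k : dom M k -> (\int[v]_y (r ^- n * k (x * y)%g)%:E =
    (r ^- n.+1 * U k x)%:E)%E.
  move=> dk; have nk := nnm_mull x (dom_nnm dk).
  have := mf_Z (mf_integral v) rn nk => /=.
  rewrite (Ux k dk) -EFinM mulrA -invfM -exprSr => <-.
  by apply: eq_integral => y _; rewrite EFinM.
rewrite (integral_diff (nn _ dpn) (nn _ dmn) (Un _ dpn) (Un _ dmn)).
by rewrite -mulrBr.
Qed.

Lemma integral_density (kappa : probability E R) K c h (F : E -> \bar R) :
  compact K -> ccf K c h -> has_density kappa pi h -> nnm F ->
  (\int[kappa]_x F x = \int[pi]_x ((h x)%:E * F x))%E.
Proof.
move=> cK ch hk; have nh := ccf_nnm ch.
have mL : monotone_functional (fun F : E -> \bar R => \int[pi]_x ((h x)%:E * F x)%E)%E.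
  split.
  - by move=> f nf; exact: (mf_ge0 (mf_integral pi) (nnmM nh nf)).
  - move=> f g nf ng fg; apply: (mf_le (mf_integral pi)); try exact: nnmM.
    by move=> x; apply: lee_wpmul2l => //; exact: nh.2.
  - move=> f g nf ng; rewrite -(mf_D (mf_integral pi)); try exact: nnmM.
    by apply: eq_integral => x _; rewrite /= ge0_muleDr ?nf.2 ?ng.2.
  - move=> a f a0 nf; rewrite -(mf_Z (mf_integral pi) a0 (nnmM nh nf)).
    by apply: eq_integral => x _; rewrite muleCA.
  - move=> f_ nf nd.
    rewrite (_ : (\int[pi]_x _)%E =
        (\int[pi]_x limn (fun n => (h x)%:E * f_ n x))%E); last first.
      apply: eq_integral => x _; apply/esym/cvg_lim => //.
      by apply: cvgeZl => //; exact: ereal_nondecreasing_is_cvgn.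
    apply: (mf_cvg (mf_integral pi)); first by move=> n; exact: nnmM.
    move=> x n n' nn'; apply: lee_wpmul2l; first exact: nh.2.
    exact: nd.
move=> nF; apply: (mf_eq_indic (mf_integral kappa) mL _ nF) => A mA.
rewrite integral_indic // setIT hk // integral_mkcond; apply: eq_integral => x _.
by rewrite /= patchE indicE; case: (x \in A); rewrite ?mule1 ?mule0.
Qed.

Lemma int_rw_op_diff (kappa : probability E R) n K c h K' c' (p m : E -> R) :
  compact K -> ccf K c h -> has_density kappa pi h ->
  compact K' -> ccf K' c' p -> ccf K' c' m ->
  int_rw_op v kappa n (p \- m) =
  r ^- n * (pairing h (iter n U p) - pairing h (iter n U m)).
Proof.
move=> cK ch hk cK' cp cm; have [M1 dp1] := ccf_dom cK' cp.
have [M2 dm2] := ccf_dom cK' cm.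
have dp : dom (Num.max M1 M2) p by apply: (dom_le _ dp1); rewrite le_max lexx.
have dm : dom (Num.max M1 M2) m.
  by apply: (dom_le _ dm2); rewrite le_max lexx orbT.
have dpn := dom_iterU n dp; have dmn := dom_iterU n dm.
have rn : 0 <= r ^- n by rewrite invr_ge0 exprn_ge0 // ltW.
rewrite /int_rw_op.
have -> : (\int[kappa]_x iter n (rw_op v) (EFin \o (p \- m)%R) x =
    \int[kappa]_x (r ^- n * iter n U p x - r ^- n * iter n U m x)%:E)%E.
  by apply: eq_integral => x _; rewrite (iter_rw_op_diff n x dp dm) mulrBr.
have Ik k : dom (Num.max M1 M2) k ->
    (\int[kappa]_x (r ^- n * k x)%:E = (r ^- n * pairing h k)%:E)%E.
  move=> dk; have nk := dom_nnm dk; rewrite EFinM (pair_EFin cK ch dk).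
  rewrite -[in RHS](_ : (\int[kappa]_x (k x)%:E = \int[pi]_x (h x * k x)%:E)%E).
    rewrite -(mf_Z (mf_integral kappa) rn nk).
    by apply: eq_integral => x _; rewrite EFinM.
  by rewrite (integral_density cK ch hk nk); apply: eq_integral => x _; rewrite EFinM.
have nn k : dom (Num.max M1 M2) k -> nnm (EFin \o (fun y => r ^- n * k y)).
  by move=> dk; exact: (nnmZ rn (dom_nnm dk)).
by rewrite (integral_diff (nn _ dpn) (nn _ dmn) (Ik _ dpn) (Ik _ dmn)) /= -mulrBr.
Qed.

Section pairing_limit.
Variable nu : {measure set E -> \bar R}.
Hypothesis hB : unique_invariant_measure v r nu.
Variable K0 : set E.
Hypothesis cK0 : compact K0.
Hypothesis pK0 : (0 < pi K0)%E.
Let a n := ret K0 n.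
Hypothesis a_sub : forall q, 0 < q < 1 ->
  exists n0, forall n, (n0 <= n)%N -> q ^+ n <= a n.
Variable F : set_system nat.
Context {FF : Filter F}.
Hypothesis Foo : \oo `<=` F.
Hypothesis Fj : forall j e, 0 < e ->
  \forall n \near F, `|a (n + j)%N - a n| <= e * a n.
Let Z := mass (wmul phi \1_K0) * vmass \1_K0.

(** If the bound by [e] failed along [F], then [F] and the complement of [A] would lie in a common
    ultrafilter [H]. The limit along [H] exists and equals [y] by [form_unique], so [H] would
    contain [A] as well. *)
Lemma pair_limit K c h K' c' f : compact K -> ccf K c h ->
  compact K' -> ccf K' c' f ->
  pairing h (iter n U f) / a n @[n --> F] --> mass (wmul phi h) * vmass f / Z.
Proof.
move=> cK ch cK' cf; set y := _ / Z; apply/cvgrPdist_le => e e0.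
pose A : set nat := fun n => `|y - pairing h (iter n U f) / a n| <= e.
change (F A); apply: contrapT => nFA.
pose G := within (~` A) F.
have GF : F `<=` G by move=> B; apply: filterS => n Bn _.
have PG : ProperFilter G.
  apply: Build_ProperFilter_ex => B GB; apply: contrapT => /forallNP nB.
  by apply: nFA; apply: (@filterS _ F _ _ _ _ GB) => n h1; apply: contrapT => /h1/nB.
have [H [HU GH]] := ultraFilterLemma PG.
have Hoo : \oo `<=` H by move=> B /Foo/GF/GH.
have Hj j e' : 0 < e' -> \forall n \near H, `|a (n + j)%N - a n| <= e' * a n.
  by move=> /(Fj j)/GF/GH.
have cv := limform_cvg cK0 pK0 a_sub HU Hoo Hj cK ch cK' cf.
have := form_unique hB cK0 pK0
  (fun _ _ _ c1 c2 => limform_acr cK0 pK0 a_sub HU Hoo Hj c1 c2)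
  (fun _ _ _ c1 c2 => limform_acl cK0 pK0 a_sub HU Hoo Hj c1 c2)
  (fun _ _ _ _ _ _ c1 c2 c3 c4 =>
     limformU cK0 pK0 a_sub HU Hoo Hj c1 c2 c3 c4)
  (fun _ _ _ _ _ _ b c1 c2 c3 c4 =>
     limform_ltrans cK0 pK0 a_sub HU Hoo Hj b c1 c2 c3 c4)
  cK ch cK' cf (limform1 a_sub HU Hoo).
rewrite -/Z -/y => ly; rewrite {}ly in cv.
have HA : H A by move/cvgrPdist_le : cv => /(_ e e0).
have HnA : H (~` A) by apply: GH; exact: withinT.
have HP : ProperFilter H by exact: ultra_proper.
by have [n []] := filter_ex (filterI HA HnA).
Qed.

Lemma ret_gt0_near : \forall n \near F, 0 < a n.
Proof.
have h2 : 0 < (2^-1 : R) < 1 by apply/andP; split; lra.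
have [n0 H] := a_sub h2; apply: Foo; exists n0 => // n /= /H; apply: lt_le_trans.
by rewrite exprn_gt0 // invr_gt0.
Qed.

(** The delay [j] is moved into the function: [U^j] preserves [vmass], so the limit is the same for
    all [j] while the denominator stays [a n]. *)
Lemma scaled_limit (kappa : probability E R) K c h K' c' (p m : E -> R) j : compact K ->
  ccf K c h -> has_density kappa pi h -> compact K' -> ccf K' c' p ->
  ccf K' c' m ->
  r ^+ (n + j)%N * int_rw_op v kappa (n + j)%N (p \- m) / a n @[n --> F] -->
  mass (wmul phi h) * (vmass p - vmass m) / Z.
Proof.
move=> cK ch hk cK' cp cm.
have vj k : ccf K' c' k -> exists K1 c1, [/\ compact K1, ccf K1 c1 (iter j U k) &
    vmass (iter j U k) = vmass k].
  move=> ck; elim: j => [|i [K1 [c1 [cK1 ck1 e1]]]]; first by exists K', c'.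
  have [K2 [c2 [cK2 ck2]]] := ccf_U cK1 ck1.
  by exists K2, c2; split => //=; rewrite (vmassU cK1 ck1).
have [K1 [c1 [cK1 cp1 <-]]] := vj _ cp; have [K2 [c2 [cK2 cm2 <-]]] := vj _ cm.
rewrite mulrBr mulrBl.
apply: cvg_ext (cvgB (pair_limit cK ch cK1 cp1) (pair_limit cK ch cK2 cm2)) => n.
rewrite (int_rw_op_diff _ cK ch hk cK' cp cm) !iterD /=.
have rn : 0 < r ^+ (n + j) by rewrite exprn_gt0.
by rewrite mulrA divff ?mul1r ?gt_eqF // mulrBl.
Qed.

End pairing_limit.

Lemma bounded_split f : bounded_borel f -> vanishes_off_compact f ->
  exists K c p m, [/\ compact K, ccf K c p, ccf K c m & f = p \- m].
Proof.
move=> [mf [M fM]] [K cK fK].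
exists K, M, (fun x => Num.max (f x) 0), (fun x => Num.max (- f x) 0).
have M0 : 0 <= M by apply: le_trans (fM 1%g).
have bd x : - M <= f x <= M by rewrite -ler_norml.
split => //.
- split; first exact: measurable_maxr.
  + move=> x; have /andP[_ ?] := bd x.
    by rewrite le_max lexx orbT /= ge_max M0 andbT.
  + by move=> x /fK ->; rewrite maxxx.
- split.
  + by apply: measurable_maxr => //; exact: measurableT_comp.
  + move=> x; have /andP[? _] := bd x.
    by rewrite le_max lexx orbT /= ge_max M0 andbT lerNl.
  + by move=> x /fK ->; rewrite oppr0 maxxx.
- apply/funext => x /=; case: (leP (f x) 0) => f0.
    by rewrite max_l ?oppr_ge0 // sub0r opprK.
  by rewrite max_r ?subr0 // oppr_le0 ltW.
Qed.

Lemma S0_ccf h : S0 pi h ->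
  exists K c, compact K /\ ccf K c h.
Proof.
move=> [[mh [M hM]] h0 pc _].
exists (closure [set x | 0 < h x]), M; split; first by rewrite -precompactE.
split => //.
  by move=> x; rewrite h0 /=; apply: le_trans (hM x); exact: ler_norm.
move=> x nx; apply/eqP; rewrite eq_le h0 andbT leNgt; apply/negP => hx.
by apply: nx; exact: subset_closure.
Qed.

End walk_analysis.

Theorem theorem2 (R : realType) (d : measure_display) (E : borelGroupType d)
    (pi : {measure set E -> \bar R}) (v : probability E R)
    (r : R) (nu : {measure set E -> \bar R}) (phi : E -> R)
    (E_lc : lc_group_countable_base E)
    (E_unimodular : unimodular E R)
    (pi_haar : right_haar pi)
    (v_compact : compactly_supported v)
    (r_conv : convergence_parameter v pi r%:E)
    (hA : conditionA v pi)
    (hB : unique_invariant_measure v r nu)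
    (phi_cont : continuous phi)
    (phi_exp : exponential phi)
    (phi_int : (\int[v]_x (phi x)%:E)%E = (r^-1)%:E) :
  exists N : set nat,
    [/\ (forall n, N n -> (0 < n)%N),
        density_zero R N &
        forall (f g : E -> R) (kappa mu : probability E R),
          bounded_borel f -> vanishes_off_compact f ->
          bounded_borel g -> vanishes_off_compact g ->
          \int[nu]_x g x != 0 ->
          (exists2 h, S0 pi h & has_density kappa pi h) ->
          (exists2 h, S0 pi h & has_density mu pi h) ->
          let L := ((\int[kappa]_x phi x) * (\int[pi]_x ((phi x)^-1 * f x)))
                   / ((\int[mu]_x phi x) * (\int[pi]_x ((phi x)^-1 * g x))) in
          [/\ (fun n => int_rw_op v kappa n f / int_rw_op v mu n g)
                @ within (~` N) \oo --> L,
              L = ((\int[kappa]_x phi x) * (\int[nu]_x f x))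
                  / ((\int[mu]_x phi x) * (\int[nu]_x g x)) &
              forall m : nat, (1 <= m)%N ->
                (fun n => int_rw_op v mu (n + m) g / int_rw_op v mu n g)
                  @ within (~` N) \oo --> (r ^+ m)^-1]].

Proof.
have [r0 _ _] : invariant_measure v r nu by case: hB.
have [pi_pos pi_fin pi_r] := pi_haar.
have [_ _ pi_l] : left_haar pi by exact/E_unimodular.
have W : walk_setting v pi r phi by split.
have [K0 [cK0 pK0 a_sub]] := ret_subexponential W r_conv.
have ci0 := ccf_indic W cK0; have [M0 dM0] := indic_dom W cK0.
have [C a_le] := ret_bounded W cK0.
(* The exceptional set is read off from the return sequence of [K0] alone, so one [N] serves all
   functions and all initial laws. *)
have [del del01|N [N0 Nd HN]] := ratio_limit_set a_le a_sub.
  have [t Ht] := posfun_superinvariant W del01; exists t => s st.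
  exact: Ht s st _ _ _ (posfun_pair W cK0 ci0) dM0.
exists N; split => //.
pose F := within (~` N) (\oo : set_system nat).
have HF : Filter F by exact: within_filter.
have Foo : \oo `<=` F by move=> A; apply: filterS => n An _.
have Fj j e : 0 < e -> \forall n \near F,
    `|ret v pi r K0 (n + j)%N - ret v pi r K0 n| <= e * ret v pi r K0 n.
  by move=> /(HN j)[n0 Hn0]; exists n0 => // n /= ln nN; exact: Hn0.
move=> f g kappa mu bf cf bg cg nug [h1 S1 d1] [h2 S2 d2] L.
have [K1 [c1 [cK1 ch1]]] := S0_ccf S1; have [K2 [c2 [cK2 ch2]]] := S0_ccf S2.
have [Kf [cf' [pf [mf [cKf cpf cmf fE]]]]] := bounded_split bf cf.
have [Kg [cg' [pg [mg [cKg cpg cmg gE]]]]] := bounded_split bg cg.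
have [b b0 Hb] := invariant_measure_vmass W hB cK0 pK0.
pose D p m := vmass pi phi p - vmass pi phi m.
pose Mh h := mass pi (wmul phi h).
have phiE (kap : probability E R) K c h : compact K -> ccf K c h ->
    has_density kap pi h -> \int[kap]_x phi x = Mh h.
  move=> cK ch hd; rewrite /Rintegral (integral_density cK ch hd (nnm_phi W)).
  by congr fine; apply: eq_integral => x _; rewrite -EFinM mulrC.
have nuE K c p m : compact K -> ccf K c p -> ccf K c m ->
    \int[nu]_x (p \- m) x = b * D p m.
  move=> cK cp cm; rewrite /Rintegral.
  rewrite (integral_diff (ccf_nnm cp) (ccf_nnm cm) (Hb _ _ _ cK cp) (Hb _ _ _ cK cm)).
  by rewrite -mulrBr.
have piE K c p m : compact K -> ccf K c p -> ccf K c m ->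
    \int[pi]_x ((phi x)^-1 * (p \- m) x) = D p m.
  move=> cK cp cm; rewrite /Rintegral.
  have [c3 cwp] := ccf_wmul (weight_phiV W) cK cp.
  have [c4 cwm] := ccf_wmul (weight_phiV W) cK cm.
  rewrite -[RHS](congr1 fine (integral_diff (ccf_nnm cwp) (ccf_nnm cwm)
    (mass_EFin W cK cwp) (mass_EFin W cK cwm))).
  by congr fine; apply: eq_integral => x _; rewrite -mulrBr.
have Dg0 : D pg mg != 0.
  by move: nug; rewrite gE (nuE _ _ _ _ cKg cpg cmg) mulf_eq0 negb_or => /andP[].
have Mh0 K c h : compact K -> ccf K c h -> S0 pi h -> 0 < Mh h.
  move=> cK ch [_ _ _ hp]; have [c3 cw] := ccf_wmul (weight_phi W) cK ch.
  apply: (mass_gt0 W cK cw); rewrite (_ : [set x | _] = [set x | 0 < h x]) //.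
  by apply/seteqP; split => x /=; rewrite pmulr_rgt0 // (phi_gt0 W).
have M1 := Mh0 _ _ _ cK1 ch1 S1; have M2 := Mh0 _ _ _ cK2 ch2 S2.
have LE : L = Mh h1 * D pf mf / (Mh h2 * D pg mg).
  by rewrite /L fE gE (phiE _ _ _ _ cK1 ch1 d1) (phiE _ _ _ _ cK2 ch2 d2)
    (piE _ _ _ _ cKf cpf cmf) (piE _ _ _ _ cKg cpg cmg).
set Z := mass pi (wmul phi \1_K0) * vmass pi phi \1_K0.
have Z0 : 0 < Z.
  rewrite mulr_gt0 ?(vmass_gt0 W cK0 pK0) // (wmul_gt0 W cK0 pK0) //.
    exact: weight_phi W.
  exact: phi_gt0 W.
have a0 := ret_gt0_near a_sub Foo.
have lim1 := scaled_limit (FF := HF) W hB cK0 pK0 a_sub Foo Fj 0 cK1 ch1 d1 cKf cpf cmf.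
have lim2 j := scaled_limit (FF := HF) W hB cK0 pK0 a_sub Foo Fj j cK2 ch2 d2 cKg cpg cmg.
have G0 : Mh h2 * D pg mg / Z != 0.
  by rewrite !mulf_neq0 ?invr_eq0 ?(gt_eqF M2) ?(gt_eqF Z0).
(* Used with [s = r ^+ n] and [t] the return sequence at [n]: the normalization common to numerator
   and denominator drops out. *)
have cancel (s x y t : R) : s / t != 0 -> (s * x / t) * (s * y / t)^-1 = x / y.
  by move=> st; rewrite [s * x / t]mulrAC [s * y / t]mulrAC -mulf_div divff // mul1r.
split.
- rewrite LE.
  have -> : Mh h1 * D pf mf / (Mh h2 * D pg mg) =
      (Mh h1 * D pf mf / Z) / (Mh h2 * D pg mg / Z).
    by field; rewrite Dg0 (gt_eqF M2) (gt_eqF Z0).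
  apply: cvg_trans (cvgM lim1 (cvgV G0 (lim2 0%N))).
  apply: near_eq_cvg; apply: filterS a0 => n an /=.
  by rewrite addn0 fE gE cancel // gt_eqF // divr_gt0 // exprn_gt0.
- rewrite LE fE gE (phiE _ _ _ _ cK1 ch1 d1) (phiE _ _ _ _ cK2 ch2 d2).
  rewrite (nuE _ _ _ _ cKf cpf cmf) (nuE _ _ _ _ cKg cpg cmg).
  by field; rewrite Dg0 (gt_eqF M2) (gt_eqF b0).
- move=> m _.
  have -> : (r ^+ m)^-1 =
      (r ^+ m)^-1 * ((Mh h2 * D pg mg / Z) / (Mh h2 * D pg mg / Z)).
    by rewrite divff ?mulr1.
  (* Both scaled sequences are divided by the same term of the return sequence and have the same
     limit; only the surplus factor [r ^+ m] survives. *)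
  apply: cvg_trans (cvgMl_tmp (cvgM (lim2 m) (cvgV G0 (lim2 0%N)))).
  apply: near_eq_cvg; apply: filterS a0 => n an /=.
  have rm : r ^+ m != 0 by rewrite expf_neq0 // gt_eqF.
  have cancel_pow (u s x y t : R) : u != 0 -> s / t != 0 ->
      u^-1 * ((s * u * x / t) * (s * y / t)^-1) = x / y.
    move=> u0 st; rewrite -(cancel s x y t st) mulrA; congr (_ * _).
    by rewrite (mulrC s u) -!mulrA mulKf.
  rewrite addn0 exprD -gE cancel_pow ?expf_neq0 ?gt_eqF //.
  by rewrite divr_gt0 // exprn_gt0.
Qed.
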